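(* Let $s\ge s_0>1/2$, $T>0$, and let $(u_l^{\mathfrak p},u_r^{\mathfrak p})$ be strong solutions on $[0,T)$, depending on the parameters $(\mu,\epsilon,\delta,\gamma)=\mathfrak p\in\mathcal P$, of the coupled system $$\partial_tu_l+\partial_xu_l+f_l^{\epsilon,\mu}(u_l,u_r)=0,\qquad \partial_tu_r-\partial_xu_r+f_r^{\epsilon,\mu}(u_l,u_r)=0,$$ where $$\begin{aligned}f_l^{\epsilon,\mu}=\ &\epsilon\tfrac{\alpha_1}2\partial_x\big((u_l+\tfrac13u_r)(u_l-u_r)\big)+\epsilon^2\tfrac{\alpha_2}3\partial_x\big((u_l-u_r)u_l(u_l+u_r)\big)+\epsilon^3\tfrac{\alpha_3}4\partial_x\big((u_l-\tfrac15u_r)(u_l-u_r)(u_l+u_r)^2\big)\\&-\mu\nu\partial_x^2\partial_t(u_l-u_r)+\mu\epsilon\kappa_3\partial_x\Big(\tfrac13(u_l-u_r)(\partial_x^2u_l-\partial_x^2u_r)+\tfrac12(\partial_xu_l-\partial_xu_r)^2\Big)\\&-\mu\epsilon\,\partial_t\Big[\kappa_1(u_l\partial_x^2u_l-u_r\partial_x^2u_r)+\kappa_2(u_r\partial_x^2u_l-u_l\partial_x^2u_r)+(\kappa_1+\tfrac{\kappa_2}2)\big((\partial_xu_l)^2-(\partial_xu_r)^2\big)\Big],\end{aligned}$$ $$\begin{aligned}f_r^{\epsilon,\mu}=\ &-\epsilon\tfrac{\alpha_1}2\partial_x\big((\tfrac13u_l+u_r)(u_r-u_l)\big)-\epsi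lon^2\tfrac{\alpha_2}3\partial_x\big((u_r-u_l)u_r(u_l+u_r)\big)-\epsilon^3\tfrac{\alpha_3}4\partial_x\big((u_r-\tfrac15u_l)(u_r-u_l)(u_l+u_r)^2\big)\\&-\mu\nu\partial_x^2\partial_t(u_r-u_l)-\mu\epsilon\kappa_3\partial_x\Big(\tfrac13(u_r-u_l)(\partial_x^2u_r-\partial_x^2u_l)+\tfrac12(\partial_xu_r-\partial_xu_l)^2\Big)\\&-\mu\epsilon\,\partial_t\Big[\kappa_1(u_r\partial_x^2u_r-u_l\partial_x^2u_l)+\kappa_2(u_l\partial_x^2u_r-u_r\partial_x^2u_l)+(\kappa_1+\tfrac{\kappa_2}2)\big((\partial_xu_r)^2-(\partial_xu_l)^2\big)\Big],\end{aligned}$$ with $$\alpha_1=\frac32\frac{\delta^2-\gamma}{\gamma+\delta},\quad\alpha_2=-3\frac{\gamma\delta(\delta+1)^2}{(\gamma+\delta)^2},\quad\alpha_3=-5\frac{\delta^2(\delta+1)^2\gamma(1-\gamma)}{(\gamma+\delta)^3},\quad\nu=\frac16\frac{1+\gamma\delta}{\delta(\delta+\gamma)},$$ $$\kappa_1=\frac{(1+\gamma\delta)(\delta^2-\gamma)}{3\delta(\gamma+\delta)^2},\quad\kappa_2=\frac{1-\gamma}{3(\gamma+\delta)},\quad\kappa_3=\frac{\gamma-1}{2(\gamma+\delta)}.$$ Assume that $u_l^{\mathfrak p},u_r^{\mathfrak p}\in W^{1}([0,T);H^{s+3}(\mathbb R))$, uniformly in $\mathfrak p$, and that there exists $h>0$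 such that $$h_1^{\mathfrak p}\equiv1-\epsilon(u_l^{\mathfrak p}+u_r^{\mathfrak p})\ge h>0,\qquad h_2^{\mathfrak p}\equiv\frac1\delta+\epsilon(u_l^{\mathfrak p}+u_r^{\mathfrak p})\ge h>0.$$ Then $(\zeta^{\mathfrak p},\bar v^{\mathfrak p})\equiv\big(u_l^{\mathfrak p}+u_r^{\mathfrak p},(\gamma+\delta)(u_l^{\mathfrak p}-u_r^{\mathfrak p})\big)$ is consistent with the Green-Naghdi system (GN) of order $s$ on $[0,T)$, at precision $\mathcal O(\mu\epsilon^2+\epsilon^4)$.
   Context: Parameters: for fixed positive finite $\mu_{\max},\epsilon_{\max},\delta_{\min},\delta_{\max}$, $$\mathcal P=\{(\mu,\epsilon,\delta,\gamma):\ 0\le\mu\le\mu_{\max},\ 0\le\epsilon\le\epsilon_{\max},\ \delta\in(\delta_{\min},\delta_{\max}),\ 0\le\gamma<1\}.$$ $C(\lambda_1,\lambda_2,\dots)$ denotes a positive constant depending on the indicated quantities, nondecreasing in each. $H^s=H^s(\mathbb R)$ is the $L^2$-based Sobolev space; $W^{1}([0,T);H^{s+1})$ is the space of $f\in L^\infty([0,T);H^{s+1})$ with $\partial_tf\in L^\infty([0,T);H^s)$, with norm $\|f\|_{L^\infty([0,T);H^{s+1})}+\|\partial_tf\|_{L^\infty([0,T);H^s)}$. Green-Naghdi system (GN), with unknowns $(\zeta,v)$ and $h_1=1-\epsilon\zeta$, $h_2=\frac1\delta+\epsilon\zeta$: $$\partial_t\zeta+\partial_x\Big(\frac{h_1h_2}{h_1+\gamma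 h_2}v\Big)=0,$$ $$\partial_t\big(v+\mu\overline{\mathcal Q}[h_1,h_2]v\big)+(\gamma+\delta)\partial_x\zeta+\frac\epsilon2\partial_x\Big(\frac{h_1^2-\gamma h_2^2}{(h_1+\gamma h_2)^2}|v|^2\Big)=\mu\epsilon\,\partial_x\big(\overline{\mathcal R}[h_1,h_2]v\big),$$ where $$\overline{\mathcal Q}[h_1,h_2]V=\frac{-1}{3h_1h_2}\Big(h_1\partial_x\big(h_2^3\partial_x(\tfrac{h_1V}{h_1+\gamma h_2})\big)+\gamma h_2\partial_x\big(h_1^3\partial_x(\tfrac{h_2V}{h_1+\gamma h_2})\big)\Big),$$ $$\overline{\mathcal R}[h_1,h_2]V=\frac12\Big(\big(h_2\partial_x(\tfrac{h_1V}{h_1+\gamma h_2})\big)^2-\gamma\big(h_1\partial_x(\tfrac{h_2V}{h_1+\gamma h_2})\big)^2\Big)+\frac13\frac{V}{h_1+\gamma h_2}\Big(\frac{h_1}{h_2}\partial_x\big(h_2^3\partial_x(\tfrac{h_1V}{h_1+\gamma h_2})\big)-\gamma\frac{h_2}{h_1}\partial_x\big(h_1^3\partial_x(\tfrac{h_2V}{h_1+\gamma h_2})\big)\Big).$$ Consistency: let $(\zeta^{\mathfrak p},v^{\mathfrak p})_{\mathfrak p\in\mathcal P}$ be a family of pairs of functions uniformly bounded in $L^\infty([0,T);H^{s+\bar s})$ (for some $\bar s\ge0$ to be determined). It is consistent with (GN) at precision $\mathcal O(\eta)$, of order $s$ and on $[0,T)$, if, for $\eta=\eta^{\mathfrak p}$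 sufficiently small, it satisfies the two equations of (GN) (all terms on the left-hand side) with right-hand sides $\eta\,r_1$ and $\eta\,r_2$ respectively, where $$\|(r_1,r_2)\|_{L^\infty([0,T);H^s)^2}\le C\big(\mu_{\max},\epsilon_{\max},1/\delta_{\min},\delta_{\max},\|\zeta^{\mathfrak p}\|_{L^\infty([0,T);H^{s+\bar s})},\|v^{\mathfrak p}\|_{L^\infty([0,T);H^{s+\bar s})}\big).$$ *)

(* Defs.v *)
From HB Require Import structures.
From mathcomp Require Import all_boot all_order all_algebra.
From mathcomp Require Import all_classical all_reals all_analysis ess_sup_inf.

Set Implicit Arguments.
Unset Strict Implicit.
Unset Printing Implicit Defensive.

Import Order.TTheory GRing.Theory Num.Theory.
Import numFieldNormedType.Exports.

Local Open Scope classical_set_scope.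
Local Open Scope ring_scope.

(* Functions of time and space are curried, time first: [f t x]. *)

Section Sobolev.
Variable R : realType.
Local Notation leb := (@lebesgue_measure R).

(* The Fourier transform of the real function f is [a - i b], i.e.
   f(x) = (2 pi)^(-1/2) int e^(i x xi) (a - i b)(xi) dxi; it is Hermitian since
   f is real.  As f is given by an absolutely convergent integral at every
   point, it is the continuous representative of its class. *)
Definition fourier_pair (f a b : R -> R) : Prop :=
  [/\ leb.-integrable setT (EFin \o a), leb.-integrable setT (EFin \o b),
      forall xi, a (- xi) = a xi, forall xi, b (- xi) = - b xi
    & forall x, f x = (Num.sqrt (2 * pi))^-1 *
        \int[leb]_(xi in setT) (a xi * cos (x * xi) + b xi * sin (x * xi))].

(* || <xi>^s f^ ||_{L^2}, which is +oo when f is not in H^s.  The pair (a, b) is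
   determined by f up to null sets, so the infimum ranges over at most one
   value.  For s > 1/2 (the only case in use), <xi>^s f^ in L^2 makes f^
   integrable, so that the integrability required in [fourier_pair] excludes no
   element of H^s. *)
Definition Hs_norm (s : R) (f : R -> R) : \bar R :=
  ereal_inf [set N | exists a b, fourier_pair f a b /\
    N = Lnorm leb 2%:E (fun xi =>
          (Num.sqrt ((1 + xi ^+ 2) `^ s * (a xi ^+ 2 + b xi ^+ 2)))%:E)].

Definition ae_time (T : R) (P : R -> Prop) : Prop :=
  {ae leb, forall t, t \in `[0, T[ -> P t}.

Definition LinfH_norm (T s : R) (f : R -> R -> R) : \bar R :=
  ess_sup leb ((fun t => Hs_norm s (f t)) \_ `[0, T[).

(* An element of L^oo([0,T);H^s) is given by a representative with values in H^s
   at every time.  Point evaluations span a dense subspace of the dual of H^s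
   (s > 1/2), hence by Pettis' theorem measurability at each x is strong
   measurability of t |-> f t. *)
Definition in_LinfH (T s : R) (f : R -> R -> R) : Prop :=
  [/\ forall x, measurable_fun `[0, T[ (f ^~ x),
      forall t, t \in `[0, T[ -> (Hs_norm s (f t) < +oo)%E
    & (LinfH_norm T s f < +oo)%E].

Definition test_function (T : R) (phi : R -> R) : Prop :=
  (forall n t, derivable (derive1n n phi) t 1) /\
  (exists a b, [/\ 0 < a, b < T & forall t, t \notin `[a, b] -> phi t = 0]).

(* Weak time derivative on (0,T), tested at each x.  The continuity in x makes g
   unique in the sense that two weak derivatives agree for a.e. t and all x. *)
Definition is_dt (T : R) (f g : R -> R -> R) : Prop :=
  [/\ ae_time T (fun t => continuous (g t)),
      forall x, leb.-integrable `[0, T[ (EFin \o f ^~ x),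
      forall x, leb.-integrable `[0, T[ (EFin \o g ^~ x)
    & forall x phi, test_function T phi ->
        \int[leb]_(t in `[0, T[) (f t x * derive1 phi t) =
        - \int[leb]_(t in `[0, T[) (g t x * phi t)].

Definition has_dt (T : R) (f : R -> R -> R) : Prop := exists g, is_dt T f g.

Definition dt (T : R) (f : R -> R -> R) : R -> R -> R :=
  xget (fun _ _ => 0) [set g | is_dt T f g].

(* W^1([0,T);H^s) : f in L^oo([0,T);H^s), d_t f in L^oo([0,T);H^(s-1)). *)
Definition in_W1 (T s : R) (f : R -> R -> R) : Prop :=
  in_LinfH T s f /\ exists2 g, is_dt T f g & in_LinfH T (s - 1) g.

Definition W1_norm (T s : R) (f : R -> R -> R) : \bar R :=
  (LinfH_norm T s f + LinfH_norm T (s - 1) (dt T f))%E.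

Definition dx (f : R -> R -> R) : R -> R -> R := fun t x => derive1 (f t) x.

End Sobolev.

Record param (R : Type) :=
  Param { mu_of : R; eps_of : R; delta_of : R; gamma_of : R }.

Definition in_params (R : realType) (mumax epsmax deltamin deltamax : R)
    (p : param R) : Prop :=
  [/\ 0 <= mu_of p <= mumax, 0 <= eps_of p <= epsmax,
      deltamin < delta_of p < deltamax & 0 <= gamma_of p < 1].

Section Models.
Variables (R : realType) (p : param R).
Local Notation mu := (mu_of p).
Local Notation eps := (eps_of p).
Local Notation delta := (delta_of p).
Local Notation gamma := (gamma_of p).

Definition h1 (zeta : R -> R -> R) : R -> R -> R :=
  fun t x => 1 - eps * zeta t x.
Definition h2 (zeta : R -> R -> R) : R -> R -> R :=
  fun t x => delta^-1 + eps * zeta t x.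

Definition GN_Q (h1 h2 V : R -> R -> R) : R -> R -> R :=
  let A := fun t x => h1 t x * V t x / (h1 t x + gamma * h2 t x) in
  let B := fun t x => h2 t x * V t x / (h1 t x + gamma * h2 t x) in
  fun t x => - 1 / (3 * h1 t x * h2 t x) *
    (h1 t x * dx (fun t x => h2 t x ^+ 3 * dx A t x) t x
     + gamma * h2 t x * dx (fun t x => h1 t x ^+ 3 * dx B t x) t x).

Definition GN_R (h1 h2 V : R -> R -> R) : R -> R -> R :=
  let A := fun t x => h1 t x * V t x / (h1 t x + gamma * h2 t x) in
  let B := fun t x => h2 t x * V t x / (h1 t x + gamma * h2 t x) in
  fun t x =>
    1 / 2 * ((h2 t x * dx A t x) ^+ 2 - gamma * (h1 t x * dx B t x) ^+ 2)
    + 1 / 3 * (V t x / (h1 t x + gamma * h2 t x)) *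
      (h1 t x / h2 t x * dx (fun t x => h2 t x ^+ 3 * dx A t x) t x
       - gamma * (h2 t x / h1 t x)
           * dx (fun t x => h1 t x ^+ 3 * dx B t x) t x).

(* (zeta, v) satisfies the Green-Naghdi system on [0,T) with right-hand sides
   g1 and g2, all the terms of the system being on the left-hand side. *)
Definition GN_with_rhs (T : R) (zeta v g1 g2 : R -> R -> R) : Prop :=
  let h1 := h1 zeta in
  let h2 := h2 zeta in
  let w := fun t x => v t x + mu * GN_Q h1 h2 v t x in
  [/\ has_dt T zeta, has_dt T w
    & ae_time T (fun t => forall x,
        dt T zeta t x
        + dx (fun t x =>
            h1 t x * h2 t x / (h1 t x + gamma * h2 t x) * v t x) t x
        = g1 t x
        /\
        dt T w t x + (gamma + delta) * dx zeta t x
        + eps / 2 * dx (fun t x =>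
            (h1 t x ^+ 2 - gamma * h2 t x ^+ 2)
              / (h1 t x + gamma * h2 t x) ^+ 2 * `|v t x| ^+ 2) t x
        - mu * eps * dx (GN_R h1 h2 v) t x
        = g2 t x)].

Definition alpha1 : R := 3 / 2 * ((delta ^+ 2 - gamma) / (gamma + delta)).
Definition alpha2 : R :=
  - 3 * (gamma * delta * (delta + 1) ^+ 2 / (gamma + delta) ^+ 2).
Definition alpha3 : R :=
  - 5 * (delta ^+ 2 * (delta + 1) ^+ 2 * gamma * (1 - gamma)
         / (gamma + delta) ^+ 3).
Definition nu : R := 1 / 6 * ((1 + gamma * delta) / (delta * (delta + gamma))).
Definition kappa1 : R :=
  (1 + gamma * delta) * (delta ^+ 2 - gamma)
  / (3 * delta * (gamma + delta) ^+ 2).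
Definition kappa2 : R := (1 - gamma) / (3 * (gamma + delta)).
Definition kappa3 : R := (gamma - 1) / (2 * (gamma + delta)).

Definition f_l (T : R) (ul ur : R -> R -> R) : R -> R -> R := fun t x =>
  eps * (alpha1 / 2) * dx (fun t x =>
    (ul t x + 1 / 3 * ur t x) * (ul t x - ur t x)) t x
  + eps ^+ 2 * (alpha2 / 3) * dx (fun t x =>
    (ul t x - ur t x) * ul t x * (ul t x + ur t x)) t x
  + eps ^+ 3 * (alpha3 / 4) * dx (fun t x =>
    (ul t x - 1 / 5 * ur t x) * (ul t x - ur t x) * (ul t x + ur t x) ^+ 2) t x
  - mu * nu * dx (dx (dt T (fun t x => ul t x - ur t x))) t x
  + mu * eps * kappa3 * dx (fun t x =>
    1 / 3 * (ul t x - ur t x) * (dx (dx ul) t x - dx (dx ur) t x)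
    + 1 / 2 * (dx ul t x - dx ur t x) ^+ 2) t x
  - mu * eps * dt T (fun t x =>
    kappa1 * (ul t x * dx (dx ul) t x - ur t x * dx (dx ur) t x)
    + kappa2 * (ur t x * dx (dx ul) t x - ul t x * dx (dx ur) t x)
    + (kappa1 + kappa2 / 2) * (dx ul t x ^+ 2 - dx ur t x ^+ 2)) t x.

Definition f_r (T : R) (ul ur : R -> R -> R) : R -> R -> R := fun t x =>
  - (eps * (alpha1 / 2) * dx (fun t x =>
    (1 / 3 * ul t x + ur t x) * (ur t x - ul t x)) t x)
  - eps ^+ 2 * (alpha2 / 3) * dx (fun t x =>
    (ur t x - ul t x) * ur t x * (ul t x + ur t x)) t x
  - eps ^+ 3 * (alpha3 / 4) * dx (fun t x =>
    (ur t x - 1 / 5 * ul t x) * (ur t x - ul t x) * (ul t x + ur t x) ^+ 2) t x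
  - mu * nu * dx (dx (dt T (fun t x => ur t x - ul t x))) t x
  - mu * eps * kappa3 * dx (fun t x =>
    1 / 3 * (ur t x - ul t x) * (dx (dx ur) t x - dx (dx ul) t x)
    + 1 / 2 * (dx ur t x - dx ul t x) ^+ 2) t x
  - mu * eps * dt T (fun t x =>
    kappa1 * (ur t x * dx (dx ur) t x - ul t x * dx (dx ul) t x)
    + kappa2 * (ul t x * dx (dx ur) t x - ur t x * dx (dx ul) t x)
    + (kappa1 + kappa2 / 2) * (dx ur t x ^+ 2 - dx ul t x ^+ 2)) t x.

(* [in_W1 T (s + 3)] for ul and ur, with s > 1/2, guarantees that every
   derivative occurring here exists. *)
Definition strong_solution (T : R) (ul ur : R -> R -> R) : Prop :=
  ae_time T (fun t => forall x,
    dt T ul t x + dx ul t x + f_l T ul ur t x = 0 /\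
    dt T ur t x - dx ur t x + f_r T ul ur t x = 0).

End Models.

Section Consistency.
Variable R : realType.

(* The constants C(l1, ..., l6), for nonnegative arguments. *)
Definition positive_nondecreasing6 (C : R -> R -> R -> R -> R -> R -> R) : Prop :=
  (forall a1 a2 a3 a4 a5 a6,
    0 <= a1 -> 0 <= a2 -> 0 <= a3 -> 0 <= a4 -> 0 <= a5 -> 0 <= a6 ->
    0 < C a1 a2 a3 a4 a5 a6) /\
  (forall a1 a2 a3 a4 a5 a6 b1 b2 b3 b4 b5 b6,
    0 <= a1 <= b1 -> 0 <= a2 <= b2 -> 0 <= a3 <= b3 ->
    0 <= a4 <= b4 -> 0 <= a5 <= b5 -> 0 <= a6 <= b6 ->
    C a1 a2 a3 a4 a5 a6 <= C b1 b2 b3 b4 b5 b6).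

(* The existentially quantified data "sbar >= 0 to be determined" and "C" of the
   notion are arguments here, so that a statement can say on what they depend.
   The norms of zeta and v are finite by the first condition. *)
Definition consistent_with_GN (mumax epsmax deltamin deltamax : R)
    (sbar : R) (C : R -> R -> R -> R -> R -> R -> R)
    (eta : param R -> R) (s T : R) (zeta v : param R -> R -> R -> R) : Prop :=
  (exists M : R, forall p, in_params mumax epsmax deltamin deltamax p ->
    [/\ in_LinfH T (s + sbar) (zeta p), in_LinfH T (s + sbar) (v p),
        (LinfH_norm T (s + sbar) (zeta p) <= M%:E)%E
      & (LinfH_norm T (s + sbar) (v p) <= M%:E)%E]) /\
  (exists2 eta0 : R, 0 < eta0 &
    forall p, in_params mumax epsmax deltamin deltamax p -> eta p <= eta0 ->
    exists r1 r2 : R -> R -> R,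
      [/\ in_LinfH T s r1, in_LinfH T s r2,
          GN_with_rhs p T (zeta p) (v p)
            (fun t x => eta p * r1 t x) (fun t x => eta p * r2 t x)
        & (LinfH_norm T s r1 + LinfH_norm T s r2 <=
           (C mumax epsmax deltamin^-1 deltamax
              (fine (LinfH_norm T (s + sbar) (zeta p)))
              (fine (LinfH_norm T (s + sbar) (v p))))%:E)%E]).

End Consistency.

(* Main.v *)
Require Import Defs.
From HB Require Import structures.
From mathcomp Require Import all_boot all_order all_algebra.
From mathcomp Require Import all_classical all_reals all_analysis ess_sup_inf.
From mathcomp Require Import measurable_realfun simple_functions.
From mathcomp Require Import ring lra zify.

(** Write V = u_l - u_r, zeta = u_l + u_r, tau = gamma + delta, so that the
    velocity of the pair is tau V.  Taking the sum of the two equations of the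
    decoupled system, the dispersive terms cancel and what remains is a
    conservation law for zeta; taking tau times their difference gives an
    equation for tau V.  The coefficients alpha_i, nu, kappa_i are exactly those
    for which these two equations are the Green-Naghdi system with its fluxes
    expanded up to e^3, its operator Q up to the first power of e, and its
    operator R reduced to its value at e = 0.  Hence the residue of the first
    equation is e^4 d_x F4 and that of the second one is
      e^4 d_x G4 / 2 + mu e^2 (d_t Q2 - d_x R1),
    where F4, G4, Q2, R1 are polynomials in u_l, u_r, their space derivatives and
    the reciprocals of affine functions of e zeta, whose coefficients depend on
    the parameters.
    Dividing by mu e^2 + e^4 leaves coefficients at most 1, and it remains to
    bound F4, G4, Q2, R1.

    Since e^4 is at most the precision, a small precision makes e small,
    depending on the bound M of the solutions.  Then e zeta is small in H^(s+3),
    and 1 / (1 - e b zeta) is bounded there by its Neumann series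
    [Hs_ball_inv1B], which takes the place of a composition theorem in Sobolev
    spaces.  The positivity of the depths h1 and h2 makes the quotients
    meaningful also at the times where the solutions are in H^(s+3) without
    control of their size.

    The space estimates are obtained from the Hartley transform, a real form of
    the Fourier transform: a function belongs to [Hs_ball sg N] when it is the
    transform of a function whose weighted L2 norm is at most N.  For
    sg > 1/2 these balls are stable under products [Hs_ball_mul], by Peetre's
    inequality and Cauchy-Schwarz, and under the derivative, up to the loss of
    one unit of sg [Hs_ball_deriv].

    In time, everything reduces at fixed x to bounded functions on [0,T[ which
    are almost everywhere the primitive of a bounded function [wder].  By the lemma
    of du Bois-Reymond this is equivalent to having a bounded weak derivative,
    and it gives the product rule, the derivative of a reciprocal, the uniqueness
    of the derivative and, through difference quotients, the commutation of
    d_t with d_x.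

    Both aspects are collected in the class [W1B k n c], of functions f of t and
    x such that f - c is in H^(s+k+1) and d_t f in H^(s+k), with norms at most
    B^n outside of a fixed null set of times.  Here B dominates the parameters,
    M and the constants of the Sobolev estimates.  The exponents n are explicit numbers, so
    that the final constant is a fixed multiple of a fixed power of B. *)

Set Implicit Arguments.
Unset Strict Implicit.
Unset Printing Implicit Defensive.

Import Order.TTheory GRing.Theory Num.Theory.
Import numFieldNormedType.Exports.

Local Open Scope classical_set_scope.
Local Open Scope ring_scope.

(** * Lebesgue measure on the line: invariance, Cauchy-Schwarz, Fubini *)

Section Invariance.
Variable R : realType.
Local Notation leb := (@lebesgue_measure R).

Let shift a : R -> measurableTypeR R := fun x => x + a.

Let mshift a : measurable_fun [set: measurableTypeR R] (shift a).
Proof.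
by apply: continuous_measurable_fun => x; apply: cvgD; [exact: cvg_id|exact: cvg_cst].
Qed.

Let opp : R -> measurableTypeR R := fun x => - x.

Let mopp : measurable_fun [set: measurableTypeR R] opp.
Proof. exact: oppr_measurable. Qed.

Lemma lebesgue_measure_shift a (A : set R) : measurable A ->
  pushforward leb (shift a) A = leb A.
Proof.
move=> mA.
pose m : {measure set (measurableTypeR R) -> \bar R} :=
  measure_function_pushforward__canonical__measure_function_Measure leb (mshift a).
apply/esym; apply: (@lebesgue_measure_unique R m) => //= _ [[b c]] _ <-.
rewrite /pushforward /=.
have -> : shift a @^-1` [set` `]b, c]] = [set` `](b - a), (c - a)]].
  by apply/seteqP; split => x /=; rewrite !in_itv /= ltrBlDr lerBrDr.
rewrite !lebesgue_measure_itv/= !lte_fin ltrD2r; case: ifP => // _.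
by rewrite -!EFinB; congr EFin; ring.
Qed.

Lemma ge0_integral_shift a (f : R -> \bar R) :
  measurable_fun [set: R] f -> (forall x, 0 <= f x)%E ->
  (\int[leb]_x f (x + a)%R = \int[leb]_x f x)%E.
Proof.
move=> mf f0.
rewrite -[LHS](@ge0_integral_pushforward _ _ _ (measurableTypeR R) R _ (mshift a) leb setT f) //.
by apply: eq_measure_integral => A mA _; exact: lebesgue_measure_shift.
Qed.

Lemma ge0_integral_opp (f : R -> \bar R) :
  measurable_fun [set: R] f -> (forall x, 0 <= f x)%E ->
  (\int[leb]_x f (- x)%R = \int[leb]_x f x)%E.
Proof.
move=> mf f0.
rewrite -[LHS](@ge0_integral_pushforward _ _ _ (measurableTypeR R) R _ mopp leb setT f) //.
by apply: eq_measure_integral => A mA _; exact: lebesgue_measureN.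
Qed.

Lemma measurable_shift a (f : R -> R) : measurable_fun [set: R] f ->
  measurable_fun [set: R] (fun x : R => f (x + a)).
Proof. by move=> mf; exact: (measurableT_comp mf (mshift a)). Qed.

Lemma measurable_opp (f : R -> R) : measurable_fun [set: R] f ->
  measurable_fun [set: R] (fun x : R => f (- x)).
Proof. by move=> mf; exact: (measurableT_comp mf mopp). Qed.

Lemma integrable_shift a (f : R -> R) : leb.-integrable setT (EFin \o f) ->
  leb.-integrable setT (EFin \o (fun x => f (x + a))).
Proof.
move=> /integrableP[/measurable_EFinP mf If]; apply/integrableP; split.
  by apply/measurable_EFinP; exact: measurable_shift.
rewrite (@ge0_integral_shift a (fun x => `|(f x)%:E|)%E) //.
by apply/measurableT_comp => //; exact/measurable_EFinP.
Qed.

Lemma integrable_opp (f : R -> R) : leb.-integrable setT (EFin \o f) ->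
  leb.-integrable setT (EFin \o (fun x => f (- x))).
Proof.
move=> /integrableP[/measurable_EFinP mf If]; apply/integrableP; split.
  by apply/measurable_EFinP; exact: measurable_opp.
rewrite (@ge0_integral_opp (fun x => `|(f x)%:E|)%E) //.
by apply/measurableT_comp => //; exact/measurable_EFinP.
Qed.

Lemma Rintegral_shift a (f : R -> R) : leb.-integrable setT (EFin \o f) ->
  \int[leb]_x f (x + a)%R = \int[leb]_x f x.
Proof.
move=> fi; rewrite /Rintegral.
congr fine.
have mf : measurable_fun [set: measurableTypeR R] (EFin \o f) by case/integrableP : fi.
rewrite -[LHS](@integral_pushforward _ _ _ (measurableTypeR R) R _ (mshift a) leb setT (EFin \o f)) //.
  by apply: eq_measure_integral => A mA _; exact: lebesgue_measure_shift.
exact: (integrable_shift a fi).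
Qed.

Lemma Rintegral_opp (f : R -> R) : leb.-integrable setT (EFin \o f) ->
  \int[leb]_x f (- x) = \int[leb]_x f x.
Proof.
move=> fi; rewrite /Rintegral; congr fine.
have mf : measurable_fun [set: measurableTypeR R] (EFin \o f) by case/integrableP : fi.
rewrite -[LHS](@integral_pushforward _ _ _ (measurableTypeR R) R _ mopp leb setT (EFin \o f)) //.
  by apply: eq_measure_integral => A mA _; exact: lebesgue_measureN.
exact: (integrable_opp fi).
Qed.

End Invariance.

Section Tools.
Context d (T : measurableType d) (R : realType) (mu : {measure set T -> \bar R}).

Lemma Rintegral_fine (F : T -> \bar R) : mu.-integrable setT F ->
  mu.-integrable setT (EFin \o (fun x => fine (F x))) /\
  (\int[mu]_x (fine (F x))%:E = \int[mu]_x F x)%E.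
Proof.
move=> iF.
have mF : measurable_fun setT F by case/integrableP : iF.
have mf : measurable_fun setT (EFin \o (fun x => fine (F x))).
  by apply/measurable_EFinP; exact: measurableT_comp.
have ae : ae_eq mu setT F (EFin \o (fun x => fine (F x))).
  by apply: filterS (integrable_ae measurableT iF) => x /(_ I) Fx _ /=; rewrite fineK.
split; last exact/esym/ae_eq_integral.
apply/integrableP; split => //.
case/integrableP : iF => _; apply: le_lt_trans.
rewrite le_eqVlt; apply/orP; left; apply/eqP/esym.
apply: ae_eq_integral => //; [exact: measurableT_comp|exact: measurableT_comp|].
by apply: filterS ae => x h /h /= ->.
Qed.

Lemma Lnorm2_le (f : T -> R) (A : R) : 0 <= A ->
  (Lnorm mu 2%:E (EFin \o f) <= A%:E)%E <->
  (\int[mu]_x (f x ^+ 2)%:E <= (A ^+ 2)%:E)%E.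
Proof.
move=> A0.
have -> : (\int[mu]_x (f x ^+ 2)%:E = Lnorm mu 2%:E (EFin \o f) `^ 2)%E.
  rewrite powR_Lnorm ?pnatr_eq0 //; apply: eq_integral => x _ /=.
  by rewrite powR_mulrn // real_normK ?num_real.
have := @Lnorm_ge0 _ T R mu 2%:E (EFin \o f).
case: (Lnorm _ _ _) => [r|_|//]; last by rewrite poweRE pnatr_eq0 eqxx leye_eq.
rewrite /= !lee_fin => r0; rewrite powR_mulrn //.
by rewrite ler_sqr ?nnegrE.
Qed.

Lemma cauchy_schwarz_integral (f g : T -> R) (A B : R) :
  measurable_fun setT f -> measurable_fun setT g -> 0 <= A -> 0 <= B ->
  (\int[mu]_x (f x ^+ 2)%:E <= (A ^+ 2)%:E)%E ->
  (\int[mu]_x (g x ^+ 2)%:E <= (B ^+ 2)%:E)%E ->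
  (\int[mu]_x `|f x * g x|%:E <= (A * B)%:E)%E.
Proof.
move=> mf mg A0 B0 /(Lnorm2_le f A0) fA /(Lnorm2_le g B0) gB.
have h : (2^-1 + 2^-1 = 1 :> R) by field.
have p2 : (0 < 2 :> R) by rewrite ltr0n.
have := @hoelder _ T R mu f g 2 2 mf mg p2 p2 h.
rewrite Lnorm1 => /le_trans; apply.
by rewrite EFinM; apply: lee_pmul; rewrite // Lnorm_ge0.
Qed.

End Tools.

Section RealFubini.
Variable R : realType.
Local Notation leb := (@lebesgue_measure R).

Lemma integrable_swap (f : R * R -> R) :
  (leb \x leb)%E.-integrable setT (EFin \o f) ->
  (leb \x leb)%E.-integrable setT (EFin \o (fun z => f (z.2, z.1))).
Proof.
move=> fi.
have mf : measurable_fun [set: measurableTypeR R * measurableTypeR R] (EFin \o f).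
  by case/integrableP : fi.
apply/integrable21ltyP.
  exact: (measurableT_comp mf (@measurable_swap _ _ _ _)).
by move/(integrable12ltyP _ _ mf) : fi.
Qed.

(** Iterated integrals of real functions, for an integrand which is integrable for the product measure. *)
Lemma Rfubini (g : R -> R -> R) :
  (leb \x leb)%E.-integrable setT (EFin \o (fun z : R * R => g z.1 z.2)) ->
  [/\ leb.-integrable setT (EFin \o (fun x : R => \int[leb]_y g x y)),
      leb.-integrable setT (EFin \o (fun y : R => \int[leb]_x g x y)) &
  \int[leb]_x (\int[leb]_y g x y) = \int[leb]_y (\int[leb]_x g x y)].
Proof.
move=> ig.
have [iF eF] := Rintegral_fine (integrable_fubini_F ig).
have [iG eG] := Rintegral_fine (integrable_fubini_F (integrable_swap ig)).
split; [exact: iF|exact: iG|].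
rewrite [LHS]/Rintegral [RHS]/Rintegral; congr fine.
etransitivity; first exact: eF.
by etransitivity; last exact/esym/eG; exact: Fubini.
Qed.

End RealFubini.
(** * The Hartley transform and weighted L2 spaces *)

Section Weight.
Variable R : realType.
Local Notation leb := (@lebesgue_measure R).
Implicit Types (sg xi eta : R).

Definition japsq (xi : R) : R := 1 + xi ^+ 2.

Definition wt (sg xi : R) : R := japsq xi `^ sg.

Lemma japsq_ge1 xi : 1 <= japsq xi.
Proof. by rewrite lerDl sqr_ge0. Qed.

Lemma japsq_gt0 xi : 0 < japsq xi.
Proof. exact: lt_le_trans ltr01 (japsq_ge1 xi). Qed.

Lemma wt_gt0 sg xi : 0 < wt sg xi.
Proof. by rewrite powR_gt0 // japsq_gt0. Qed.

Lemma wt_ge0 sg xi : 0 <= wt sg xi.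
Proof. exact/ltW/wt_gt0. Qed.

Lemma wt_opp sg xi : wt sg (- xi) = wt sg xi.
Proof. by rewrite /wt /japsq sqrrN. Qed.

Lemma wt_mono sg sg' xi : sg <= sg' -> wt sg xi <= wt sg' xi.
Proof. by move=> h; apply: ler_powR => //; exact: japsq_ge1. Qed.

Lemma wtS sg xi : wt (sg + 1) xi = japsq xi * wt sg xi.
Proof.
rewrite /wt powRD ?powRr1 ?(ltW (japsq_gt0 _)) 1?mulrC //.
by rewrite (gt_eqF (japsq_gt0 _)) implybT.
Qed.

Lemma measurable_wt sg : measurable_fun [set: R] (wt sg).
Proof.
apply: (@measurableT_comp _ _ _ _ _ _ (fun y => y `^ sg) _ japsq).
  exact: measurable_powR.
by apply: measurable_funD => //; exact: measurable_funX.
Qed.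

(** Peetre's inequality: the weight of a sum of frequencies can be shared between
    its two terms. *)
Lemma wt_sub sg xi eta : 0 <= sg ->
  wt sg xi <= 4 `^ sg * (wt sg (xi - eta) + wt sg eta).
Proof.
move=> s0.
set m := Num.max (japsq (xi - eta)) (japsq eta).
have m0 : 0 <= m by rewrite le_max (ltW (japsq_gt0 _)).
have h : japsq xi <= 4 * m.
  have : japsq (xi - eta) + japsq eta <= m + m by apply: lerD; rewrite le_max lexx ?orbT.
  have := sqr_ge0 (xi - 2 * eta); rewrite /japsq.
  move: m {m0} => m; lra.
have : wt sg xi <= (4 * m) `^ sg.
  by apply: ge0_ler_powR => //; rewrite nnegrE ?(ltW (japsq_gt0 _)) // mulr_ge0.
move/le_trans; apply; rewrite powRM //.
apply: ler_wpM2l; first exact: powR_ge0.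
have [->|->] : m = japsq (xi - eta) \/ m = japsq eta.
  by rewrite /m; case: leP; [right|left].
  by rewrite -/(wt sg (xi - eta)) lerDl wt_ge0.
by rewrite -/(wt sg eta) lerDr wt_ge0.
Qed.

Lemma cvg_powRN_y (b : R) : 0 < b -> (1 + x) `^ (- b) @[x --> +oo] --> (0 : R).
Proof.
move=> b0; apply/cvgrPdist_le => e e0.
near=> x.
have x0 : 0 < 1 + x.
  by rewrite -ltrBlDl sub0r; near: x; apply: nbhs_pinfty_gt; rewrite num_real.
rewrite sub0r normrN ger0_norm ?powR_ge0 //.
rewrite powRN -[leRHS]invrK lef_pV2 ?posrE ?powR_gt0 ?invr_gt0 //.
have -> : e^-1 = (e^-1 `^ b^-1) `^ b.
  by rewrite -powRrM mulVf ?powRr1 ?invr_ge0 ?(ltW e0) // lt0r_neq0.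
apply: ge0_ler_powR; rewrite ?nnegrE ?powR_ge0 ?(ltW b0) ?(ltW x0) //.
rewrite -lerBlDl; near: x; apply: nbhs_pinfty_ge; rewrite num_real.
Unshelve. all: by end_near. Qed.

Lemma integral_powR_lty (b : R) : 0 < b ->
  (\int[leb]_(x in `[0%R, +oo[) ((1 + x) `^ (- b - 1))%:E = (b^-1)%:E)%E.
Proof.
move=> b0.
have dp a (x : R) : 0 < 1 + x ->
    is_derive x 1 (fun x : R => (1 + x) `^ a) (a * (1 + x) `^ (a - 1)).
  move=> x1.
  have h1 := @is_derive1_powR R a (1 + x) x1.
  have h2 : is_derive x 1 (fun x : R => 1 + x) 1.
    rewrite (_ : (fun x : R => 1 + x) = shift 1); first exact: is_derive_shift.
    by apply/funext => y; rewrite addrC.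
  have h3 := @is_derive1_comp R (fun y => y `^ a) (fun x : R => 1 + x) x _ _ h1 h2.
  by apply: (is_derive_eq h3); rewrite mulr1.
have cpow (x : R) : 0 < 1 + x -> {for x, continuous (fun x : R => (1 + x) `^ (- b - 1))}.
  move=> x0; apply: differentiable_continuous; apply/derivable1_diffP.
  by case: (dp (- b - 1) x x0).
have dpow (x : R) : 0 <= x -> derivable (fun x : R => - b^-1 * (1 + x) `^ (- b)) x 1 /\
  derive1 (fun x : R => - b^-1 * (1 + x) `^ (- b)) x = (1 + x) `^ (- b - 1).
  move=> x0.
  have x1 : 0 < 1 + x by rewrite ltr_wpDr.
  have h4 := @is_deriveZ _ _ _ _ (- b^-1) _ _ _ (dp (- b) x x1).
  split; first by case: h4.
  rewrite derive1E; case: h4 => _ ->.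
  rewrite /GRing.scale /= mulrA mulrNN mulVf ?mul1r //; exact: lt0r_neq0.
rewrite (@ge0_continuous_FTC2y R (fun x : R => (1 + x) `^ (- b - 1)) (fun x : R => - b^-1 * (1 + x) `^ (- b)) 0 0).
- by rewrite addr0 powR1 mulr1 sub0e -EFinN opprK.
- by move=> x _; exact: powR_ge0.
- apply/continuous_within_itvcyP; split.
    by move=> x; rewrite in_itv /= andbT => x0; apply: cpow; rewrite addr_gt0.
  apply: cvg_at_right_filter; apply: cpow; rewrite addr0; exact: ltr01.
- rewrite -[X in _ --> X](mulr0 (- b^-1)).
  by apply: cvgM; [exact: cvg_cst|exact: cvg_powRN_y].
- by move=> x x0; case: (dpow x (ltW x0)).
- have c0 : {for 0, continuous (fun x : R => - b^-1 * (1 + x) `^ (- b))}.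
    apply: differentiable_continuous; apply/derivable1_diffP.
    by case: (dpow 0 (lexx 0)).
  by apply: cvg_at_right_filter; exact: c0.
- by move=> x; rewrite in_itv /= andbT => x0; exact: (dpow x (ltW x0)).2.
Qed.

(** This is where s > 1/2 enters: the inverse weight decays like the power
    - 2 sg of the frequency. *)
Lemma integral_wtV_lty sg : 2^-1 < sg ->
  (\int[leb]_xi ((wt sg xi)^-1)%:E < +oo)%E.
Proof.
move=> s2.
have s0 : 0 < sg by apply: lt_trans s2; rewrite invr_gt0.
have mV : measurable_fun [set: R] (fun xi => (wt sg xi)^-1).
  rewrite (_ : (fun _ => _) = wt (- sg)); first exact: measurable_wt.
  by apply/funext => x; rewrite /wt powRN.
have mVE : measurable_fun [set: R] (fun xi => ((wt sg xi)^-1)%:E) by exact/measurable_EFinP.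
have V0 xi : (0 <= ((wt sg xi)^-1)%:E)%E by rewrite lee_fin invr_ge0 wt_ge0.
have b0 : 0 < 2 * sg - 1.
  by rewrite subr_gt0 -(@ltr_pM2l _ 2^-1) ?invr_gt0 // mulr1 mulKf.
have half : (\int[leb]_(x in `[0%R, +oo[) ((wt sg x)^-1)%:E < +oo)%E.
  apply: (@le_lt_trans _ _ (\int[leb]_(x in `[0%R, +oo[)
     ((2 `^ sg)%:E * ((1 + x) `^ (- (2 * sg - 1) - 1))%:E))%E).
    apply: ge0_le_integral => //.
    - exact: measurable_funTS.
    - apply: measurable_funTS; apply: emeasurable_funM => //; apply/measurable_EFinP.
      apply: (@measurableT_comp _ _ _ _ _ _ (fun y : R => y `^ (- (2 * sg - 1) - 1)) _ (fun x : R => 1 + x)).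
        exact: measurable_powR.
      exact: measurable_funD.
    - move=> x; rewrite /= in_itv /= andbT => x0.
      have x1 : 0 < 1 + x by rewrite ltr_wpDr.
      rewrite -EFinM lee_fin.
      have -> : - (2 * sg - 1) - 1 = - (2 * sg) by ring.
      rewrite powRN powRrM powR_mulrn ?(ltW x1) //.
      rewrite ler_pdivlMr ?powR_gt0 ?exprn_gt0 // mulrC ler_pdivrMr ?wt_gt0 //.
      rewrite /wt -powRM ?(ltW (japsq_gt0 _)) //.
      apply: ge0_ler_powR; rewrite ?nnegrE ?(ltW s0) ?sqr_ge0 ?mulr_ge0 ?(ltW (japsq_gt0 _)) //.
      by rewrite /japsq; have := sqr_ge0 (1 - x); lra.
  rewrite ge0_integralZl_EFin ?powR_ge0 //.
  - by rewrite integral_powR_lty // -EFinM ltry.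
  - by move=> x _; rewrite lee_fin powR_ge0.
  - apply: measurable_funTS; apply/measurable_EFinP.
    apply: (@measurableT_comp _ _ _ _ _ _ (fun y : R => y `^ (- (2 * sg - 1) - 1)) _ (fun x : R => 1 + x)).
      exact: measurable_powR.
    exact: measurable_funD.
have eT : [set: R] = [set` `]-oo, (0:R)[] `|` [set` `[(0:R), +oo[].
  rewrite -set_itvNyy; apply/seteqP; split => x //= _; rewrite !in_itv /= andbT.
  by case: (ltP x 0); [left|right].
rewrite eT ge0_integral_setU //; last 2 first.
- by rewrite -eT.
- apply/disj_setPLR => x /=; rewrite !in_itv /= andbT => x0.
  by apply/negP; rewrite -ltNge.
rewrite lte_add_pinfty //.
apply: (@le_lt_trans _ _ (\int[leb]_(x in `]-oo, (0%R:R)]) ((wt sg x)^-1)%:E)%E).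
  apply: ge0_subset_integral => //.
    exact: measurable_funTS.
  by move=> x; rewrite /= !in_itv /= => /ltW.
have E := ge0_integration_by_substitution0 mVE V0.
apply: le_lt_trans half; apply: (@eq_ind_r _ _ (fun z => _ <= z)%E _ _ E).
by under [leRHS]eq_integral do rewrite wt_opp.
Qed.

End Weight.

Section Hartley.
Variable R : realType.
Local Notation leb := (@lebesgue_measure R).
Implicit Types (sg xi eta x N M : R) (c f g : R -> R).

(** The kernel of the Hartley transform.  For real functions it replaces the pair
    of cosine and sine transforms by a single real density, so that all the
    estimates concern one scalar function. *)
Definition cas x : R := cos x + sin x.

Lemma cas_bound x : `|cas x| <= 2.
Proof.
apply: (le_trans (ler_normD _ _)); rewrite (_ : 2 = 1 + 1) //.
apply: lerD; rewrite ler_norml ?cos_le1 ?cos_geN1 ?sin_le1 ?sin_geN1 //.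
Qed.

Lemma continuous_cas : continuous cas.
Proof. by move=> x; apply: cvgD; [exact: continuous_cos|exact: continuous_sin]. Qed.

Lemma measurable_cas : measurable_fun [set: R] cas.
Proof. exact: continuous_measurable_fun continuous_cas. Qed.

Lemma casD x y : cas (x + y) = cos y * cas x + sin y * cas (- x).
Proof. by rewrite /cas cosD sinD cosN sinN; ring. Qed.

Lemma measurable_casM x : measurable_fun [set: R] (fun xi => cas (x * xi)).
Proof.
apply: (@measurableT_comp _ _ _ _ _ _ cas _ (fun xi => x * xi)).
  exact: measurable_cas.
exact: mulrl_measurable.
Qed.

Definition hart c x : R := \int[leb]_xi (c xi * cas (x * xi)).

(** The bound N is required to be positive so that bounds can be compared and
    inverted without case distinction. *)
Definition wL2 sg N c : Prop :=
  [/\ measurable_fun [set: R] c, 0 < N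
    & (\int[leb]_xi (wt sg xi * c xi ^+ 2)%:E <= (N ^+ 2)%:E)%E].

Definition Kwt sg : R := 1 + fine (\int[leb]_xi ((wt sg xi)^-1)%:E)%E.

Lemma Kwt_ge1 sg : 1 <= Kwt sg.
Proof.
rewrite lerDl fine_ge0 // integral_ge0 // => x _.
by rewrite lee_fin invr_ge0 wt_ge0.
Qed.

Lemma integral_wtV sg : 2^-1 < sg ->
  (\int[leb]_xi ((wt sg xi)^-1)%:E <= (Kwt sg)%:E)%E.
Proof.
move=> s2; rewrite /Kwt EFinD fineK.
  by rewrite leeDr // lee_fin.
rewrite ge0_fin_numE ?integral_wtV_lty // integral_ge0 // => x _.
by rewrite lee_fin invr_ge0 wt_ge0.
Qed.

Lemma wt_half sg xi : wt (sg / 2) xi ^+ 2 = wt sg xi.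
Proof.
by rewrite /wt -powR_mulrn ?powR_ge0 // -powRrM -mulrA mulVf ?mulr1.
Qed.

(** Cauchy-Schwarz against the inverse weight: this is the embedding of H^sg, for
    sg > 1/2, in the functions with integrable transform. *)
Lemma wL2_L1 sg N c : 2^-1 < sg -> wL2 sg N c ->
  (\int[leb]_xi `|c xi|%:E <= (Kwt sg * N)%:E)%E.
Proof.
move=> s2 [mc N0 cN].
have K1 := Kwt_ge1 sg.
have mwt (a : R) := @measurable_wt R a.
have H := @cauchy_schwarz_integral _ _ R leb (wt (- (sg / 2))) (fun xi => wt (sg / 2) xi * c xi) (Kwt sg) N.
have -> : (fun xi => `|c xi|%:E) = (fun xi => `|wt (- (sg / 2)) xi * (wt (sg / 2) xi * c xi)|%:E).
  apply/funext => xi; congr (`|_|%:E).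
  by rewrite mulrA /wt powRN mulVf ?mul1r // gt_eqF // powR_gt0 // japsq_gt0.
apply: H => //.
- exact: mwt.
- by apply: measurable_funM => //; exact: mwt.
- exact: le_trans ler01 K1.
- exact: ltW.
- apply: (@le_trans _ _ (Kwt sg)%:E).
    rewrite (_ : (fun xi => (wt (- (sg / 2)) xi ^+ 2)%:E) = (fun xi => ((wt sg xi)^-1)%:E)).
      exact: integral_wtV.
    by apply/funext => xi; rewrite {1}/wt powRN -/(wt _ _) exprVn wt_half.
  by rewrite lee_fin expr2 ler_peMl // (le_trans ler01).
- rewrite (_ : (fun xi => ((wt (sg / 2) xi * c xi) ^+ 2)%:E) =
    (fun xi => (wt sg xi * c xi ^+ 2)%:E)) //.
  by apply/funext => xi; rewrite exprMn wt_half.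
Qed.

Lemma wL2_integrable sg N c : 2^-1 < sg -> wL2 sg N c ->
  leb.-integrable setT (EFin \o c).
Proof.
move=> s2 cN; apply/integrableP; split; first by apply/measurable_EFinP; case: cN.
exact: le_lt_trans (wL2_L1 s2 cN) (ltry _).
Qed.

Lemma hart_integrable c x : leb.-integrable setT (EFin \o c) ->
  leb.-integrable setT (EFin \o (fun xi => c xi * cas (x * xi))).
Proof.
move=> ci.
have mc : measurable_fun [set: R] c by case/integrableP : ci => /measurable_EFinP.
apply: (@le_integrable _ _ R leb setT _ _ (EFin \o (fun xi => 2 * c xi))) => //.
- by apply/measurable_EFinP; apply: measurable_funM => //; exact: measurable_casM.
- move=> xi _ /=; rewrite lee_fin !normrM mulrC ler_wpM2r //.
  exact: le_trans (cas_bound _) (ler_norm _).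
- rewrite (_ : EFin \o _ = fun xi => (2%:E * (c xi)%:E)%E); first exact: integrableZl.
  by apply/funext => xi; rewrite /= EFinM.
Qed.

Lemma hart_bound sg N c x : 2^-1 < sg -> wL2 sg N c ->
  `|hart c x| <= 2 * (Kwt sg * N).
Proof.
move=> s2 cN.
have ci := wL2_integrable s2 cN.
apply: (le_trans (le_normr_Rintegral measurableT (hart_integrable x ci))).
rewrite -lee_fin /Rintegral fineK; last first.
  exact/integrable_fin_num/integrable_norm/hart_integrable.
apply: (@le_trans _ _ (\int[leb]_xi (2%:E * `|c xi|%:E))%E).
  apply: ge0_le_integral => //.
  - apply/measurable_EFinP; apply: measurableT_comp => //.
    by apply: measurable_funM; [case: cN|exact: measurable_casM].
  - apply/measurable_EFinP; apply: measurable_funM => //.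
    by apply: measurableT_comp => //; case: cN.
  - by move=> xi _; rewrite -EFinM lee_fin normrM mulrC ler_wpM2r // cas_bound.
rewrite ge0_integralZl_EFin //; last first.
  by apply/measurable_EFinP; apply: measurableT_comp => //; case: cN.
rewrite [leRHS]EFinM; apply: lee_wpmul2l => //.
exact: wL2_L1.
Qed.

Lemma wL2_mono sg sg' N M c : sg <= sg' -> N <= M -> wL2 sg' N c -> wL2 sg M c.
Proof.
move=> ss NM [mc N0 cN]; split=> //; first exact: lt_le_trans NM.
have m2 : measurable_fun [set: R] (fun xi => c xi ^+ 2) by exact: measurable_funX.
apply: (@le_trans _ _ (N ^+ 2)%:E).
  apply: le_trans cN; apply: ge0_le_integral => //.
  - by move=> xi _; rewrite lee_fin mulr_ge0 ?wt_ge0 ?sqr_ge0.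
  - by apply/measurable_EFinP; apply: measurable_funM => //; exact: measurable_wt.
  - by apply/measurable_EFinP; apply: measurable_funM => //; exact: measurable_wt.
  - by move=> xi _; rewrite lee_fin ler_wpM2r ?sqr_ge0 // wt_mono.
by rewrite lee_fin ler_sqr // nnegrE ltW // (lt_le_trans N0).
Qed.

Lemma wL2_scale sg N c (k : R) (L : R) : 0 < L -> `|k| <= L -> wL2 sg N c ->
  wL2 sg (L * N) (fun xi => k * c xi).
Proof.
move=> L0 kL [mc N0 cN]; split; [exact: measurable_funM|exact: mulr_gt0|].
have -> : (fun xi => (wt sg xi * (k * c xi) ^+ 2)%:E) =
    (fun xi => (k ^+ 2)%:E * (wt sg xi * c xi ^+ 2)%:E)%E.
  by apply/funext => xi; rewrite -EFinM; congr EFin; ring.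
rewrite ge0_integralZl_EFin ?sqr_ge0 //.
- rewrite exprMn [leRHS]EFinM lee_pmul //.
    by rewrite lee_fin sqr_ge0.
    by apply: integral_ge0 => xi _; rewrite lee_fin mulr_ge0 ?wt_ge0 ?sqr_ge0.
  by rewrite lee_fin -real_normK ?num_real // ler_sqr ?nnegrE ?(ltW L0).
- by move=> xi _; rewrite lee_fin mulr_ge0 ?wt_ge0 ?sqr_ge0.
- apply/measurable_EFinP; apply: measurable_funM; first exact: measurable_wt.
  exact: measurable_funX.
Qed.

Lemma wL2_opp sg N c : wL2 sg N c -> wL2 sg N (fun xi => c (- xi)).
Proof.
move=> [mc N0 cN]; split => //; first exact: measurable_opp.
have := @ge0_integral_opp R (fun xi => (wt sg xi * c xi ^+ 2)%:E).
under eq_integral do rewrite wt_opp; move=> -> //.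
  apply/measurable_EFinP; apply: measurable_funM; first exact: measurable_wt.
  exact: measurable_funX.
by move=> xi; rewrite lee_fin mulr_ge0 ?wt_ge0 ?sqr_ge0.
Qed.

Lemma wL2_add sg N M c c' : wL2 sg N c -> wL2 sg M c' ->
  wL2 sg (2 * (N + M)) (fun xi => c xi + c' xi).
Proof.
move=> [mc N0 cN] [mc' M0 cM].
have mW : measurable_fun [set: R] (wt sg) by exact: measurable_wt.
split; [exact: measurable_funD|by rewrite mulr_gt0 // addr_gt0|].
apply: (@le_trans _ _ (\int[leb]_xi (2%:E * (wt sg xi * c xi ^+ 2)%:E + 2%:E * (wt sg xi * c' xi ^+ 2)%:E))%E).
  apply: ge0_le_integral => //.
  - by move=> xi _; rewrite lee_fin mulr_ge0 ?wt_ge0 ?sqr_ge0.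
  - apply/measurable_EFinP; apply: measurable_funM => //; apply: measurable_funX.
    exact: measurable_funD.
  - apply: emeasurable_funD; apply/measurable_EFinP; apply: measurable_funM => //; apply: measurable_funM => //; exact: measurable_funX.
  - move=> xi _; rewrite -!EFinM -EFinD lee_fin !(mulrCA 2) -mulrDr.
    apply: ler_wpM2l; first exact: wt_ge0.
    by have := sqr_ge0 (c xi - c' xi); lra.
have mm c0 : measurable_fun [set: R] c0 -> measurable_fun [set: R] (fun xi => (wt sg xi * c0 xi ^+ 2)%:E).
  by move=> mc0; apply/measurable_EFinP; apply: measurable_funM => //; exact: measurable_funX.
have p c0 xi : (0 <= (wt sg xi * c0 xi ^+ 2)%:E)%E.
  by rewrite lee_fin mulr_ge0 ?wt_ge0 ?sqr_ge0.
rewrite ge0_integralD //.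
- rewrite !ge0_integralZl_EFin //; try exact: mm.
  apply: (@le_trans _ _ (2%:E * (N ^+ 2)%:E + 2%:E * (M ^+ 2)%:E)%E).
    by apply: leeD; apply: lee_wpmul2l.
  rewrite -!EFinM -EFinD lee_fin.
  have := mulr_gt0 N0 M0; have := sqr_ge0 N; have := sqr_ge0 M; rewrite exprMn !expr2; lra.
- by move=> xi _; exact: mule_ge0.
- by apply: emeasurable_funM => //; exact: mm.
- by move=> xi _; exact: mule_ge0.
- by apply: emeasurable_funM => //; exact: mm.
Qed.

End Hartley.

Section LebesgueTools.
Variable R : realType.
Local Notation leb := (@lebesgue_measure R).
Implicit Types (D : set R) (f g : R -> R).

(** Integrability of a real function, stated once with its embedding in the
    extended reals. *)
Definition itg D f : Prop := leb.-integrable D (EFin \o f).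

Lemma itg_measurable D f : itg D f -> measurable_fun D f.
Proof. by case/integrableP => /measurable_EFinP. Qed.

Lemma itgD D f g : measurable D -> itg D f -> itg D g -> itg D (fun x => f x + g x).
Proof.
move=> mD fi gi; rewrite /itg (_ : EFin \o _ = (EFin \o f) \+ (EFin \o g))%E.
  exact: integrableD.
by apply/funext.
Qed.

Lemma itgZl D f (k : R) : measurable D -> itg D f -> itg D (fun x => k * f x).
Proof.
move=> mD fi; rewrite /itg (_ : EFin \o _ = (fun x => k%:E * (EFin \o f) x))%E.
  exact: integrableZl.
by apply/funext.
Qed.

Lemma itgZr D f (k : R) : measurable D -> itg D f -> itg D (fun x => f x * k).
Proof. by move=> mD /(itgZl k mD); under eq_fun do rewrite mulrC. Qed.

Lemma itgM D f (k : R -> R) (B : R) : measurable D -> itg D f ->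
  measurable_fun D k -> (forall x, D x -> `|k x| <= B) ->
  itg D (fun x => f x * k x).
Proof.
move=> mD fi mk kB.
apply: (@le_integrable _ _ R leb D _ _ (EFin \o (fun x => B * f x))) => //.
- by apply/measurable_EFinP; apply: measurable_funM => //; exact: itg_measurable.
- move=> x Dx /=; rewrite lee_fin !normrM mulrC ler_wpM2r //.
  exact: le_trans (kB x Dx) (ler_norm _).
- exact: itgZl.
Qed.

Lemma RID D f g : measurable D -> itg D f -> itg D g ->
  \int[leb]_(x in D) (f x + g x) = \int[leb]_(x in D) f x + \int[leb]_(x in D) g x.
Proof. by move=> mD fi gi; exact: RintegralD. Qed.

Lemma RIZl D f (k : R) : measurable D -> itg D f ->
  \int[leb]_(x in D) (k * f x) = k * \int[leb]_(x in D) f x.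
Proof. by move=> mD fi; exact: RintegralZl. Qed.

Lemma RIZr D f (k : R) : measurable D -> itg D f ->
  \int[leb]_(x in D) (f x * k) = \int[leb]_(x in D) f x * k.
Proof. by move=> mD fi; exact: RintegralZr. Qed.

Lemma eq_RI D f g : (forall x, D x -> f x = g x) ->
  \int[leb]_(x in D) f x = \int[leb]_(x in D) g x.
Proof. by move=> fg; apply: eq_Rintegral => x /set_mem; exact: fg. Qed.

Lemma itg_opp f : itg setT f -> itg setT (fun x => f (- x)).
Proof. exact: integrable_opp. Qed.

Lemma ae_eq_RI D f g : measurable D -> measurable_fun D f -> measurable_fun D g ->
  {ae leb, forall x, D x -> f x = g x} ->
  \int[leb]_(x in D) f x = \int[leb]_(x in D) g x.
Proof.
move=> mD mf mg fg; rewrite /Rintegral; congr fine.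
apply: ae_eq_integral => //; [exact/measurable_EFinP|exact/measurable_EFinP|].
by apply: (@filterS _ _ (ae_filter_ringOfSetsType leb) _ _ _ fg) => x h /h ->.
Qed.

Lemma RI_norm_le D f (B : R) : measurable D -> measurable_fun D f ->
  (\int[leb]_(x in D) `|f x|%:E <= B%:E)%E ->
  itg D f /\ `|\int[leb]_(x in D) f x| <= B.
Proof.
move=> mD mf fB.
have fi : itg D f.
  apply/integrableP; split; first exact/measurable_EFinP.
  exact: le_lt_trans fB (ltry _).
split=> //; apply: (le_trans (@le_normr_Rintegral _ _ _ leb D f mD fi)).
by rewrite -lee_fin /Rintegral fineK //; exact/integrable_fin_num/integrable_norm.
Qed.

End LebesgueTools.

Section Convolution.
Variable R : realType.
Local Notation leb := (@lebesgue_measure R).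
Implicit Types (sg xi eta x N M : R) (a c f g : R -> R).

Definition conv a c xi : R := \int[leb]_eta (a (xi - eta) * c eta).

Let mconv a c : measurable_fun [set: R] a -> measurable_fun [set: R] c ->
  measurable_fun [set: R * R] (fun z : R * R => a (z.1 - z.2) * c z.2).
Proof.
move=> ma mc; apply: measurable_funM.
  apply: (@measurableT_comp _ _ _ _ _ _ a _ (fun z : R * R => z.1 - z.2)) => //.
  exact: (measurable_funB (@measurable_fst _ _ R R) (@measurable_snd _ _ R R)).
exact: (measurableT_comp mc (@measurable_snd _ _ R R)).
Qed.

Lemma conv_integrable2 a c (k : R -> R) :
  leb.-integrable setT (EFin \o a) -> leb.-integrable setT (EFin \o c) ->
  measurable_fun [set: R] k -> (forall x, `|k x| <= 2) ->
  (leb \x leb)%E.-integrable setT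
    (EFin \o (fun z : R * R => a (z.1 - z.2) * c z.2 * k z.1)).
Proof.
move=> /integrableP[/measurable_EFinP ma ia] /integrableP[/measurable_EFinP mc ic] mk k2.
have mg : measurable_fun [set: R * R] (fun z : R * R => a (z.1 - z.2) * c z.2 * k z.1).
  apply: measurable_funM; first exact: mconv.
  exact: (measurableT_comp mk (@measurable_fst _ _ R R)).
apply/integrable21ltyP; first exact/measurable_EFinP.
have mc' : measurable_fun [set: R] (fun y => `|c y|%:E).
  by apply/measurable_EFinP; exact: measurableT_comp.
have ma' y : measurable_fun [set: R] (fun x => `|a (x - y)|%:E).
  by apply/measurable_EFinP; apply: measurableT_comp => //; exact: measurable_shift.
apply: (@le_lt_trans _ _ (\int[leb]_y ((2 * fine (\int[leb]_x `|(EFin \o a) x|))%:E * `|c y|%:E))%E).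
  apply: ge0_le_integral => //.
  - by move=> y _; exact: integral_ge0.
  - have h0 (z : R * R) : (0%R <= `|(a (z.1 - z.2) * c z.2 * k z.1)%:E|)%E by [].
    pose g0 (z : measurableTypeR R * measurableTypeR R) : \bar R :=
      `|(a (z.1 - z.2) * c z.2 * k z.1)%:E|%E.
    have mg0 : measurable_fun setT g0.
      by apply: measurableT_comp => //; exact/measurable_EFinP.
    exact: (@measurable_fun_fubini_tonelli_G _ _ (measurableTypeR R) (measurableTypeR R) R leb g0 mg0).
  - by apply: emeasurable_funM.
  - move=> y _.
    apply: (@le_trans _ _ (\int[leb]_x ((2 * `|c y|)%:E * `|a (x - y)|%:E))%E).
      apply: ge0_le_integral => //.
      + apply: measurableT_comp => //; apply/measurable_EFinP; apply: measurable_funM => //.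
        by apply: measurable_funM => //=; exact: (measurable_shift (- y) ma).
      + by apply: emeasurable_funM => //; exact: (ma' y).
      + move=> x _ /=; rewrite -EFinM lee_fin !normrM.
        rewrite mulrC (mulrC `|a _|) -[leRHS]mulrA.
        by rewrite ler_wpM2r // mulr_ge0.
    rewrite ge0_integralZl_EFin ?mulr_ge0 //; last exact: (ma' y).
    have -> : (\int[leb]_x `|a (x - y)%R|%:E = \int[leb]_x `|(EFin \o a) x|)%E.
      rewrite (@ge0_integral_shift R (- y) (fun x => `|a x|%:E)) //.
      by apply/measurable_EFinP; exact: measurableT_comp.
    rewrite -[X in (_ * X <= _)%E]fineK; last by rewrite ge0_fin_numE // integral_ge0.
    by rewrite -!EFinM lee_fin mulrAC.
rewrite ge0_integralZl_EFin //; last by rewrite mulr_ge0 // fine_ge0 // integral_ge0.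
by rewrite lte_mul_pinfty // lee_fin mulr_ge0 // fine_ge0 // integral_ge0.
Qed.

Lemma conv_measurable a c :
  leb.-integrable setT (EFin \o a) -> leb.-integrable setT (EFin \o c) ->
  measurable_fun [set: R] (conv a c).
Proof.
move=> ia ic.
have b1 (x : R) : `|cst 1 x| <= 2 :> R by rewrite normr1 ler1n.
have := @conv_integrable2 a c (cst 1) ia ic (@measurable_cst _ _ _ _ _ _) b1.
move=> /(@Rfubini R (fun xi eta => a (xi - eta) * c eta * cst 1 xi))[].
move=> /integrableP[/measurable_EFinP + _] _ _.
rewrite (_ : (fun x => _) = conv a c) //.
apply/funext => x; apply: eq_Rintegral => y _; by rewrite /= mulr1.
Qed.

Lemma conv_hart_swap a c x :
  itg setT a -> itg setT c ->
  hart (conv a c) x = \int[leb]_y (\int[leb]_xi (a (xi - y) * c y * cas (x * xi))).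
Proof.
move=> ia ic.
have ccas y : `|cas (x * y)| <= 2 by exact: cas_bound.
have ii := conv_integrable2 ia ic (measurable_casM x) ccas.
have [i1 _ E] := @Rfubini R (fun xi eta => a (xi - eta) * c eta * cas (x * xi)) ii.
have b1 (y : R) : `|cst 1 y| <= 2 :> R by rewrite normr1 ler1n.
have i0 := @conv_integrable2 a c (cst 1) ia ic (@measurable_cst _ _ _ _ _ _) b1.
rewrite -[RHS]E /= /hart.
apply: ae_eq_RI; first exact: measurableT.
- apply: measurable_funM; first exact: conv_measurable.
  exact: measurable_casM.
- exact: itg_measurable i1.
- apply: filterS (ae_integrable1 i0) => xi /= ixi _.
  have ixi' : itg setT (fun y => a (xi - y) * c y).
    suff -> : (fun y => a (xi - y) * c y) = (fun y => a (xi - y) * c y * 1) by exact: ixi.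
    by apply/funext => y; rewrite mulr1.
  by rewrite /conv RIZr.
Qed.

(** The Hartley transform of a convolution is not a product: the kernel satisfies
    cas (x + y) = cos y cas x + sin y cas (- x). *)
Lemma conv_hart a c x :
  itg setT a -> itg setT c ->
  hart (conv a c) x = hart a x * \int[leb]_eta (c eta * cos (x * eta))
    + hart a (- x) * \int[leb]_eta (c eta * sin (x * eta)).
Proof.
move=> ia ic.
have mc : measurable_fun [set: R] c by case/integrableP : ic => /measurable_EFinP.
have bnd (k : R -> R) : measurable_fun [set: R] k -> (forall y, `|k y| <= 1) ->
    leb.-integrable setT (EFin \o (fun y => c y * k y)).
  move=> mk k1; apply: (@le_integrable _ _ R leb setT _ _ (EFin \o c)) => //.
    by apply/measurable_EFinP; exact: measurable_funM.
  by move=> y _ /=; rewrite lee_fin normrM ler_piMr.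
have mcos : measurable_fun [set: R] (fun y => cos (x * y)).
  apply: (@measurableT_comp _ _ _ _ _ _ (@cos R) _ (fun y => x * y)); last exact: mulrl_measurable.
  exact: continuous_measurable_fun (@continuous_cos R).
have msin : measurable_fun [set: R] (fun y => sin (x * y)).
  apply: (@measurableT_comp _ _ _ _ _ _ (@sin R) _ (fun y => x * y)); last exact: mulrl_measurable.
  exact: continuous_measurable_fun (@continuous_sin R).
have icos := bnd _ mcos (fun y => ltac:(by rewrite ler_norml cos_le1 cos_geN1)).
have isin := bnd _ msin (fun y => ltac:(by rewrite ler_norml sin_le1 sin_geN1)).
rewrite conv_hart_swap //.
have ha := hart_integrable x ia.
have ha' := hart_integrable (- x) ia.
rewrite (mulrC (hart a x)) -RIZr // (mulrC (hart a (- x))) -RIZr //.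
rewrite -RID //; [|exact: itgZr|exact: itgZr].
apply: eq_RI => y _.
have hy z : x * (z + y) = x * z + x * y by rewrite mulrDr.
have mcy : measurable_fun [set: R] (fun z => cas (x * (z + y))).
  exact: (measurable_shift y (measurable_casM x)).
have ics : itg setT (fun xi => a xi * cas (x * (xi + y))).
  by apply: (itgM _ ia) => // z _; exact: cas_bound.
transitivity (c y * \int[leb]_xi (a xi * cas (x * (xi + y)))).
  rewrite -RIZl //.
  have := @Rintegral_shift R (- y) (fun z => c y * (a z * cas (x * (z + y)))).
  rewrite (itgZl (c y) measurableT ics) => <- //.
  by apply: eq_RI => z _; rewrite subrK mulrCA mulrA.
rewrite -!mulrA -mulrDr; congr (_ * _).
rewrite (mulrC (cos _)) (mulrC (sin _)) -!RIZr //.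
rewrite -RID //; [|exact: itgZr|exact: itgZr].
by apply: eq_RI => z _; rewrite hy casD mulNr; ring.
Qed.

Definition Kconv sg : R := 1 + 2 * 4 `^ sg * Kwt sg.

Lemma Kconv_ge1 sg : 1 <= Kconv sg.
Proof.
by rewrite lerDl !mulr_ge0 ?powR_ge0 // (le_trans ler01 (Kwt_ge1 _)).
Qed.

Let mwt sg : measurable_fun [set: R] (wt sg). Proof. exact: measurable_wt. Qed.

Let msub xi f : measurable_fun [set: R] f ->
  measurable_fun [set: R] (fun eta => f (xi - eta)).
Proof.
move=> mf; apply: (@measurableT_comp _ _ _ _ _ _ f _ (fun eta => xi - eta)) => //.
exact: measurable_funB.
Qed.

Let Vwt sg xi : 0 < (wt sg xi)^-1. Proof. by rewrite invr_gt0 wt_gt0. Qed.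

Let mVwt sg : measurable_fun [set: R] (fun xi => ((wt sg xi)^-1)%:E).
Proof.
apply/measurable_EFinP; rewrite (_ : (fun _ => _) = wt (- sg)) //.
by apply/funext => x; rewrite /wt powRN.
Qed.

Lemma integral_wtV_sub sg xi : 2^-1 < sg ->
  (\int[leb]_eta ((wt sg (xi - eta))^-1)%:E <= (Kwt sg)%:E)%E.
Proof.
move=> s2.
have -> : (fun eta => ((wt sg (xi - eta))^-1)%:E) = (fun eta => ((wt sg (eta - xi))^-1)%:E).
  by apply/funext => eta; rewrite -wt_opp opprB.
rewrite (@ge0_integral_shift R (- xi) (fun eta => ((wt sg eta)^-1)%:E)) //.
  exact: integral_wtV.
by move=> x; rewrite lee_fin ltW.
Qed.

(** By Peetre's inequality the kernel is at most a multiple of the sum of the two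
    inverse weights, and each of them is integrable. *)
Lemma conv_kernel sg xi : 2^-1 < sg ->
  (\int[leb]_eta (wt sg xi / (wt sg (xi - eta) * wt sg eta))%:E <= (Kconv sg)%:E)%E.
Proof.
move=> s2; have s0 : 0 <= sg by apply: ltW; apply: lt_trans s2; rewrite invr_gt0.
have m1 := mVwt sg.
have m2 : measurable_fun [set: R] (fun eta => ((wt sg (xi - eta))^-1)%:E).
  apply/measurable_EFinP; apply: (@msub xi (fun eta => (wt sg eta)^-1)).
  exact/measurable_EFinP.
apply: (@le_trans _ _ (\int[leb]_eta ((4 `^ sg)%:E * (((wt sg eta)^-1)%:E + ((wt sg (xi - eta))^-1)%:E)))%E).
  apply: ge0_le_integral => //.
  - by move=> eta _; rewrite lee_fin divr_ge0 ?mulr_ge0 ?wt_ge0.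
  - rewrite (_ : (fun eta => _) = (fun eta => ((wt sg xi)%:E * (((wt sg (xi - eta))^-1)%:E * ((wt sg eta)^-1)%:E))%E)).
      by apply: emeasurable_funM => //; exact: emeasurable_funM.
    by apply/funext => eta; rewrite -!EFinM invfM.
  - by apply: emeasurable_funM => //; exact: emeasurable_funD.
  - move=> eta _; rewrite -EFinD -EFinM lee_fin.
    have w1 := wt_gt0 sg (xi - eta); have w2 := wt_gt0 sg eta.
    rewrite ler_pdivrMr ?mulr_gt0 //; apply: le_trans (wt_sub xi eta s0) _.
    rewrite -mulrA ler_wpM2l ?powR_ge0 //.
    by rewrite mulrDl mulrCA mulVf ?gt_eqF // mulr1 mulrA mulVf ?gt_eqF // mul1r.
have p1 eta : (0 <= ((wt sg eta)^-1)%:E)%E by rewrite lee_fin ltW.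
rewrite ge0_integralZl_EFin ?powR_ge0 //; last 2 first.
- by move=> eta _; rewrite -EFinD lee_fin addr_ge0 ?ltW.
- exact: emeasurable_funD.
rewrite ge0_integralD //.
apply: (@le_trans _ _ ((4 `^ sg)%:E * ((Kwt sg)%:E + (Kwt sg)%:E))%E).
  apply: lee_wpmul2l; first by rewrite lee_fin powR_ge0.
  by apply: leeD; [exact: integral_wtV|exact: integral_wtV_sub].
rewrite -EFinD -EFinM lee_fin /Kconv.
by rewrite (_ : 4 `^ sg * _ = 2 * 4 `^ sg * Kwt sg) ?lerDr //; ring.
Qed.

(** Cauchy-Schwarz in the inner integral, with the weights of both factors, and
    Fubini. *)
Lemma wL2_conv sg N M a c : 2^-1 < sg -> wL2 sg N a -> wL2 sg M c ->
  wL2 sg (Kconv sg * (N * M)) (conv a c).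
Proof.
move=> s2 aN cM.
have ia : itg setT a := wL2_integrable s2 aN.
have ic : itg setT c := wL2_integrable s2 cM.
case: aN => ma N0 aN; case: cM => mc M0 cM.
have K1 := Kconv_ge1 sg; have K0 : 0 < Kconv sg by exact: lt_le_trans ltr01 K1.
split; [exact: conv_measurable|by rewrite !mulr_gt0|].
pose A eta := wt sg eta * a eta ^+ 2.
pose C eta := wt sg eta * c eta ^+ 2.
have A0 eta : 0 <= A eta by rewrite mulr_ge0 ?wt_ge0 ?sqr_ge0.
have C0 eta : 0 <= C eta by rewrite mulr_ge0 ?wt_ge0 ?sqr_ge0.
have mA : measurable_fun [set: R] A by apply: measurable_funM => //; exact: measurable_funX.
have mC : measurable_fun [set: R] C by apply: measurable_funM => //; exact: measurable_funX.
pose P xi : \bar R := (\int[leb]_eta (A (xi - eta) * C eta)%:E)%E.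
have P0 xi : (0 <= P xi)%E by apply: integral_ge0 => eta _; rewrite lee_fin mulr_ge0.
pose g0 (z : measurableTypeR R * measurableTypeR R) : \bar R := (A (z.1 - z.2) * C z.2)%:E.
have mg0 : measurable_fun setT g0 by apply/measurable_EFinP; exact: mconv.
have g00 z : (0 <= g0 z)%E by rewrite lee_fin mulr_ge0.
have mP : measurable_fun [set: R] P.
  exact: (@measurable_fun_fubini_tonelli_F _ _ (measurableTypeR R) (measurableTypeR R) R leb g0 mg0).
have mE : measurable_fun [set: R] (fun xi => (wt sg xi * conv a c xi ^+ 2)%:E).
  apply/measurable_EFinP; apply: measurable_funM => //.
  by apply: measurable_funX; exact: conv_measurable.
apply: (@le_trans _ _ (\int[leb]_xi ((Kconv sg ^+ 2)%:E * P xi))%E).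
  apply: ge0_le_integral => //.
  - by move=> xi _; rewrite lee_fin mulr_ge0 ?wt_ge0 ?sqr_ge0.
  - exact: emeasurable_funM.
  - move=> xi _.
    have [Py|Pf] := eqVneq (P xi) +oo%E.
      by rewrite Py gt0_muley ?leey // lte_fin exprn_gt0.
    have Pfin : P xi = (fine (P xi))%:E by rewrite fineK // ge0_fin_numE // ltey.
    set p := fine (P xi) in Pfin; have p0 : 0 <= p by rewrite -lee_fin -Pfin.
    rewrite Pfin -EFinM lee_fin.
    have mh := mwt (sg / 2).
    have mh' : measurable_fun [set: R] (fun eta => (wt (sg / 2) eta)^-1).
      by apply/measurable_EFinP; exact: mVwt.
    have := @cauchy_schwarz_integral _ _ R leb
      (fun eta => wt (sg / 2) xi * ((wt (sg / 2) (xi - eta))^-1 * (wt (sg / 2) eta)^-1))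
      (fun eta => (wt (sg / 2) (xi - eta) * a (xi - eta)) * (wt (sg / 2) eta * c eta))
      (Kconv sg) (Num.sqrt p).
    have -> : (fun eta => `|wt (sg / 2) xi * ((wt (sg / 2) (xi - eta))^-1 * (wt (sg / 2) eta)^-1) *
         ((wt (sg / 2) (xi - eta) * a (xi - eta)) * (wt (sg / 2) eta * c eta))|%:E) =
         (fun eta => `|wt (sg / 2) xi * (a (xi - eta) * c eta)|%:E).
      apply/funext => eta; congr (`|_|%:E).
      have := wt_gt0 (sg / 2) eta; have := wt_gt0 (sg / 2) (xi - eta).
      by move=> /lt0r_neq0 h1 /lt0r_neq0 h2; field; rewrite h1 h2.
    have -> : (fun eta => ((wt (sg / 2) xi * ((wt (sg / 2) (xi - eta))^-1 * (wt (sg / 2) eta)^-1)) ^+ 2)%:E) =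
       (fun eta => (wt sg xi / (wt sg (xi - eta) * wt sg eta))%:E).
      by apply/funext => eta; rewrite !exprMn !exprVn !wt_half invfM.
    have -> : (fun eta => ((wt (sg / 2) (xi - eta) * a (xi - eta) * (wt (sg / 2) eta * c eta)) ^+ 2)%:E) =
       (fun eta => (A (xi - eta) * C eta)%:E).
      by apply/funext => eta; rewrite !exprMn !wt_half.
    move=> H.
    have mac : measurable_fun [set: R] (fun eta => a (xi - eta) * c eta).
      by apply: measurable_funM => //; exact: (@msub xi a).
    have [ii] : itg setT (fun eta => wt (sg / 2) xi * (a (xi - eta) * c eta)) /\
       `|\int[leb]_eta (wt (sg / 2) xi * (a (xi - eta) * c eta))| <= Kconv sg * Num.sqrt p.
      apply: RI_norm_le => //; first exact: measurable_funM.
      apply: H.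
      - apply: measurable_funM => //; apply: measurable_funM => //.
        exact: (@msub xi (fun eta => (wt (sg / 2) eta)^-1)).
      - apply: measurable_funM; last exact: measurable_funM.
        by apply: (@msub xi (fun eta => wt (sg / 2) eta * a eta)); exact: measurable_funM.
      - exact: ltW.
      - exact: sqrtr_ge0.
      - apply: (le_trans (conv_kernel xi s2)).
        by rewrite lee_fin expr2 ler_peMl // ltW.
      - by rewrite sqr_sqrtr // -Pfin.
    have i2 : itg setT (fun eta => a (xi - eta) * c eta).
      have := itgZl (wt (sg / 2) xi)^-1 measurableT ii.
      by under eq_fun do rewrite mulKf ?lt0r_neq0 ?wt_gt0 //.
    rewrite RIZl // -/(conv a c xi) => le1.
    rewrite -(wt_half sg xi) -exprMn -[X in _ <= _ * X](sqr_sqrtr p0) -exprMn.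
    by rewrite -real_normK ?num_real // ler_sqr ?nnegrE // mulr_ge0 ?sqrtr_ge0 // ltW.
rewrite ge0_integralZl_EFin ?sqr_ge0 //.
have -> : (\int[leb]_xi P xi = (\int[leb]_eta (A eta)%:E) * (\int[leb]_eta (C eta)%:E))%E.
  rewrite /P (@fubini_tonelli _ _ (measurableTypeR R) (measurableTypeR R) R leb leb g0 mg0) //.
  have IAfin : (\int[leb]_eta (A eta)%:E)%E \is a fin_num.
    rewrite ge0_fin_numE; first exact: le_lt_trans aN (ltry _).
    by apply: integral_ge0 => eta _; rewrite lee_fin.
  have C0' eta : (0 <= (C eta)%:E)%E by rewrite lee_fin.
  rewrite -(fineK IAfin) -ge0_integralZl_EFin //; last 2 first.
  - exact/measurable_EFinP.
  - by rewrite fine_ge0 // integral_ge0 // => eta _; rewrite lee_fin.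
  apply: eq_integral => eta _; rewrite fineK // /g0 /=.
  have -> : (fun xi => (A (xi - eta) * C eta)%:E) = (fun xi => (C eta)%:E * (A (xi - eta))%:E)%E.
    by apply/funext => xi; rewrite -EFinM mulrC.
  rewrite ge0_integralZl_EFin //; last 2 first.
  - by move=> xi _; rewrite lee_fin.
  - by apply/measurable_EFinP; exact: (measurable_shift (- eta) mA).
  rewrite (@ge0_integral_shift R (- eta) (fun xi => (A xi)%:E)) 1?muleC //.
    exact/measurable_EFinP.
rewrite exprMn [leRHS]EFinM; apply: lee_wpmul2l; first by rewrite lee_fin sqr_ge0.
by rewrite exprMn EFinM; apply: lee_pmul => //; apply: integral_ge0 => eta _; rewrite lee_fin.
Qed.

End Convolution.
(** * Sobolev balls: algebra, derivative, Neumann series *)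

Section HartleyClass.
Variable R : realType.
Local Notation leb := (@lebesgue_measure R).
Implicit Types (sg xi eta x N M : R) (a c f g : R -> R).

(** The functions of H^sg of norm at most N, up to constants relating N to
    [Hs_norm]; being an absolutely convergent integral, f is defined at every
    point. *)
Definition Hs_ball sg N f : Prop := exists2 c, wL2 sg N c & forall x, f x = hart c x.

Lemma Hs_ball_gt0 sg N f : Hs_ball sg N f -> 0 < N.
Proof. by case=> c []. Qed.

Lemma Hs_ball_ext sg N f g : (forall x, f x = g x) -> Hs_ball sg N f -> Hs_ball sg N g.
Proof. by move=> fg [c cN fc]; exists c => // x; rewrite -fg. Qed.

Lemma Hs_ball_mono sg sg' N M f : sg <= sg' -> N <= M -> Hs_ball sg' N f -> Hs_ball sg M f.
Proof. by move=> ss NM [c cN fc]; exists c => //; exact: wL2_mono cN. Qed.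

Lemma Hs_ball_bound sg N f x : 2^-1 < sg -> Hs_ball sg N f -> `|f x| <= 2 * Kwt sg * N.
Proof. by move=> s2 [c cN ->]; rewrite -mulrA; exact: hart_bound cN. Qed.

Lemma hartD c c' x : itg setT c -> itg setT c' ->
  hart (fun xi => c xi + c' xi) x = hart c x + hart c' x.
Proof.
move=> ic ic'; rewrite /hart -RID //; last 2 first.
- exact: hart_integrable ic.
- exact: hart_integrable ic'.
by apply: eq_RI => xi _; rewrite mulrDl.
Qed.

Lemma hartZ c x (k : R) : itg setT c -> hart (fun xi => k * c xi) x = k * hart c x.
Proof.
move=> ic; rewrite /hart -RIZl //; last exact: hart_integrable ic.
by apply: eq_RI => xi _; rewrite mulrA.
Qed.

Lemma Hs_ball_add sg N M f g : 2^-1 < sg -> Hs_ball sg N f -> Hs_ball sg M g ->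
  Hs_ball sg (2 * (N + M)) (fun x => f x + g x).
Proof.
move=> s2 [c cN fc] [c' cM gc].
exists (fun xi => c xi + c' xi); first exact: wL2_add.
by move=> x; rewrite fc gc hartD //; apply: wL2_integrable; eassumption.
Qed.

Lemma Hs_ball_scale sg N f (k L : R) : 2^-1 < sg -> 0 < L -> `|k| <= L -> Hs_ball sg N f ->
  Hs_ball sg (L * N) (fun x => k * f x).
Proof.
move=> s2 L0 kL [c cN fc].
exists (fun xi => k * c xi); first exact: wL2_scale.
by move=> x; rewrite fc hartZ //; apply: wL2_integrable; eassumption.
Qed.

Lemma odd_RI f : itg setT f -> (forall x, f (- x) = - f x) -> \int[leb]_x f x = 0.
Proof.
move=> fi fo; have := Rintegral_opp fi.
have -> : \int[leb]_x f (- x) = - \int[leb]_x f x.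
  by rewrite -[RHS]mulN1r -RIZl //; apply: eq_RI => x _; rewrite fo mulN1r.
lra.
Qed.

Lemma hart_opp c x : itg setT c -> hart (fun xi => c (- xi)) x = hart c (- x).
Proof.
move=> ic; have ih : itg setT (fun xi => c xi * cas (- x * xi)) by exact: hart_integrable ic.
rewrite /hart -(Rintegral_opp ih).
by apply: eq_RI => xi _; rewrite mulrNN.
Qed.

Let mcosM x : measurable_fun [set: R] (fun y => cos (x * y)).
Proof.
apply: (@measurableT_comp _ _ _ _ _ _ (@cos R) _ (fun y => x * y)); last exact: mulrl_measurable.
exact: continuous_measurable_fun (@continuous_cos R).
Qed.

Let msinM x : measurable_fun [set: R] (fun y => sin (x * y)).
Proof.
apply: (@measurableT_comp _ _ _ _ _ _ (@sin R) _ (fun y => x * y)); last exact: mulrl_measurable.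
exact: continuous_measurable_fun (@continuous_sin R).
Qed.

Let icos c x : itg setT c -> itg setT (fun xi => c xi * cos (x * xi)).
Proof. by move=> ic; apply: (itgM (B := 1) _ ic) => // y _; rewrite ler_norml cos_le1 cos_geN1. Qed.

Let isin c x : itg setT c -> itg setT (fun xi => c xi * sin (x * xi)).
Proof. by move=> ic; apply: (itgM (B := 1) _ ic) => // y _; rewrite ler_norml sin_le1 sin_geN1. Qed.

Lemma hart_conv_even a c x : itg setT a -> itg setT c ->
  (forall xi, c (- xi) = c xi) -> hart (conv a c) x = hart a x * hart c x.
Proof.
move=> ia ic ce; rewrite conv_hart //.
have s0 : \int[leb]_xi (c xi * sin (x * xi)) = 0.
  by apply: odd_RI => [|y]; [exact: isin|rewrite ce mulrN sinN mulrN].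
rewrite s0 mulr0 addr0; congr (_ * _).
rewrite -[LHS]addr0 -s0 -RID //; [|exact: icos|exact: isin].
by apply: eq_RI => xi _; rewrite /cas mulrDr.
Qed.

(** The reflection of a compensates the minus sign in [conv_hart]. *)
Lemma hart_conv_odd a c x : itg setT a -> itg setT c ->
  (forall xi, c (- xi) = - c xi) -> hart (conv (fun xi => a (- xi)) c) x = hart a x * hart c x.
Proof.
move=> ia ic ce; have ia' := itg_opp ia; rewrite conv_hart //.
have s0 : \int[leb]_xi (c xi * cos (x * xi)) = 0.
  by apply: odd_RI => [|y]; [exact: icos|rewrite ce mulrN cosN mulNr].
rewrite s0 mulr0 add0r hart_opp // opprK; congr (_ * _).
rewrite -[LHS]addr0 -s0 -RID //; [|exact: isin|exact: icos].
by apply: eq_RI => xi _; rewrite /cas -mulrDr addrC.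
Qed.

(** The density of g is split into its even and odd parts, for which the transform
    of the convolution is the product up to a reflection; [wL2_conv] bounds each
    of the two convolutions. *)
Lemma Hs_ball_mul sg N M f g : 2^-1 < sg -> Hs_ball sg N f -> Hs_ball sg M g ->
  Hs_ball sg (16 * Kconv sg * (N * M)) (fun x => f x * g x).
Proof.
move=> s2 [a aN fa] [c cM gc].
have h1 : `|2^-1 : R| <= 1 by rewrite ger0_norm ?invr_ge0 // invf_le1 // ler1n.
pose ce xi := 2^-1 * (c xi + c (- xi)).
pose co xi := 2^-1 * (c xi + -1 * c (- xi)).
have ceM : wL2 sg (1 * (2 * (M + M))) ce.
  by apply: wL2_scale => //; apply: wL2_add => //; exact: wL2_opp.
have coM : wL2 sg (1 * (2 * (M + 1 * M))) co.
  apply: wL2_scale => //; apply: wL2_add => //; apply: wL2_scale => //.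
    by rewrite normrN normr1.
  exact: wL2_opp.
have E := wL2_add (wL2_conv s2 aN ceM) (wL2_conv s2 (wL2_opp aN) coM).
exists (fun xi => conv a ce xi + conv (fun xi => a (- xi)) co xi).
  apply: wL2_mono E => //; rewrite le_eqVlt; apply/orP; left; apply/eqP; ring.
move=> x.
have ia := wL2_integrable s2 aN; have ic := wL2_integrable s2 cM.
have ie := wL2_integrable s2 ceM; have io := wL2_integrable s2 coM.
rewrite hartD; last 2 first.
- exact: wL2_integrable s2 (wL2_conv s2 aN ceM).
- exact: wL2_integrable s2 (wL2_conv s2 (wL2_opp aN) coM).
rewrite hart_conv_even //; last by move=> xi; rewrite /ce opprK addrC.
rewrite hart_conv_odd //; last by move=> xi; rewrite /co opprK; ring.
rewrite -mulrDr -hartD // fa gc; congr (_ * _).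
by congr (hart _ _); apply/funext => xi; rewrite /ce /co; field.
Qed.

Lemma wL2_dx sg N c : wL2 (sg + 1) N c -> wL2 sg N (fun xi => xi * c xi).
Proof.
move=> [mc N0 cN]; split=> //; first exact: measurable_funM.
apply: le_trans cN; apply: ge0_le_integral => //.
- by move=> xi _; rewrite lee_fin mulr_ge0 ?wt_ge0 ?sqr_ge0.
- apply/measurable_EFinP; apply: measurable_funM; first exact: measurable_wt.
  by apply: measurable_funX; exact: measurable_funM.
- apply/measurable_EFinP; apply: measurable_funM; first exact: measurable_wt.
  exact: measurable_funX.
- move=> xi _; rewrite lee_fin wtS exprMn mulrA ler_wpM2r ?sqr_ge0 //.
  by rewrite mulrC ler_wpM2r ?wt_ge0 // /japsq lerDr.
Qed.

Lemma is_derive_cas (x : R) : is_derive x 1 (@cas R) (cas (- x)).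
Proof.
have := @is_deriveD _ _ _ (@cos R) (@sin R) x 1 _ _ (is_derive_cos x) (is_derive_sin x).
by move=> h; apply: (is_derive_eq h); rewrite /cas cosN sinN addrC.
Qed.

(** The density of f is still integrable after multiplication by the frequency,
    so that one differentiates under the integral; the derivative of cas (x xi) in
    x is xi cas (- x xi), whence a reflection. *)
Lemma Hs_ball_deriv sg N f : 2^-1 < sg -> Hs_ball (sg + 1) N f ->
  (forall x, derivable f x 1) /\ Hs_ball sg N (derive1 f).
Proof.
move=> s2 [c cN fc].
have s2' : 2^-1 < sg + 1 by rewrite (lt_trans s2) // ltrDl.
have ic : itg setT c := wL2_integrable s2' cN.
have cN' := wL2_dx cN.
have ic' : itg setT (fun xi => xi * c xi) := wL2_integrable s2 cN'.
have fE : f = hart c by apply/funext.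
pose F x xi := c xi * cas (x * xi).
have dF x xi : is_derive x 1 (fun y => F y xi) (xi * c xi * cas (- x * xi)).
  have h1 := is_derive_cas (x * xi).
  have h2 : is_derive x 1 (fun y : R => y * xi) xi.
    have := @is_deriveZ _ _ _ (@id R) xi x 1 1 (is_derive_id x 1).
    move=> h; have : is_derive x 1 (xi \*: id) xi by apply: (is_derive_eq h); rewrite /GRing.scale /= mulr1.
    by rewrite (_ : xi \*: id = (fun y => y * xi)) //; apply/funext => y /=; rewrite /GRing.scale /= mulrC.
  have h3 := @is_derive1_comp R (@cas R) (fun y => y * xi) x _ _ h1 h2.
  have h4 := @is_deriveZ _ _ _ _ (c xi) _ _ _ h3.
  by apply: (is_derive_eq h4); rewrite /GRing.scale /= mulNr; ring.
have d1F x xi : partial1of2 F x xi = xi * c xi * cas (- x * xi).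
  by rewrite partial1of2E; case: (dF x xi).
pose G xi := 2 * `|xi * c xi|.
have iG : itg setT G by apply: itgZl => //; exact: integrable_norm.
have H x : derivable (hart c) x 1 /\ derive1 (hart c) x = hart (fun xi => - xi * c (- xi)) x.
  have xI : [set` `](x - 1), (x + 1)[] x by rewrite /= in_itv /= ltrDl ltrBlDr ltrDl ltr01.
  have iF y : [set` `](x - 1), (x + 1)[] y -> leb.-integrable setT (EFin \o F y).
    by move=> _; exact: hart_integrable ic.
  have dF' y xi : [set` `](x - 1), (x + 1)[] y -> [set: R] xi -> derivable (F ^~ xi) y 1.
    by move=> _ _; case: (dF y xi).
  have G0 xi : 0 <= G xi by rewrite mulr_ge0.
  have FG y xi : [set` `](x - 1), (x + 1)[] y -> [set: R] xi -> `|partial1of2 F y xi| <= G xi.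
    by move=> _ _; rewrite d1F normrM mulrC /G ler_wpM2r // cas_bound.
  split.
    exact: (@derivable_under_integral R _ _ leb F setT measurableT x (x - 1) (x + 1) xI iF dF' G G0 iG FG).
  rewrite (@differentiation_under_integral R _ _ leb F setT measurableT x (x - 1) (x + 1) xI iF dF' G G0 iG FG).
  transitivity (hart (fun xi => xi * c xi) (- x)).
    by apply: eq_RI => xi _; rewrite d1F.
  by rewrite -hart_opp.
rewrite fE; split=> [x|]; first exact: (H x).1.
exists (fun xi => - xi * c (- xi)); first exact: (wL2_opp cN').
by move=> x; case: (H x).
Qed.

Lemma continuous_casM xi : continuous (fun x => cas (x * xi)).
Proof.
move=> y; apply: (@continuous_comp _ _ _ (fun x : R => x * xi) (@cas R)); last exact: continuous_cas.
by apply: cvgM; [exact: cvg_id|exact: cvg_cst].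
Qed.

Lemma Hs_ball_continuous sg N f : 2^-1 < sg -> Hs_ball sg N f -> continuous f.
Proof.
move=> s2 [c cN fc].
have ic : itg setT c := wL2_integrable s2 cN.
have -> : f = hart c by apply/funext.
pose F x xi := c xi * cas (x * xi).
move=> x.
have xI : x \in [set` `](x - 1), (x + 1)[] by rewrite inE /= in_itv /= ltrDl ltrBlDr ltrDl ltr01.
apply: (@continuity_under_integral R _ _ leb F setT measurableT (x - 1) (x + 1) _ _ (fun xi => 2 * `|c xi|)) => //.
- by move=> y _; exact: hart_integrable ic.
- apply: aeW => xi _ y _; apply: cvgM; first exact: cvg_cst.
  exact: continuous_casM.
- by apply: (itgZl 2 measurableT); exact: integrable_norm.
- by move=> y _; apply: aeW => xi _; rewrite /F normrM mulrC ler_wpM2r // cas_bound.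
Qed.

End HartleyClass.

Section HartleySeries.
Variable R : realType.
Local Notation leb := (@lebesgue_measure R).
Implicit Types (sg xi eta x N M : R) (a c f g : R -> R).

Lemma nneseries_le_bound (u : nat -> \bar R) (B : \bar R) : (forall n, 0 <= u n)%E ->
  (forall n, \sum_(0 <= k < n) u k <= B)%E -> (\sum_(0 <= k <oo) u k <= B)%E.
Proof.
move=> u0 uB; apply: lime_le; first exact: is_cvg_nneseries.
exact: nearW.
Qed.

Lemma sum_half (n : nat) : \sum_(0 <= k < n) (2^-1 : R) ^+ k = 2 - 2 * 2^-1 ^+ n.
Proof.
elim: n => [|n IH]; first by rewrite big_geq // expr0; ring.
by rewrite big_nat_recr //= IH exprS; field.
Qed.

Lemma sum_half_le (n : nat) : \sum_(0 <= k < n) (2^-1 : R) ^+ k <= 2.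
Proof. by rewrite sum_half gerBl mulr_ge0 // exprn_ge0 // invr_ge0. Qed.

(** Cauchy-Schwarz against the weights 2^(- k), whose sum is at most 2. *)
Lemma sqr_sum_le (c : nat -> R) (n : nat) :
  (\sum_(0 <= k < n) c k) ^+ 2 <= 2 * \sum_(0 <= k < n) 2 ^+ k * c k ^+ 2.
Proof.
pose p := fun n : nat => 2 - 2 * (2^-1 : R) ^+ n.
pose Q := fun n : nat => \sum_(0 <= k < n) 2 ^+ k * c k ^+ 2.
have Q0 m : 0 <= Q m.
  by apply: sumr_ge0 => k _; rewrite mulr_ge0 ?sqr_ge0 ?exprn_ge0.
have p0 m : 0 <= p m.
  by rewrite subr_ge0 ler_piMr // exprn_ile1 ?invr_ge0 // invf_le1 ?ler1n.
suff H : (\sum_(0 <= k < n) c k) ^+ 2 <= p n * Q n.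
  apply: (le_trans H); apply: ler_wpM2r; first exact: Q0.
  by rewrite gerBl mulr_ge0 // exprn_ge0 // invr_ge0.
elim: n => [|n IH]; first by rewrite big_geq // expr0n /= mulr_ge0.
rewrite big_nat_recr //= /Q [in leRHS]big_nat_recr //= -/(Q n).
move: IH; set S := \sum_(0 <= k < n) c k; move: (c n) => y IH.
have [q0 q0'] : 0 < (2^-1 : R) ^+ n /\ (2:R) ^+ n = ((2^-1 : R) ^+ n)^-1.
  by split; [rewrite exprn_gt0 // invr_gt0|rewrite exprVn invrK].
have -> : p n.+1 = p n + 2^-1 ^+ n by rewrite /p exprS; field.
rewrite q0'; move: (2^-1 ^+ n) q0 {q0'} => q q0.
move: (p n) (p0 n) (Q n) (Q0 n) IH => P P0 q1 q10 IH.
have [P00|Pn] := eqVneq P 0.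
  have S0 : S = 0 by apply/eqP; rewrite -sqrf_eq0 eq_le sqr_ge0 andbT -(mul0r q1) -P00.
  rewrite S0 P00 !add0r mulrDr mulrA divff ?lt0r_neq0 // mul1r lerDr.
  by rewrite mulr_ge0 // ltW.
have Pp : 0 < P by rewrite lt_neqAle eq_sym Pn.
have h1 : S ^+ 2 / P <= q1 by rewrite ler_pdivrMr // mulrC.
have h2 : 0 <= (q * S - P * y) ^+ 2 / (P * q) by rewrite divr_ge0 ?sqr_ge0 // mulr_ge0 // ltW.
have -> : (P + q) * (q1 + q^-1 * y ^+ 2) = (P * q1 - S ^+ 2) + q * (q1 - S ^+ 2 / P) +
   (q * S - P * y) ^+ 2 / (P * q) + (S + y) ^+ 2.
  by field; rewrite !lt0r_neq0.
rewrite lerDr; apply: addr_ge0 => //; apply: addr_ge0; first by rewrite subr_ge0.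
by rewrite mulr_ge0 ?subr_ge0 // ltW.
Qed.

Lemma cvg_bounded_series (c : nat -> R) :
  (\sum_(0 <= k <oo) `|c k|%:E < +oo)%E -> cvgn (series c).
Proof.
move=> cS; apply: normed_cvg.
apply: nondecreasing_is_cvgn.
  apply/nondecreasing_seqP => n.
  change (series (fun k => `|c k|) n <= series (fun k => `|c k|) n.+1).
  by rewrite seriesSr lerDl.
exists (fine (\sum_(0 <= k <oo) `|c k|%:E)%E) => _ [n _ <-].
rewrite -lee_fin fineK; last first.
  by rewrite ge0_fin_numE // nneseries_ge0.
rewrite /series /= -sumEFin; exact: nneseries_lim_ge.
Qed.

(** The ratio 1/4 leaves, after Cauchy-Schwarz against 2^(- k), a convergent series
    of squared norms; the sum of the densities then converges almost everywhere,
    with the bound in the weighted L2 space. *)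
Lemma Hs_ball_series sg N (f_ : nat -> R -> R) (F : R -> R) : 2^-1 < sg ->
  (forall n, Hs_ball sg (N * 4^-1 ^+ n) (f_ n)) ->
  (forall x, (\sum_(0 <= k < n) f_ k x) @[n --> \oo] --> F x) ->
  Hs_ball sg (2 * N) F.
Proof.
move=> s2 Hf fF.
have N0 : 0 < N by have := Hs_ball_gt0 (Hf 0%N); rewrite expr0 mulr1.
have /choice[c Hc] : forall n, exists c,
    wL2 sg (N * 4^-1 ^+ n) c /\ forall x, f_ n x = hart c x.
  by move=> n; case: (Hf n) => c cN fc; exists c.
have mc n : measurable_fun [set: R] (c n) by case: (Hc n) => -[].
have ic n : itg setT (c n) by case: (Hc n) => /(wL2_integrable s2).
pose G xi : \bar R := (\sum_(0 <= k <oo) `|c k xi|%:E)%E.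
have mcE n : measurable_fun [set: R] (fun xi => `|c n xi|%:E).
  by apply/measurable_EFinP; exact: measurableT_comp.
have mG : measurable_fun [set: R] G.
  exact: (@ge0_emeasurable_sum _ _ _ setT (fun k xi => `|c k xi|%:E) xpredT).
have G0 xi : (0 <= G xi)%E by exact: nneseries_ge0.
have K1 := Kwt_ge1 sg; have K0 : 0 < Kwt sg by exact: lt_le_trans ltr01 K1.
have q42 k : (4^-1 : R) ^+ k <= 2^-1 ^+ k.
  by apply: lerXn2r; rewrite ?nnegrE ?invr_ge0 // lef_pV2 ?posrE // ler_nat.
have IG : (\int[leb]_xi G xi <= (Kwt sg * N * 2)%:E)%E.
  rewrite integral_nneseries //; apply: nneseries_le_bound => [n|n].
    by apply: integral_ge0 => xi _; rewrite lee_fin.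
  apply: (@le_trans _ _ (\sum_(0 <= k < n) (Kwt sg * N * 2^-1 ^+ k)%:E)%E).
    apply: lee_sum => k _; apply: (le_trans (wL2_L1 s2 (Hc k).1)).
    by rewrite lee_fin mulrA ler_wpM2l // mulr_ge0 // ltW.
  by rewrite sumEFin lee_fin -mulr_sumr ler_wpM2l ?sum_half_le // mulr_ge0 // ltW.
have iG : leb.-integrable setT G.
  apply/integrableP; split=> //.
  rewrite (_ : (fun xi => _) = G); first exact: le_lt_trans IG (ltry _).
  by apply/funext => xi; rewrite gee0_abs.
have aeG : {ae leb, forall xi, (G xi < +oo)%E}.
  apply: (@filterS _ _ (ae_filter_ringOfSetsType leb) _ _ _ (integrable_ae measurableT iG)).
  by move=> xi /(_ I); rewrite ge0_fin_numE.
pose d xi : R := if (G xi < +oo)%E then 1 else 0.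
have md : measurable_fun [set: R] d.
  apply: measurable_fun_ifT => //.
  exact: measurable_fun_lte.
pose A xi := d xi * limn (series (c ^~ xi)).
have cvA xi : (d xi * \sum_(0 <= k < n) c k xi) @[n --> \oo] --> A xi.
  rewrite /A /d; case: ifPn => [Gxi|_]; last first.
    by rewrite mul0r; under eq_fun do rewrite mul0r; exact: cvg_cst.
  by apply: cvgM; [exact: cvg_cst|exact: cvg_bounded_series].
have mS n : measurable_fun [set: R] (fun xi => \sum_(0 <= k < n) c k xi).
  exact: measurable_sum.
have mA : measurable_fun [set: R] A.
  apply: (@measurable_fun_cvg _ _ R setT (fun n xi => d xi * \sum_(0 <= k < n) c k xi)) => [n|xi _].
    exact: measurable_funM.
  exact: cvA.
have d01 xi : 0 <= d xi <= 1 by rewrite /d; case: ifP => _; rewrite ler01 lexx.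
have mW : measurable_fun [set: R] (wt sg) by exact: measurable_wt.
pose H (k : nat) xi : \bar R := (2 * (2 ^+ k * (wt sg xi * c k xi ^+ 2)))%:E.
have H0 k xi : (0 <= H k xi)%E.
  by rewrite lee_fin mulr_ge0 // mulr_ge0 ?exprn_ge0 // mulr_ge0 ?wt_ge0 ?sqr_ge0.
have mH k : measurable_fun [set: R] (H k).
  apply/measurable_EFinP; do 2 apply: measurable_funM => //.
  by apply: measurable_funM => //; exact: measurable_funX.
have AN : wL2 sg (2 * N) A.
  split=> //; first by rewrite mulr_gt0.
  apply: (@le_trans _ _ (\int[leb]_xi (\sum_(0 <= k <oo) H k xi))%E).
    apply: ge0_le_integral => //.
    - by move=> xi _; rewrite lee_fin mulr_ge0 ?wt_ge0 ?sqr_ge0.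
    - by apply/measurable_EFinP; apply: measurable_funM => //; exact: measurable_funX.
    - exact: (@ge0_emeasurable_sum _ _ _ setT (fun k xi => H k xi) xpredT).
    - move=> xi _.
      have [->|Bf] := eqVneq (\sum_(0 <= k <oo) H k xi)%E +oo%E; first by rewrite leey.
      have : (\sum_(0 <= k <oo) H k xi)%E = (fine (\sum_(0 <= k <oo) H k xi))%:E.
        by rewrite fineK // ge0_fin_numE ?nneseries_ge0 // ltey.
      set B := fine _ => BE; rewrite BE lee_fin.
      have cv : (wt sg xi * (d xi * \sum_(0 <= k < n) c k xi) ^+ 2) @[n --> \oo] --> wt sg xi * A xi ^+ 2.
        apply: cvgM; first exact: cvg_cst.
        by rewrite expr2; under eq_fun do rewrite expr2; apply: cvgM; exact: cvA.
      rewrite -(cvg_lim _ cv) //; apply: limr_le; first by apply/cvg_ex; eexists; exact: cv.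
      apply: nearW => n; rewrite -lee_fin -BE.
      apply: le_trans (nneseries_lim_ge n _) => //.
      rewrite sumEFin lee_fin exprMn mulrCA.
      apply: (@le_trans _ _ (wt sg xi * (\sum_(0 <= k < n) c k xi) ^+ 2)).
        rewrite ler_piMl //; first by rewrite mulr_ge0 ?wt_ge0 // sqr_ge0.
        by case/andP: (d01 xi) => d0 d1; rewrite exprn_ile1.
      apply: (@le_trans _ _ (wt sg xi * (2 * \sum_(0 <= k < n) 2 ^+ k * c k xi ^+ 2))).
        by rewrite ler_wpM2l ?wt_ge0 // sqr_sum_le.
      rewrite mulrCA -mulr_sumr ler_wpM2l // mulr_sumr le_eqVlt; apply/orP; left; apply/eqP.
      by apply: eq_bigr => k _; rewrite mulrCA.
  rewrite integral_nneseries //; apply: nneseries_le_bound => [n|n].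
    exact: integral_ge0.
  apply: (@le_trans _ _ (\sum_(0 <= k < n) (2 * N ^+ 2 * 2^-1 ^+ k)%:E)%E).
    apply: lee_sum => k _.
    have -> : (\int[leb]_xi H k xi = (2 * 2 ^+ k)%:E * \int[leb]_xi (wt sg xi * c k xi ^+ 2)%:E)%E.
      rewrite -ge0_integralZl_EFin ?mulr_ge0 ?exprn_ge0 //.
      - by apply: eq_integral => xi _; rewrite /H -EFinM mulrA.
      - by move=> xi _; rewrite lee_fin mulr_ge0 ?wt_ge0 ?sqr_ge0.
      - apply/measurable_EFinP; apply: measurable_funM; first exact: mW.
        exact: (measurable_funX _ (mc k)).
    apply: (@le_trans _ _ ((2 * 2 ^+ k)%:E * ((N * 4^-1 ^+ k) ^+ 2)%:E)%E).
      apply: lee_wpmul2l; first by rewrite lee_fin mulr_ge0 ?exprn_ge0.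
      by case: (Hc k) => -[].
    rewrite -EFinM lee_fin exprMn.
    have -> : 2 * 2 ^+ k * (N ^+ 2 * (4^-1 ^+ k) ^+ 2) = 2 * N ^+ 2 * (2 ^+ k * (4^-1 ^+ k) ^+ 2) by ring.
    apply: ler_wpM2l; first by rewrite mulr_ge0 // sqr_ge0.
    have -> : (4^-1 : R) = 2^-1 * 2^-1 by field.
    rewrite exprMn expr2; set q := 2^-1 ^+ k.
    have -> : (2:R) ^+ k = q^-1 by rewrite /q exprVn invrK.
    have q0 : 0 < q by rewrite exprn_gt0 // invr_gt0.
    have q1 : q <= 1 by rewrite exprn_ile1 ?invr_ge0 // invf_le1 ?ler1n.
    have -> : q^-1 * (q * q * (q * q)) = q * (q * q) by field; rewrite lt0r_neq0.
    by apply: ler_piMr; [exact: ltW|apply: mulr_ile1 => //; exact: ltW].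
  rewrite sumEFin lee_fin -mulr_sumr.
  have -> : (2 * N) ^+ 2 = 2 * N ^+ 2 * 2 by ring.
  by rewrite ler_wpM2l ?sum_half_le // mulr_ge0 ?sqr_ge0.
exists A => // x.
have iA : itg setT A := wL2_integrable s2 AN.
have ihA := hart_integrable x iA.
have icn n : itg setT (fun xi => \sum_(0 <= k < n) c k xi * cas (x * xi)).
  rewrite /itg (_ : EFin \o _ = (fun xi => \sum_(k <- index_iota 0 n) (c k xi * cas (x * xi))%:E)%E).
    by apply: integrable_sum => // k _; exact: hart_integrable (ic k).
  by apply/funext => xi; rewrite /= sumEFin.
have mE1 n : measurable_fun [set: R] (fun xi => (\sum_(0 <= k < n) c k xi * cas (x * xi))%:E).
  by apply/measurable_EFinP; exact: itg_measurable (icn n).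
have mE2 : measurable_fun [set: R] (fun xi => (A xi * cas (x * xi))%:E).
  by apply/measurable_EFinP; exact: itg_measurable ihA.
have iG2 : leb.-integrable setT (fun xi => (2%:E * G xi)%E) by exact: integrableZl.
have aecv : {ae leb, forall xi, [set: R] xi ->
   ((\sum_(0 <= k < n) c k xi * cas (x * xi))%:E @[n --> \oo] --> (A xi * cas (x * xi))%:E)%E}.
  apply: (@filterS _ _ (ae_filter_ringOfSetsType leb) _ _ _ aeG) => xi Gxi _.
  apply: cvg_EFin; first exact: nearW.
  rewrite (_ : _ \o _ = (fun n => (d xi * \sum_(0 <= k < n) c k xi) * cas (x * xi))).
    by apply: cvgM; [exact: cvA|exact: cvg_cst].
  by apply/funext => n /=; rewrite /d Gxi mul1r mulr_suml.
have aele : {ae leb, forall xi n, [set: R] xi ->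
   (`|(\sum_(0 <= k < n) c k xi * cas (x * xi))%:E| <= 2%:E * G xi)%E}.
  apply: aeW => xi n _; apply: (@le_trans _ _ (2%:E * (\sum_(0 <= k < n) `|c k xi|%:E))%E).
    rewrite sumEFin -EFinM lee_fin mulr_sumr; apply: (le_trans (ler_norm_sum _ _ _)).
    by apply: ler_sum => k _; rewrite normrM mulrC ler_wpM2r // cas_bound.
  by apply: lee_wpmul2l => //; exact: nneseries_lim_ge.
have [_ _ cv] := @dominated_convergence _ _ R leb setT measurableT _ _ _ mE1 mE2 aecv iG2 aele.
have cv2 : (\sum_(0 <= k < n) f_ k x)%:E @[n --> \oo] --> (hart A x)%:E.
  rewrite /hart /Rintegral fineK; last exact: integrable_fin_num ihA.
  rewrite (_ : (fun n => _) = (fun n => \int[leb]_xi (\sum_(0 <= k < n) c k xi * cas (x * xi))%:E)%E) //.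
  apply/funext => n.
  under eq_integral do rewrite -sumEFin.
  rewrite integral_sum //; last by move=> k; exact: hart_integrable (ic k).
  rewrite -sumEFin; apply: eq_bigr => k _.
  by rewrite (Hc k).2 /hart /Rintegral fineK //; exact: integrable_fin_num (hart_integrable x (ic k)).
have cv3 : (\sum_(0 <= k < n) f_ k x)%:E @[n --> \oo] --> (F x)%:E.
  by apply: cvg_EFin; [exact: nearW|exact: fF].
have l2 : limn (fun n => (\sum_(0 <= k < n) f_ k x)%:E) = (hart A x)%:E by exact/cvg_lim.
have l3 : limn (fun n => (\sum_(0 <= k < n) f_ k x)%:E) = (F x)%:E by exact/cvg_lim.
by move: l3; rewrite l2 => -[].
Qed.

End HartleySeries.

Section SobolevNorm.
Variable R : realType.
Local Notation leb := (@lebesgue_measure R).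
Implicit Types (sg xi eta x N M : R) (a b c f g : R -> R).

Definition Kneu sg : R := 16 * Kconv sg + 8 * Kwt sg.

(** The Neumann series; its n-th term is in a ball of radius
    N (16 Kconv sg N)^n, and the smallness of Kneu sg N makes the ratio and
    the values of f at most 1/4. *)
Lemma Hs_ball_inv1B sg N f : 2^-1 < sg -> Hs_ball sg N f -> Kneu sg * N <= 4^-1 ->
  Hs_ball sg (2 * N) (fun x => (1 - f x)^-1 - 1).
Proof.
move=> s2 fN Ksmall; have N0 := Hs_ball_gt0 fN.
have K1 := Kwt_ge1 sg; have K1' := Kconv_ge1 sg.
have h1 := mulr_ge0 (le_trans ler01 K1) (ltW N0).
have h2 := mulr_ge0 (le_trans ler01 K1') (ltW N0).
have [KN1 KN2] : 16 * Kconv sg * N <= 4^-1 /\ 2 * Kwt sg * N <= 4^-1.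
  by move: Ksmall; rewrite /Kneu mulrDl; split; lra.
apply: (@Hs_ball_series _ _ _ (fun n x => f x ^+ n.+1)) => // [n|x].
  elim: n => [|n IH]; first by rewrite expr0 mulr1; apply: Hs_ball_ext fN => x; rewrite expr1.
  have := Hs_ball_mul s2 fN IH.
  have -> : (fun x => f x * f x ^+ n.+1) = (fun x => f x ^+ n.+2) by apply/funext => x; rewrite -exprS.
  apply: Hs_ball_mono => //.
  have -> : 16 * Kconv sg * (N * (N * 4^-1 ^+ n)) = (16 * Kconv sg * N) * (N * 4^-1 ^+ n) by ring.
  have -> : N * 4^-1 ^+ n.+1 = 4^-1 * (N * 4^-1 ^+ n) by rewrite exprS mulrCA.
  by rewrite ler_wpM2r // mulr_ge0 ?exprn_ge0 ?invr_ge0 // ltW.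
have f1 : `|f x| < 1.
  apply: (le_lt_trans (Hs_ball_bound x s2 fN)); apply: (le_lt_trans KN2).
  by rewrite invf_lt1 // ltr1n.
have fn1 : 1 - f x != 0.
  by rewrite subr_eq0; apply: contraTneq f1 => <-; rewrite normr1 ltxx.
have := @cvg_geometric_series R (f x) (f x) f1.
have -> : f x / (1 - f x) = (1 - f x)^-1 - 1 by field.
rewrite /series /geometric /=.
by under eq_fun do under eq_bigr do rewrite -exprS.
Qed.

Let k0 : R := (Num.sqrt (2 * pi))^-1.

Let pi2 : 1 < 2 * pi :> R.
Proof. by have := @pi_ge2 R; lra. Qed.

Let k0_gt0 : 0 < k0.
Proof. by rewrite invr_gt0 sqrtr_gt0 (lt_trans ltr01). Qed.

Let k0_le1 : k0 <= 1.
Proof.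
rewrite invf_le1 ?sqrtr_gt0 ?(lt_trans ltr01) //.
by rewrite -[leLHS]sqrtr1 ler_wsqrtr // ltW.
Qed.

Let mcosM x : measurable_fun [set: R] (fun y => cos (x * y)).
Proof.
apply: (@measurableT_comp _ _ _ _ _ _ (@cos R) _ (fun y => x * y)); last exact: mulrl_measurable.
exact: continuous_measurable_fun (@continuous_cos R).
Qed.

Let msinM x : measurable_fun [set: R] (fun y => sin (x * y)).
Proof.
apply: (@measurableT_comp _ _ _ _ _ _ (@sin R) _ (fun y => x * y)); last exact: mulrl_measurable.
exact: continuous_measurable_fun (@continuous_sin R).
Qed.

Let icos c x : itg setT c -> itg setT (fun xi => c xi * cos (x * xi)).
Proof. by move=> ic; apply: (itgM (B := 1) _ ic) => // y _; rewrite ler_norml cos_le1 cos_geN1. Qed.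

Let isin c x : itg setT c -> itg setT (fun xi => c xi * sin (x * xi)).
Proof. by move=> ic; apply: (itgM (B := 1) _ ic) => // y _; rewrite ler_norml sin_le1 sin_geN1. Qed.

Lemma hart_even_odd a b x : itg setT a -> itg setT b ->
  (forall xi, a (- xi) = a xi) -> (forall xi, b (- xi) = - b xi) ->
  hart (fun xi => a xi + b xi) x =
  \int[leb]_(xi in setT) (a xi * cos (x * xi) + b xi * sin (x * xi)).
Proof.
move=> ia ib ae bo; rewrite hartD //.
have sa : \int[leb]_xi (a xi * sin (x * xi)) = 0.
  by apply: odd_RI => [|y]; [exact: isin|rewrite ae mulrN sinN mulrN].
have sb : \int[leb]_xi (b xi * cos (x * xi)) = 0.
  by apply: odd_RI => [|y]; [exact: icos|rewrite bo mulrN cosN mulNr].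
rewrite RID //; [|exact: icos|exact: isin].
congr (_ + _).
  rewrite -[RHS]addr0 -sa -RID //; [|exact: icos|exact: isin].
  by apply: eq_RI => xi _; rewrite /cas mulrDr.
rewrite -[RHS]add0r -sb -RID //; [|exact: icos|exact: isin].
by apply: eq_RI => xi _; rewrite /cas mulrDr.
Qed.

(** A Fourier pair (a, b) gives the density a + b, up to the constant
    1 / sqrt (2 pi). *)
Lemma Hs_norm_Hs_ball sg M f : (Hs_norm sg f < M%:E)%E -> Hs_ball sg (2 * M) f.
Proof.
move=> /ereal_inf_lt[_ [a [b [[ia ib ae bo fE] ->]]]] NM.
have M0 : 0 < M by rewrite -lte_fin (le_lt_trans _ NM) // Lnorm_ge0.
have ma : measurable_fun [set: R] a by exact: itg_measurable ia.
have mb : measurable_fun [set: R] b by exact: itg_measurable ib.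
have mW : measurable_fun [set: R] (wt sg) by exact: measurable_wt.
have H := (Lnorm2_le leb (fun xi => Num.sqrt ((1 + xi ^+ 2) `^ sg * (a xi ^+ 2 + b xi ^+ 2))) (ltW M0)).1 (ltW NM).
have {H} H : (\int[leb]_xi (wt sg xi * (a xi ^+ 2 + b xi ^+ 2))%:E <= (M ^+ 2)%:E)%E.
  rewrite (_ : (fun xi => _) = (fun xi => (Num.sqrt ((1 + xi ^+ 2) `^ sg * (a xi ^+ 2 + b xi ^+ 2)) ^+ 2)%:E)) //.
  apply/funext => xi; rewrite sqr_sqrtr // mulr_ge0 ?powR_ge0 //.
  by rewrite addr_ge0 // sqr_ge0.
exists (fun xi => k0 * (a xi + b xi)); last first.
  by move=> x; rewrite hartZ ?hart_even_odd //; exact: itgD.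
split; [by apply: measurable_funM => //; exact: measurable_funD|by rewrite mulr_gt0|].
apply: (@le_trans _ _ (\int[leb]_xi (2%:E * (wt sg xi * (a xi ^+ 2 + b xi ^+ 2))%:E))%E).
  apply: ge0_le_integral => //.
  - by move=> xi _; rewrite lee_fin mulr_ge0 ?wt_ge0 ?sqr_ge0.
  - apply/measurable_EFinP; apply: measurable_funM => //; apply: measurable_funX.
    by apply: measurable_funM => //; exact: measurable_funD.
  - apply/measurable_EFinP; do 2 apply: measurable_funM => //.
    by apply: measurable_funD; exact: measurable_funX.
  - move=> xi _; rewrite -EFinM lee_fin [leRHS]mulrCA; apply: ler_wpM2l; first exact: wt_ge0.
    rewrite exprMn; apply: (@le_trans _ _ ((a xi + b xi) ^+ 2)).
      by rewrite ler_piMl ?sqr_ge0 // exprn_ile1 // ltW.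
    by have := sqr_ge0 (a xi - b xi); lra.
rewrite ge0_integralZl_EFin //; last 2 first.
- by move=> xi _; rewrite lee_fin mulr_ge0 ?wt_ge0 // addr_ge0 // sqr_ge0.
- apply/measurable_EFinP; apply: measurable_funM => //.
  by apply: measurable_funD; exact: measurable_funX.
apply: (@le_trans _ _ (2%:E * (M ^+ 2)%:E)%E); first exact: lee_wpmul2l.
by rewrite -EFinM lee_fin; have := sqr_ge0 M; lra.
Qed.

(** The even and odd parts of the density form a Fourier pair. *)
Lemma Hs_ball_Hs_norm sg N f : 2^-1 < sg -> Hs_ball sg N f ->
  (Hs_norm sg f <= (4 * k0^-1 * N)%:E)%E.
Proof.
move=> s2 [c cN fc].
have h1 : `|2^-1 : R| <= 1 by rewrite ger0_norm ?invr_ge0 // invf_le1 // ler1n.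
have N0 : 0 < N by case: cN.
pose a xi := k0^-1 * (2^-1 * (c xi + c (- xi))).
pose b xi := k0^-1 * (2^-1 * (c xi - c (- xi))).
have ic : itg setT c := wL2_integrable s2 cN.
have ic' := itg_opp ic.
have ia : itg setT a by do 2 apply: itgZl => //; exact: itgD.
have ib : itg setT b.
  do 2 apply: itgZl => //; apply: itgD => //.
  by have := itgZl (-1) measurableT ic'; under eq_fun do rewrite mulN1r.
have k0n : k0 != 0 by rewrite gt_eqF.
apply: (@le_trans _ _ (Lnorm leb 2%:E (fun xi =>
          (Num.sqrt ((1 + xi ^+ 2) `^ sg * (a xi ^+ 2 + b xi ^+ 2)))%:E))).
  apply: ereal_inf_lbound; exists a, b; split=> //; split=> //.
  - by move=> xi; rewrite /a opprK (addrC (c (- xi))).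
  - by move=> xi; rewrite /b opprK -!mulrN opprB.
  - move=> x; rewrite -hart_even_odd //; last 2 first.
    + by move=> xi; rewrite /a opprK (addrC (c (- xi))).
    + by move=> xi; rewrite /b opprK -!mulrN opprB.
    rewrite -/k0 -hartZ; last exact: itgD.
    rewrite fc; congr (hart _ _); apply/funext => xi; rewrite /a /b.
    by field.
apply/(Lnorm2_le leb (fun xi => Num.sqrt ((1 + xi ^+ 2) `^ sg * (a xi ^+ 2 + b xi ^+ 2)))).
  by rewrite mulr_ge0 ?mulr_ge0 ?invr_ge0 // ltW.
have cN' := wL2_opp cN.
case: cN => mc _ cN; case: cN' => mc' _ cN'.
have mW : measurable_fun [set: R] (wt sg) by exact: measurable_wt.
have mm (d : R -> R) : measurable_fun [set: R] d -> measurable_fun [set: R] (fun xi => (wt sg xi * d xi ^+ 2)%:E).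
  by move=> md; apply/measurable_EFinP; apply: measurable_funM => //; exact: measurable_funX.
have p (d : R -> R) xi : (0 <= (wt sg xi * d xi ^+ 2)%:E)%E.
  by rewrite lee_fin mulr_ge0 ?wt_ge0 // sqr_ge0.
have -> : (fun xi => (Num.sqrt ((1 + xi ^+ 2) `^ sg * (a xi ^+ 2 + b xi ^+ 2)) ^+ 2)%:E) =
  (fun xi => (2^-1 * k0^-1 ^+ 2)%:E * ((wt sg xi * c xi ^+ 2)%:E + (wt sg xi * c (- xi) ^+ 2)%:E))%E.
  apply/funext => xi; rewrite sqr_sqrtr; last first.
    by rewrite mulr_ge0 ?powR_ge0 // addr_ge0 // sqr_ge0.
  rewrite -EFinD -EFinM /a /b -/(japsq xi) -/(wt sg xi); congr EFin.
  by field.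
have k20 : 0 <= 2^-1 * k0^-1 ^+ 2 by rewrite mulr_ge0 ?invr_ge0 // exprn_ge0 // invr_ge0 ltW.
rewrite ge0_integralZl_EFin //; last 2 first.
- by move=> xi _; apply: adde_ge0; [exact: p|exact: (p (fun xi => c (- xi)))].
- by apply: emeasurable_funD; [exact: mm|exact: (mm _ mc')].
rewrite ge0_integralD //; [|exact: mm|by move=> xi _; exact: (p (fun xi => c (- xi)))|exact: (mm _ mc')].
apply: (@le_trans _ _ ((2^-1 * k0^-1 ^+ 2)%:E * ((N ^+ 2)%:E + (N ^+ 2)%:E))%E).
  by apply: lee_wpmul2l; [rewrite lee_fin|apply: leeD].
rewrite -EFinD -EFinM lee_fin.
have -> : 2^-1 * k0^-1 ^+ 2 * (N ^+ 2 + N ^+ 2) = (k0^-1 * N) ^+ 2 by field.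
have -> : (4 * k0^-1 * N) ^+ 2 = 16 * (k0^-1 * N) ^+ 2 by ring.
by rewrite ler_peMl ?sqr_ge0 // ler1n.
Qed.

End SobolevNorm.

(** * Derivatives on the line and smooth bumps *)

Section Der.
Variable R : realType.
Implicit Types (f g : R -> R).

Definition der f f' : Prop := forall x : R, is_derive x 1 f (f' x).

Lemma derE f f' : der f f' -> derive1 f = f'.
Proof. by move=> H; apply/funext => x; rewrite derive1E; case: (H x). Qed.

Lemma der_derivable f f' x : der f f' -> derivable f x 1.
Proof. by move=> H; case: (H x). Qed.

Lemma derivable_der f : (forall x, derivable f x 1) -> der f (derive1 f).
Proof. by move=> H x; apply: DeriveDef; rewrite ?derive1E. Qed.

Lemma der_ext f g f' g' : (forall x, f x = g x) -> (forall x, f' x = g' x) ->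
  der f f' -> der g g'.
Proof. by move=> /funext -> /funext ->. Qed.

Lemma der_cst (k : R) : der (fun _ => k) (fun _ => 0).
Proof. by move=> x; exact: is_derive_cst. Qed.

Lemma der_id : der (fun x => x) (fun _ => 1).
Proof. by move=> x; exact: is_derive_id. Qed.

Lemma der_add f g f' g' : der f f' -> der g g' ->
  der (fun x => f x + g x) (fun x => f' x + g' x).
Proof. by move=> F G x; exact: (is_deriveD (F x) (G x)). Qed.

Lemma der_mul f g f' g' : der f f' -> der g g' ->
  der (fun x => f x * g x) (fun x => f' x * g x + f x * g' x).
Proof.
move=> F G x; have h := is_deriveM (F x) (G x).
by apply: (is_derive_eq h); rewrite /GRing.scale /= addrC mulrC (mulrC (f x)).
Qed.

Lemma der_scale f f' (k : R) : der f f' -> der (fun x => k * f x) (fun x => k * f' x).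
Proof. by move=> F; apply: der_ext (der_mul (der_cst k) F) => // x; rewrite mul0r add0r. Qed.

Lemma der_opp f f' : der f f' -> der (fun x => - f x) (fun x => - f' x).
Proof. by move=> F; apply: der_ext (der_scale (-1) F) => x; rewrite mulN1r. Qed.

Lemma der_inv f f' : (forall x, f x != 0) -> der f f' ->
  der (fun x => (f x)^-1) (fun x => - f' x * (f x)^-1 ^+ 2).
Proof.
move=> f0 F x; have h := is_deriveV (f0 x) (F x).
by apply: (is_derive_eq h); rewrite /GRing.scale /= -exprVn mulNr mulrC mulNr.
Qed.

Lemma der_comp f g f' g' : der f f' -> der g g' ->
  der (fun x => f (g x)) (fun x => f' (g x) * g' x).
Proof. by move=> F G x; exact: (is_derive1_comp (F (g x)) (G x)). Qed.

Lemma der_continuous f f' : der f f' -> continuous f.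
Proof.
by move=> F x; apply: differentiable_continuous; apply/derivable1_diffP; case: (F x).
Qed.

(** n-fold differentiability, in the recursive form in which it is used. *)
Fixpoint nd (n : nat) f : Prop :=
  if n is m.+1 then (forall x, derivable f x 1) /\ nd m (derive1 f) else True.

Lemma ndS n f f' : der f f' -> nd n f' -> nd n.+1 f.
Proof. by move=> F N; split; [move=> x; case: (F x)|rewrite (derE F)]. Qed.

Lemma ndP n f : nd n.+1 f -> der f (derive1 f) /\ nd n (derive1 f).
Proof. by case=> F N; split=> //; exact: derivable_der. Qed.

Lemma nd_ext n f g : (forall x, f x = g x) -> nd n f -> nd n g.
Proof. by move=> /funext ->. Qed.

Lemma nd_le m n f : (m <= n)%N -> nd n f -> nd m f.
Proof.
elim: m n f => [//|m IH] [//|n] f; rewrite ltnS => mn [F N]; split=> //; exact: IH N.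
Qed.

Lemma nd_cst n (k : R) : nd n (fun _ => k).
Proof. by elim: n k => [//|n IH] k; exact: ndS (der_cst k) (IH 0). Qed.

Lemma nd_add n f g : nd n f -> nd n g -> nd n (fun x => f x + g x).
Proof.
elim: n f g => [//|n IH] f g /ndP[F NF] /ndP[G NG].
exact: ndS (der_add F G) (IH _ _ NF NG).
Qed.

Lemma nd_mul n f g : nd n f -> nd n g -> nd n (fun x => f x * g x).
Proof.
elim: n f g => [//|n IH] f g Nf Ng.
have [F NF] := ndP Nf; have [G NG] := ndP Ng.
apply: ndS (der_mul F G) _; apply: nd_add; apply: IH => //.
  exact: nd_le Ng.
exact: nd_le Nf.
Qed.

Lemma nd_scale n f (k : R) : nd n f -> nd n (fun x => k * f x).
Proof. by move=> N; apply: nd_mul => //; exact: nd_cst. Qed.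

Lemma nd_inv n f : (forall x, f x != 0) -> nd n f -> nd n (fun x => (f x)^-1).
Proof.
move=> f0; elim: n => [//|n IH] Nf; have [F NF] := ndP Nf.
have NI := IH (nd_le (leqnSn n) Nf).
apply: ndS (der_inv f0 F) _; apply: nd_mul.
  by apply: nd_ext (nd_scale (-1) NF) => x; rewrite mulN1r.
by apply: nd_ext (nd_mul NI NI) => x; rewrite expr2.
Qed.

Lemma nd_affine n f (a b : R) : nd n f -> nd n (fun x => f (a * x + b)).
Proof.
elim: n f => [//|n IH] f /ndP[F NF].
have A : der (fun x => a * x + b) (fun _ => a).
  apply: der_ext (der_add (der_scale a der_id) (der_cst b)) => // x.
  by rewrite mulr1 addr0.
apply: ndS (der_comp F A) _; apply: nd_mul; [exact: IH|exact: nd_cst].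
Qed.

Definition smooth f : Prop := forall n, nd n f.

Lemma smooth_test f : smooth f -> forall n t, derivable (derive1n n f) t 1.
Proof.
move=> S n; have := S n.+1; elim: n f {S} => [|n IH] f [F N] t; first exact: F.
by rewrite /derive1n iterSr; exact: IH.
Qed.

Lemma test_smooth f : (forall n t, derivable (derive1n n f) t 1) -> smooth f.
Proof.
move=> S n; elim: n f S => [//|n IH] f S; split; first exact: (S 0%N).
apply: IH => m t; have := S m.+1 t; by rewrite /derive1n iterSr.
Qed.

(** For n = 0, the classical smooth function which vanishes for x <= 0; the family
    in n is closed under the derivative. *)
Definition bexp (n : nat) (x : R) : R := if 0 < x then x^-1 ^+ n * expR (- x^-1) else 0.

Lemma bexp_le (n : nat) (x : R) : 0 < x -> x^-1 ^+ n * expR (- x^-1) <= n.+2`!%:R * x ^+ 2.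
Proof.
move=> x0; have y0 : 0 < x^-1 by rewrite invr_gt0.
rewrite expRN ler_pdivrMr ?expR_gt0 //.
have h := expR_ge1Dxn n.+1 (ltW y0).
have f0 : 0 < n.+2`!%:R :> R by rewrite ltr0n fact_gt0.
have h2 : x^-1 ^+ n.+2 <= n.+2`!%:R * expR x^-1.
  rewrite mulrC -ler_pdivrMr //; apply: le_trans h; by rewrite lerDr.
rewrite mulrAC -ler_pdivrMr ?exprn_gt0 //; apply: le_trans h2.
by rewrite -exprVn -exprD addn2.
Qed.

Lemma bexp_abs_le (n : nat) (x : R) : `|bexp n x| <= n.+2`!%:R * x ^+ 2.
Proof.
rewrite /bexp; case: ifPn => x0; last by rewrite normr0 mulr_ge0 ?sqr_ge0.
rewrite ger0_norm; first exact: bexp_le.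
by rewrite mulr_ge0 ?expR_ge0 // exprn_ge0 // invr_ge0 ltW.
Qed.

Lemma is_derive_bexp0 n : is_derive (0 : R) 1 (bexp n) 0.
Proof.
have b0 : bexp n 0 = 0 by rewrite /bexp ltxx.
have cv : (h : R)^-1 *: (bexp n (h *: 1 + 0) - bexp n 0) @[h --> 0^'] --> (0 : R).
  apply/cvgrPdist_le => e e0.
  have C0 : 0 < n.+2`!%:R :> R by rewrite ltr0n fact_gt0.
  near=> h.
  have hn0 : h != 0 by near: h; exact: nbhs_dnbhs_neq.
  rewrite b0 subr0 sub0r normrN addr0 /GRing.scale /= mulr1 normrM normfV.
  rewrite mulrC ler_pdivrMr ?normr_gt0 //.
  apply: (le_trans (bexp_abs_le n h)).
  rewrite -real_normK ?num_real // expr2 mulrA ler_wpM2r //.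
  rewrite mulrC -ler_pdivlMr //.
  near: h; apply: dnbhs0_le; exact: divr_gt0.
apply: DeriveDef; first by apply/cvg_ex; exists 0.
exact/cvg_lim.
Unshelve. all: by end_near. Qed.

Lemma is_derive_bexp_pos n (x : R) : 0 < x ->
  is_derive x 1 (fun y => y^-1 ^+ n * expR (- y^-1))
    (x^-1 ^+ n.+2 * expR (- x^-1) - n%:R * (x^-1 ^+ n.+1 * expR (- x^-1))).
Proof.
move=> x0; have xn : x != 0 by rewrite gt_eqF.
have h1 : is_derive x 1 (fun y : R => y^-1) (- x^-1 ^+ 2).
  have h := is_deriveV (f := id) xn (is_derive_id x 1).
  by apply: (is_derive_eq h); rewrite /GRing.scale /= mulr1 exprVn.
have h2 : is_derive x 1 (fun y : R => expR (- y^-1)) (expR (- x^-1) * x^-1 ^+ 2).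
  have hN : is_derive x 1 (fun y : R => - y^-1) (- - x^-1 ^+ 2) by exact: is_deriveN h1.
  have h := is_derive1_comp (f := @expR R) (g := fun y : R => - y^-1) (is_derive_expR (- x^-1)) hN.
  by apply: (is_derive_eq h); rewrite opprK.
have h3 : is_derive x 1 (fun y : R => y^-1 ^+ n) (- (n%:R * x^-1 ^+ n.+1)).
  have h := is_deriveX n h1; rewrite exprfctE in h.
  apply: (is_derive_eq h); rewrite /GRing.scale /=.
  case: n {h} => [|n]; first by rewrite !mul0r oppr0.
  by rewrite /= mulrN -mulrA -exprD addn2.
have h := is_deriveM h3 h2.
apply: (is_derive_eq h); rewrite /GRing.scale /=.
rewrite !exprS; move: (x^-1 ^+ n) (x^-1) (expR _) (n%:R) => p q e k; rewrite expr0; ring.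
Qed.

Lemma der_bexp n : der (bexp n) (fun x => bexp n.+2 x - n%:R * bexp n.+1 x).
Proof.
move=> x; case: (ltrgtP x 0) => [x0|x0|->].
- have -> : bexp n.+2 x - n%:R * bexp n.+1 x = 0.
    by rewrite /bexp ltNge (ltW x0) /= mulr0 subr0.
  apply: (near_eq_is_derive _ (der_cst 0 x)).
  near=> y; have y0 : y < 0 by near: y; exact: lt_nbhsl.
  by rewrite /bexp ltNge (ltW y0).
- rewrite /bexp x0.
  apply: (near_eq_is_derive _ (is_derive_bexp_pos n x0)).
  near=> y; have y0 : 0 < y by near: y; exact: lt_nbhsr.
  by rewrite y0.
- rewrite /bexp ltxx mulr0 subr0; exact: is_derive_bexp0.
Unshelve. all: by end_near. Qed.

Lemma smooth_bexp n : smooth (bexp n).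
Proof.
move=> k; elim: k n => [//|k IH] n; apply: ndS (der_bexp n) _.
apply: nd_add; first exact: IH.
by apply: nd_ext (nd_scale (- n%:R) (IH n.+1)) => x; rewrite mulNr.
Qed.

(** As n grows these test functions tend to the indicator of ]a, b[ from below. *)
Definition bump (a b : R) (n : nat) (x : R) : R :=
  bexp 0 (n.+1%:R * x + - (n.+1%:R * a)) * bexp 0 (- n.+1%:R * x + n.+1%:R * b).

Lemma smooth_bump a b n : smooth (bump a b n).
Proof. by move=> k; apply: nd_mul; apply: nd_affine; exact: smooth_bexp. Qed.

Lemma bexp0_ge0 x : 0 <= bexp 0 x.
Proof. by rewrite /bexp; case: ifP => // _; rewrite expr0 mul1r expR_ge0. Qed.

Lemma bexp0_le1 x : bexp 0 x <= 1.
Proof.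
rewrite /bexp; case: ifPn => // x0.
by rewrite expr0 mul1r -expR0 ler_expR oppr_le0 invr_ge0 ltW.
Qed.

Lemma bump_ge0 a b n x : 0 <= bump a b n x.
Proof. by rewrite mulr_ge0 ?bexp0_ge0. Qed.

Lemma bump_le1 a b n x : bump a b n x <= 1.
Proof. by rewrite mulr_ile1 ?bexp0_ge0 ?bexp0_le1. Qed.

Lemma bump_out a b n x : x \notin `]a, b[ -> bump a b n x = 0.
Proof.
rewrite in_itv /= negb_and -!leNgt /bump /bexp => /orP[xa|bx].
  have -> : n.+1%:R * x + - (n.+1%:R * a) = n.+1%:R * (x - a) by ring.
  by rewrite pmulr_rgt0 ?ltr0n // subr_gt0 ltNge xa mul0r.
have -> : - n.+1%:R * x + n.+1%:R * b = n.+1%:R * (b - x) by ring.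
by rewrite [X in _ * X](_ : _ = 0) ?mulr0 // pmulr_rgt0 ?ltr0n // subr_gt0 ltNge bx.
Qed.

Lemma bump_cvg a b x : bump a b n x @[n --> \oo] --> (if x \in `]a, b[ then 1 else 0 : R).
Proof.
case: ifPn => [|/bump_out xab]; last first.
  by under eq_fun do rewrite xab; exact: cvg_cst.
rewrite in_itv /= => /andP[ax xb].
have H (u : R) : 0 < u -> bexp 0 (n.+1%:R * u) @[n --> \oo] --> (1 : R).
  move=> u0.
  have -> : (fun n => bexp 0 (n.+1%:R * u)) = (fun n => expR (- (n.+1%:R^-1 * u^-1))).
    by apply/funext => n; rewrite /bexp mulr_gt0 ?ltr0n // expr0 mul1r invfM.
  rewrite [X in _ --> X](_ : _ = expR (- (0 * u^-1))); last by rewrite mul0r oppr0 expR0.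
  apply: continuous_cvg; first exact: continuous_expR.
  apply: cvgN; apply: cvgM; last exact: cvg_cst.
  exact: (@cvg_harmonic R).
rewrite -[X in _ --> X]mulr1 /bump; apply: cvgM.
  under eq_fun do rewrite -mulrN -mulrDr.
  by apply: H; rewrite subr_gt0.
under eq_fun => n do rewrite mulNr -mulrN addrC -mulrDr.
by apply: H; rewrite subr_gt0.
Qed.

End Der.
(** * Weak derivatives in time *)

Section Prim.
Variable R : realType.
Local Notation leb := (@lebesgue_measure R).
Implicit Types (F G f g : R -> R) (a b c t : R).

(** Bounded measurable functions on the whole line: this class is closed under
    sums and products, and all of its members have a Lipschitz primitive. *)
Definition bmf G : Prop :=
  measurable_fun [set: R] G /\ exists B : R, forall t, `|G t| <= B.

Definition prim G t : R := \int[leb]_(tau in `[0, t]) G tau.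

Lemma itg_cst a b (k : R) : itg `[a, b] (fun _ => k).
Proof.
apply/integrableP; split; first exact/measurable_EFinP.
rewrite (_ : (fun x => _) = cst `|k|%:E) // integral_cst //.
have := @lebesgue_measure_itv R `[a, b]; rewrite /= => ->.
by case: ifP => _; rewrite ?mule0 // -EFinB -EFinM ltry.
Qed.

Lemma bmf_itg a b G : bmf G -> itg `[a, b] G.
Proof.
move=> [mG [B GB]].
rewrite (_ : G = (fun x => 1 * G x)); last by apply/funext => x; rewrite mul1r.
apply: (@itgM R `[a, b]%classic (fun _ => 1) G B) => //; first exact: itg_cst.
exact: measurable_funTS.
Qed.

Lemma itgS (D E : set R) f : measurable D -> measurable E -> E `<=` D -> itg D f -> itg E f.
Proof. by move=> mD mE ED; exact: integrableS. Qed.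

Lemma bmfT_itg (D : set R) G (a b : R) : measurable D -> D `<=` `[a, b] -> bmf G -> itg D G.
Proof. by move=> mD Dab /(bmf_itg a b); apply: itgS. Qed.

Lemma bmf_add f g : bmf f -> bmf g -> bmf (fun t => f t + g t).
Proof.
move=> [mf [B fB]] [mg [C gC]]; split; first exact: measurable_funD.
by exists (B + C) => t; apply: (le_trans (ler_normD _ _)); exact: lerD.
Qed.

Lemma bmf_mul f g : bmf f -> bmf g -> bmf (fun t => f t * g t).
Proof.
move=> [mf [B fB]] [mg [C gC]]; split; first exact: measurable_funM.
by exists (B * C) => t; rewrite normrM; apply: ler_pM.
Qed.

Lemma bmf_cst k : bmf (fun _ => k).
Proof. by split=> //; exists `|k|. Qed.

Lemma RI_le_bound (D : set R) f (B : R) a b : measurable D -> D `<=` `[a, b] -> a <= b ->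
  measurable_fun D f -> 0 <= B -> (forall x, D x -> `|f x| <= B) ->
  itg D f /\ `|\int[leb]_(x in D) f x| <= B * (b - a).
Proof.
move=> mD Dab ab mf B0 fB; apply: RI_norm_le => //.
apply: (@le_trans _ _ (\int[leb]_(x in D) (cst B%:E) x)%E).
  apply: ge0_le_integral => //.
  by apply/measurable_EFinP; exact: measurableT_comp.
rewrite integral_cst // EFinM; apply: lee_wpmul2l; first by rewrite lee_fin.
apply: (@le_trans _ _ (leb `[a, b])); first by apply: le_measure; rewrite ?inE.
by rewrite lebesgue_measure_itv /= lte_fin; case: ifP => _; rewrite ?EFinB // lee_fin subr_ge0.
Qed.

Lemma prim_neg G t : t < 0 -> prim G t = 0.
Proof.
move=> t0; rewrite /prim set_itv_ge ?Rintegral_set0 //.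
by rewrite bnd_simp -ltNge.
Qed.

Lemma prim_split G s t : bmf G -> 0 <= s -> s <= t ->
  prim G t = prim G s + \int[leb]_(tau in `]s, t]) G tau.
Proof.
move=> bG s0 st; rewrite /prim.
have := @Rintegral_itvB R G (BLeft 0) (BRight t) s (bmf_itg 0 t bG).
rewrite !bnd_simp => /(_ s0 st) <-; ring.
Qed.

Lemma prim_lip G (B : R) s t : measurable_fun [set: R] G -> (forall t, `|G t| <= B) ->
  `|prim G t - prim G s| <= B * `|t - s|.
Proof.
move=> mG GB.
have bG : bmf G by split=> //; exists B.
have B0 : 0 <= B by exact: le_trans (normr_ge0 _) (GB 0).
have H s' t' : 0 <= s' -> s' <= t' -> `|prim G t' - prim G s'| <= B * (t' - s').
  move=> s0 st; rewrite (prim_split bG s0 st) addrC addKr.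
  have [] // := @RI_le_bound `]s', t']%classic G B s' t'; last exact: measurable_funTS.
  by move=> x /=; rewrite !in_itv /= => /andP[/ltW -> ->].
have p00 : prim G 0 = 0 by rewrite /prim set_itv1 Rintegral_set1.
wlog st : s t / s <= t.
  by move=> W; case: (leP s t) => [/W //|/ltW/W]; rewrite distrC (distrC s).
rewrite (ger0_norm (_ : 0 <= t - s)) ?subr_ge0 //.
have [s0|s0] := leP 0 s; first exact: H.
rewrite (prim_neg _ s0) -p00; have [t0|t0] := leP 0 t.
  by apply: (le_trans (H 0 t (lexx 0) t0)); rewrite ler_wpM2l // lerB // ltW.
by rewrite prim_neg // p00 subr0 normr0 mulr_ge0 // subr_ge0.
Qed.

Lemma prim_continuous G : bmf G -> continuous (prim G).
Proof.
move=> [mG [B GB]] t; have B0 : 0 <= B by exact: le_trans (normr_ge0 _) (GB 0).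
apply/cvgrPdist_le => e e0.
have B1 : 0 < B + 1 by rewrite ltr_wpDl.
have N : \forall s \near t, ball t (e / (B + 1)) s by apply: nbhsx_ballx; exact: divr_gt0.
near=> s.
apply: (le_trans (prim_lip s t mG GB)).
apply: (@le_trans _ _ ((B + 1) * `|t - s|)); first by rewrite ler_wpM2r // lerDl.
rewrite mulrC -ler_pdivlMr //; near: s.
by apply: filterS N => y /ltW.
Unshelve. all: by end_near. Qed.

Lemma prim_measurable G : bmf G -> measurable_fun [set: R] (prim G).
Proof. by move=> bG; apply: continuous_measurable_fun; exact: prim_continuous. Qed.

Lemma prim_bounded G t : bmf G -> exists B : R, forall x, `[0, t]%classic x -> `|prim G x| <= B.
Proof.
move=> [mG [B GB]]; have B0 : 0 <= B by exact: le_trans (normr_ge0 _) (GB 0).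
exists (B * t) => x /=; rewrite in_itv /= => /andP[x0 xt].
have := prim_lip 0 x mG GB; rewrite {2}/prim set_itv1 Rintegral_set1 !subr0.
by move=> /le_trans; apply; rewrite ler_wpM2l // ger0_norm.
Qed.

Lemma itg_mul_prim F G t : bmf F -> bmf G -> itg `[0, t] (fun x => F x * prim G x).
Proof.
move=> bF bG; have [B BG] := prim_bounded t bG.
apply: (@itgM _ `[0, t]%classic F (prim G) B) => //; first exact: bmf_itg.
exact: measurable_funTS (prim_measurable bG).
Qed.

Lemma itg_prim_mul F G t : bmf F -> bmf G -> itg `[0, t] (fun x => prim G x * F x).
Proof.
move=> bF bG; rewrite (_ : (fun x => prim G x * F x) = (fun x => F x * prim G x)).
  exact: itg_mul_prim.
by apply/funext => x; rewrite mulrC.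
Qed.

Lemma itg2_bounded (g : R * R -> R) (a c : R -> R) :
  measurable_fun [set: measurableTypeR R * measurableTypeR R] g ->
  itg setT a -> itg setT c -> (forall x y, `|g (x, y)| <= `|a x| * `|c y|) ->
  (leb \x leb)%E.-integrable setT (EFin \o g).
Proof.
move=> mg ia ic gac.
have ma := itg_measurable ia; have mc := itg_measurable ic.
have mgE : measurable_fun [set: measurableTypeR R * measurableTypeR R] (fun z => `|(g z)%:E|%E).
  by apply: measurableT_comp => //; exact/measurable_EFinP.
have mg1 x : measurable_fun [set: R] (fun y => `|g (x, y)|%:E).
  apply/measurable_EFinP; apply: measurableT_comp => //.
  exact: (measurableT_comp mg (pair1_measurable x)).
have Ic := integrableP _ _ _ ic; have Ia := integrableP _ _ _ ia.
have Icf : (\int[leb]_y `|c y|%:E)%E \is a fin_num.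
  rewrite ge0_fin_numE; last by apply: integral_ge0 => y _; rewrite lee_fin.
  by case: Ic.
have mcE : measurable_fun [set: R] (fun y => `|c y|%:E).
  by apply/measurable_EFinP; exact: measurableT_comp.
have maE : measurable_fun [set: R] (fun y => `|a y|%:E).
  by apply/measurable_EFinP; exact: measurableT_comp.
apply/integrable12ltyP; first exact/measurable_EFinP.
apply: (@le_lt_trans _ _ (\int[leb]_x (`|a x|%:E * \int[leb]_y `|c y|%:E))%E).
  apply: ge0_le_integral => //.
  - by move=> x _; exact: integral_ge0.
  - exact: (@measurable_fun_fubini_tonelli_F _ _ (measurableTypeR R) (measurableTypeR R) R leb _ mgE).
  - by apply: emeasurable_funM.
  - move=> x _; rewrite -ge0_integralZl_EFin //.
    apply: ge0_le_integral => //; [exact: mg1|by apply: emeasurable_funM|].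
    by move=> y _; rewrite -EFinM lee_fin gac.
rewrite -(fineK Icf); under eq_integral do rewrite muleC.
rewrite ge0_integralZl_EFin //; last by rewrite fine_ge0 // integral_ge0 // => y _; rewrite lee_fin.
rewrite lte_mul_pinfty //; last by case: Ia.
by rewrite lee_fin fine_ge0 // integral_ge0 // => y _; rewrite lee_fin.
Qed.

(** Integration by parts without differentiability: the product of the primitives
    is an integral over a square, which Fubini splits along the diagonal. *)
Lemma prim_mul G1 G2 t : bmf G1 -> bmf G2 ->
  prim G1 t * prim G2 t =
  \int[leb]_(tau in `[0, t]) (G1 tau * prim G2 tau + prim G1 tau * G2 tau).
Proof.
move=> b1 b2.
pose I := fun tau : R => if tau \in `[0, t] then (1:R) else 0.
have mI : measurable_fun [set: R] I.
  rewrite (_ : I = \1_(`[0, t]%classic)) //.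
  by apply/funext => x; rewrite /I indicE mem_setE; case: ifP.
have RI_I f : \int[leb]_tau (I tau * f tau) = \int[leb]_(tau in `[0, t]) f tau.
  rewrite [RHS]Rintegral_mkcond; apply: eq_RI => x _.
  by rewrite /patch mem_setE /I; case: ifP; rewrite ?mul1r ?mul0r.
have iI G : bmf G -> itg setT (fun tau => I tau * G tau).
  move=> bG; have := bmf_itg 0 t bG.
  rewrite /itg => /(integrable_mkcond _ _).1.
  rewrite (_ : (EFin \o G) \_ _ = EFin \o (fun tau => I tau * G tau)); first by apply.
  apply/funext => x; rewrite /patch mem_setE /I /=; case: ifP; rewrite ?mul1r ?mul0r //.
pose A x := I x * G1 x; pose C x := I x * G2 x.
have iA : itg setT A := iI _ b1; have iC : itg setT C := iI _ b2.
have p1 : prim G1 t = \int[leb]_x A x by rewrite RI_I.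
have p2 : prim G2 t = \int[leb]_x C x by rewrite RI_I.
pose lo (x y : R) : R := if y <= x then 1 else 0.
have lo01 x y : `|lo x y| <= 1 by rewrite /lo; case: ifP; rewrite ?normr1 ?normr0.
have mlo : measurable_fun [set: measurableTypeR R * measurableTypeR R] (fun z : R * R => lo z.1 z.2).
  apply: measurable_fun_ifT => //; apply: measurable_fun_ler; [exact: measurable_snd|exact: measurable_fst].
have mlo1 x : measurable_fun [set: R] (lo x).
  exact: (measurableT_comp mlo (pair1_measurable x)).
have mlo2 y : measurable_fun [set: R] (lo ^~ y).
  exact: (measurableT_comp mlo (pair2_measurable y)).
have ilo x : itg setT (fun y => C y * lo x y) by apply: (itgM (B := 1) _ iC).
have ilo2 y : itg setT (fun x => A x * lo x y) by apply: (itgM (B := 1) _ iA).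
have in0t x : x \in `[0, t] -> forall f, \int[leb]_y (I y * f y * lo x y) = \int[leb]_(y in `[0, x]) f y.
  move=> xt f; rewrite [RHS]Rintegral_mkcond; apply: eq_RI => y _.
  move: xt; rewrite /patch mem_setE /I /lo !in_itv /= => /andP[x0 xt].
  case: (leP 0 y) => y0 /=; last by rewrite !mul0r.
  case: (leP y x) => yx /=; last by rewrite mulr0.
  by rewrite (le_trans yx xt) mul1r mulr1.
have E1 : \int[leb]_x (\int[leb]_y (A x * (C y * lo x y))) =
   \int[leb]_(tau in `[0, t]) (G1 tau * prim G2 tau).
  rewrite -RI_I; apply: eq_RI => x _; rewrite RIZl // /A -mulrA.
  case: (boolP (x \in `[0, t])) => xt; first by rewrite /prim -in0t.
  by rewrite /I (negbTE xt) !mul0r.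
pose hi (x y : R) : R := 1 - lo x y.
have mhi : measurable_fun [set: measurableTypeR R * measurableTypeR R] (fun z : R * R => hi z.1 z.2).
  exact: measurable_funB.
have hi01 x y : `|hi x y| <= 1 by rewrite /hi /lo; case: ifP; rewrite ?subrr ?subr0 ?normr1 ?normr0.
have ihi x : itg setT (fun y => C y * hi x y).
  apply: (itgM (B := 1) _ iC) => //; exact: (measurableT_comp mhi (pair1_measurable x)).
have ihi2 y : itg setT (fun x => A x * hi x y).
  apply: (itgM (B := 1) _ iA) => //; exact: (measurableT_comp mhi (pair2_measurable y)).
have mA : measurable_fun [set: measurableTypeR R * measurableTypeR R] (fun z : R * R => A z.1).
  exact: (measurableT_comp (itg_measurable iA) (@measurable_fst _ _ (measurableTypeR R) (measurableTypeR R))).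
have mC : measurable_fun [set: measurableTypeR R * measurableTypeR R] (fun z : R * R => C z.2).
  exact: (measurableT_comp (itg_measurable iC) (@measurable_snd _ _ (measurableTypeR R) (measurableTypeR R))).
have ihh : (leb \x leb)%E.-integrable setT (EFin \o (fun z : R * R => A z.1 * (C z.2 * hi z.1 z.2))).
  apply: (itg2_bounded _ iA iC); first by apply: measurable_funM => //; exact: measurable_funM.
  by move=> x y /=; rewrite !normrM ler_wpM2l // ler_piMr.
have ill : (leb \x leb)%E.-integrable setT (EFin \o (fun z : R * R => A z.1 * (C z.2 * lo z.1 z.2))).
  apply: (itg2_bounded _ iA iC); first by apply: measurable_funM => //; exact: measurable_funM.
  by move=> x y /=; rewrite !normrM ler_wpM2l // ler_piMr.
have [il1 _ _] := @Rfubini R (fun x y => A x * (C y * lo x y)) ill.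
have [ih1 ih2 EF] := @Rfubini R (fun x y => A x * (C y * hi x y)) ihh.
clear ihh ill.
have E2 : \int[leb]_x (\int[leb]_y (A x * (C y * hi x y))) =
   \int[leb]_(tau in `[0, t]) (prim G1 tau * G2 tau).
  rewrite EF -RI_I; apply: eq_RI => y _.
  rewrite (_ : (fun x => A x * (C y * hi x y)) = (fun x => C y * (A x * hi x y))); last first.
    by apply/funext => x; rewrite mulrCA.
  rewrite (RIZl _ measurableT (ihi2 y)) /C (mulrC (prim G1 y)) -mulrA.
  case: (boolP (y \in `[0, t])) => yt; last by rewrite /I (negbTE yt) !mul0r.
  do 2 congr (_ * _); rewrite /prim -Rintegral_itv_bndo_bndc; last first.
    apply: (@bmfT_itg _ _ 0 y); [exact: measurable_itv| |exact: b1] => z /=.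
    by rewrite !in_itv /= => /andP[-> /ltW].
  rewrite [RHS]Rintegral_mkcond; apply: eq_RI => x _.
  move: yt; rewrite /patch mem_setE /A /I /hi /lo !in_itv /= => /andP[y0 yt].
  case: (leP 0 x) => x0 /=; last by rewrite !mul0r.
  case: (ltP x y) => xy /=; last by rewrite subrr mulr0.
  by rewrite (le_trans (ltW xy) yt) mul1r subr0 mulr1.
rewrite p1 p2 (RID (measurable_itv _) (itg_mul_prim t b1 b2) (itg_prim_mul t b2 b1)).
rewrite -E1 -E2 -(RID measurableT il1 ih1) -(RIZr _ measurableT iA).
apply: eq_RI => x _.
rewrite -(RID measurableT (itgZl _ measurableT (ilo x)) (itgZl _ measurableT (ihi x))).
by rewrite -(RIZl _ measurableT iC); apply: eq_RI => y _; rewrite /hi; ring.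
Qed.

End Prim.

Section RIder.
Variable R : realType.
Local Notation leb := (@lebesgue_measure R).

Lemma continuous_itg (f : R -> R) (a b : R) : continuous f -> itg `[a, b] f.
Proof.
move=> cf; apply: continuous_compact_integrable; first exact: segment_compact.
exact: continuous_subspaceT.
Qed.

Lemma RI_der (F f : R -> R) (a b : R) : der F f -> continuous f -> a <= b ->
  \int[leb]_(x in `[a, b]) f x = F b - F a.
Proof.
move=> dF cf; rewrite le_eqVlt => /orP[/eqP ->|ab].
  by rewrite set_itv1 Rintegral_set1 subrr.
have cF : continuous F := der_continuous dF.
rewrite /Rintegral (@continuous_FTC2 R f F a b ab) ?fineB //.
- exact: continuous_subspaceT.
- split; first by move=> x _; exact: der_derivable dF.
  + by apply: cvg_at_right_filter; exact: cF.
  + by apply: cvg_at_left_filter; exact: cF.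
- by move=> x _; rewrite (derE dF).
Qed.

End RIder.

Section WeakTime.
Variables (R : realType) (T : R).
Hypothesis T0 : 0 < T.
Local Notation leb := (@lebesgue_measure R).
Local Notation D := [set` `[(0:R), T[].
Implicit Types (F G f g : R -> R) (a b c t : R) (P Q : R -> Prop).

Lemma aeS P Q : (forall t, P t -> Q t) -> {ae leb, forall t, P t} -> {ae leb, forall t, Q t}.
Proof. by move=> PQ; apply: (@filterS _ _ (ae_filter_ringOfSetsType leb)). Qed.

Lemma aeI P Q : {ae leb, forall t, P t} -> {ae leb, forall t, Q t} ->
  {ae leb, forall t, P t /\ Q t}.
Proof. exact: (@filterI _ _ (ae_filter_ringOfSetsType leb)). Qed.

Lemma ae_forall (P : nat -> R -> Prop) : (forall n, {ae leb, forall t, P n t}) ->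
  {ae leb, forall t, forall n, P n t}.
Proof.
exact: ae_foralln.
Qed.

Lemma mD : measurable D. Proof. exact: measurable_itv. Qed.

Lemma Dsub : D `<=` `[0, T].
Proof. by move=> x /=; rewrite !in_itv /= => /andP[-> /ltW]. Qed.

Lemma subD t : D t -> `[0, t]%classic `<=` D.
Proof.
move=> /=; rewrite in_itv /= => /andP[t0 tT] x /=; rewrite !in_itv /= => /andP[-> xt].
exact: le_lt_trans tT.
Qed.

Lemma ae_continuous_le f g : continuous f -> continuous g ->
  {ae leb, forall t, D t -> f t <= g t} -> forall t, D t -> f t <= g t.
Proof.
move=> cf cg [N [mN N0 sN]] t Dt; rewrite leNgt; apply/negP => gft.
have : \forall s \near t, 0 < f s - g s.
  have cv : (f s - g s) @[s --> t] --> f t - g t by apply: cvgB; [exact: cf|exact: cg].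
  by apply: (cvgr_gt _ cv); rewrite subr_gt0.
move=> /nbhs_ballP[e /= e0 He].
move: Dt; rewrite /= in_itv /= => /andP[t0 tT].
pose u := Num.min (t + e) T.
have tu : t < u by rewrite lt_min ltrDl e0 tT.
have sub : `[t, u[%classic `<=` N.
  move=> s /=; rewrite in_itv /= lt_min => /andP[ts /andP[se sT]].
  apply: sN => /= h.
  have Ds : D s by rewrite /= in_itv /= (le_trans t0 ts) sT.
  have := He s; rewrite /ball /= distrC ger0_norm ?subr_ge0 // ltrBlDl => /(_ se).
  by rewrite subr_gt0 ltNge h.
have : (leb `[t, u[ <= leb N)%E by apply: le_measure; rewrite ?inE //; exact: measurable_itv.
have := @lebesgue_measure_itv R `[t, u[; rewrite /= lte_fin tu => ->.
by rewrite N0 -EFinB lee_fin leNgt subr_gt0 tu.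
Qed.

Lemma ae_ex P : {ae leb, forall t, P t} -> exists t, D t /\ P t.
Proof.
move=> H; apply: contrapT => nP.
have D0 : D 0 by rewrite /= in_itv /= lexx T0.
suff : (1 : R) <= 0 by rewrite ler10.
apply: (@ae_continuous_le (fun _ => 1) (fun _ => 0) _ _ _ 0 D0); try by move=> x; exact: cvg_cst.
by apply: aeS H => t Pt Dt; exfalso; apply: nP; exists t.
Qed.

(** F has the bounded function G as weak derivative on ]0, T[, in the form of the
    fundamental theorem of calculus. *)
Definition wder F G : Prop :=
  [/\ measurable_fun D F, bmf G
    & exists c : R, {ae leb, forall t, D t -> F t = c + prim G t}].

Lemma cprim_continuous c G : bmf G -> continuous (fun t => c + prim G t).
Proof. by move=> bG t; apply: cvgD; [exact: cvg_cst|exact: prim_continuous]. Qed.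

Lemma prim_ae G1 G2 t : bmf G1 -> bmf G2 -> D t ->
  {ae leb, forall t, D t -> G1 t = G2 t} -> prim G1 t = prim G2 t.
Proof.
move=> [m1 _] [m2 _] Dt G12; apply: ae_eq_RI; first exact: measurable_itv.
- exact: measurable_funTS.
- exact: measurable_funTS.
- by apply: aeS G12 => s h /(subD Dt)/h.
Qed.

Lemma wder_congr F G F' G' : wder F G -> measurable_fun D F' -> bmf G' ->
  {ae leb, forall t, D t -> F' t = F t} -> {ae leb, forall t, D t -> G' t = G t} ->
  wder F' G'.
Proof.
move=> [mF bG [c FG]] mF' bG' FF' GG'; split=> //; exists c.
apply: aeS (aeI FG FF') => t [h1 h2] Dt.
by rewrite h2 // h1 //; congr (_ + _); apply: prim_ae => //; apply: aeS GG' => s h /h ->.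
Qed.

Lemma prim_add G1 G2 t : bmf G1 -> bmf G2 ->
  prim (fun s => G1 s + G2 s) t = prim G1 t + prim G2 t.
Proof. by move=> b1 b2; rewrite /prim RID //; exact: bmf_itg. Qed.

Lemma prim_scale k G t : bmf G -> prim (fun s => k * G s) t = k * prim G t.
Proof. by move=> bG; rewrite /prim RIZl //; exact: bmf_itg. Qed.

Lemma wder_add F1 G1 F2 G2 : wder F1 G1 -> wder F2 G2 ->
  wder (fun t => F1 t + F2 t) (fun t => G1 t + G2 t).
Proof.
move=> [mF1 b1 [c1 H1]] [mF2 b2 [c2 H2]]; split; [exact: measurable_funD|exact: bmf_add|].
exists (c1 + c2); apply: aeS (aeI H1 H2) => t [h1 h2] Dt.
by rewrite prim_add // h1 // h2 // addrACA.
Qed.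

Lemma wder_cst k : wder (fun _ => k) (fun _ => 0).
Proof.
split=> //; first exact: bmf_cst.
exists k; apply: aeW => t _; rewrite /prim (_ : (fun _ => 0) = (fun s : R => 0 * 0)).
  by rewrite RIZl ?mul0r ?addr0 //; exact: itg_cst.
by rewrite mul0r.
Qed.

Lemma wder_scale k F G : wder F G -> wder (fun t => k * F t) (fun t => k * G t).
Proof.
move=> [mF bG [c H]]; split; [exact: measurable_funM|by apply: bmf_mul => //; exact: bmf_cst|].
exists (k * c); apply: aeS H => t h Dt.
by rewrite prim_scale // h // mulrDr.
Qed.

Lemma cprim_mul c1 c2 G1 G2 t : bmf G1 -> bmf G2 ->
  (c1 + prim G1 t) * (c2 + prim G2 t) = c1 * c2 +
  \int[leb]_(tau in `[0, t]) (G1 tau * (c2 + prim G2 tau) + (c1 + prim G1 tau) * G2 tau).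
Proof.
move=> b1 b2.
have i1 := bmf_itg 0 t b1; have i2 := bmf_itg 0 t b2.
have mI : measurable `[0, t]%classic by exact: measurable_itv.
transitivity (c1 * c2 + (c2 * prim G1 t + (c1 * prim G2 t + prim G1 t * prim G2 t))); first by ring.
congr (_ + _); rewrite prim_mul // {1 2}/prim -(RIZl c2 mI i1) -(RIZl c1 mI i2).
rewrite -(RID mI (itgZl c1 mI i2)); last first.
  by apply: itgD => //; [exact: itg_mul_prim|exact: itg_prim_mul].
rewrite -(RID mI (itgZl c2 mI i1)); last first.
  apply: itgD => //; first exact: itgZl.
  by apply: itgD => //; [exact: itg_mul_prim|exact: itg_prim_mul].
by apply: eq_RI => x _; ring.
Qed.

Lemma wder_mul F1 G1 F2 G2 G : wder F1 G1 -> wder F2 G2 -> bmf G ->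
  {ae leb, forall t, D t -> G t = G1 t * F2 t + F1 t * G2 t} ->
  wder (fun t => F1 t * F2 t) G.
Proof.
move=> [mF1 b1 [c1 H1]] [mF2 b2 [c2 H2]] bG HG; split=> //; first exact: measurable_funM.
exists (c1 * c2); apply: aeS (aeI H1 H2) => t [h1 h2] Dt.
rewrite h1 // h2 // cprim_mul //; congr (_ + _).
have p1 := prim_measurable b1; have p2 := prim_measurable b2.
case: (b1) => m1 _; case: (b2) => m2 _.
apply: ae_eq_RI; first exact: measurable_itv.
- apply: measurable_funTS; apply: measurable_funD; apply: measurable_funM => //; exact: measurable_funD.
- by case: bG => mG _; exact: measurable_funTS.
- by apply: aeS (aeI (aeI H1 H2) HG) => s [[e1 e2] e3] /(subD Dt) Ds; rewrite e3 // e1 // e2.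
Qed.

Lemma itg_dom (E : set R) f g : measurable E -> measurable_fun E f -> itg E g ->
  (forall x, E x -> `|f x| <= `|g x|) -> itg E f.
Proof.
move=> mE mf ig fg; apply: (@le_integrable _ _ R leb E mE _ _ _ _ ig).
  exact/measurable_EFinP.
by move=> x Ex /=; rewrite lee_fin fg.
Qed.

Lemma RI_norm_leM (E : set R) f g : measurable E -> measurable_fun E f -> itg E g ->
  (forall x, E x -> `|f x| <= g x) -> `|\int[leb]_(x in E) f x| <= \int[leb]_(x in E) g x.
Proof.
move=> mE mf ig fg.
have if_ : itg E f.
  by apply: (itg_dom mE mf ig) => x Ex; rewrite (le_trans (fg x Ex)) // ler_norm.
apply: (@le_trans _ _ (\int[leb]_(x in E) `|f x|)); first exact: (@le_normr_Rintegral _ _ R leb E f mE if_).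
apply: (@le_Rintegral _ _ R leb _ _ _ mE _ ig) => //.
exact: (@integrable_norm _ _ R leb E _ if_).
Qed.

(** Iterating the hypothesis gains a factor 1/2 at each step in the norm weighted by
    exp (2 L t). *)
Lemma gronwall0 (z : R -> R) (L Z : R) : 0 < L -> continuous z ->
  0 < Z -> (forall t, D t -> `|z t| <= Z) ->
  (forall t, D t -> `|z t| <= L * \int[leb]_(tau in `[0, t]) `|z tau|) ->
  forall t, D t -> z t = 0.
Proof.
move=> L0 cz Z0 HZ Hz.
have mz : measurable_fun [set: R] (fun t => `|z t|).
  by apply: measurableT_comp => //; exact: continuous_measurable_fun.
have K0 : 0 < 2 * L by exact: mulr_gt0.
have H m t : D t -> `|z t| <= Z * 2^-1 ^+ m * expR (2 * L * t).
  elim: m t => [|m IH] t Dt.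
    rewrite expr0 mulr1; apply: (le_trans (HZ t Dt)); rewrite ler_peMr ?(ltW Z0) //.
    apply: le_trans (expR_ge1Dx _); rewrite lerDl mulr_ge0 ?(ltW K0) //.
    by move: Dt; rewrite /= in_itv /= => /andP[].
  apply: (le_trans (Hz t Dt)).
  pose q := Z * 2^-1 ^+ m.
  have q0 : 0 < q by rewrite mulr_gt0 // exprn_gt0 // invr_gt0.
  have cz' : continuous (fun tau => `|z tau|).
    by move=> x; apply: cvg_norm; exact: cz.
  have iz : itg `[0, t] (fun tau => `|z tau|) by exact: continuous_itg.
  have d1 : der (fun tau => 2 * L * tau) (fun _ => 2 * L).
    have h := der_scale (2 * L) (@der_id R).
    rewrite (_ : (fun _ => 2 * L) = (fun=> 2 * L * 1)); first exact: h.
    by apply/funext => x; rewrite mulr1.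
  have d2 : der (@expR R) (@expR R) by move=> x; exact: is_derive_expR.
  have d3 : der (fun tau => q / (2 * L) * expR (2 * L * tau)) (fun tau => q * expR (2 * L * tau)).
    apply: der_ext (der_scale (q / (2 * L)) (der_comp d2 d1)) => // x.
    by field; rewrite lt0r_neq0.
  have c3 : continuous (fun tau => q * expR (2 * L * tau)).
    exact: der_continuous (der_scale q (der_comp d2 d1)).
  have ie : itg `[0, t] (fun tau => q * expR (2 * L * tau)) by exact: continuous_itg.
  have le1 : \int[leb]_(tau in `[0, t]) `|z tau| <= \int[leb]_(tau in `[0, t]) (q * expR (2 * L * tau)).
    have mI : measurable `[0, t]%classic by exact: measurable_itv.
    by apply: (@le_Rintegral _ _ R leb _ _ _ mI iz ie) => x /(subD Dt)/IH.
  apply: (@le_trans _ _ (L * \int[leb]_(tau in `[0, t]) (q * expR (2 * L * tau)))).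
    by rewrite ler_wpM2l // ltW.
  have -> : \int[leb]_(tau in `[0, t]) (q * expR (2 * L * tau)) = q / (2 * L) * (expR (2 * L * t) - 1).
    rewrite (RI_der d3 c3); last by move: Dt; rewrite /= in_itv /= => /andP[].
    by rewrite mulr0 expR0; ring.
  have -> : L * (q / (2 * L) * (expR (2 * L * t) - 1)) = Z * 2^-1 ^+ m.+1 * (expR (2 * L * t) - 1).
    by rewrite exprS /q; field; rewrite lt0r_neq0.
  apply: ler_wpM2l; last by rewrite gerBl.
  by rewrite mulr_ge0 ?(ltW Z0) // exprn_ge0 // invr_ge0.
move=> t Dt; apply/normr0_eq0/le_anti/andP; split=> //.
have cv : Z * 2^-1 ^+ m * expR (2 * L * t) @[m --> \oo] --> (0 : R).
  rewrite -[X in _ --> X](mul0r (expR (2 * L * t))).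
  apply: cvgM; last exact: cvg_cst.
  rewrite (_ : nbhs 0 = nbhs (Z * 0)); last by rewrite mulr0.
  apply: cvgM; first exact: cvg_cst.
  by apply: cvg_expr; rewrite ger0_norm ?invr_ge0 // invf_lt1 // ltr1n.
rewrite -(cvg_lim _ cv) //; apply: limr_ge; first by apply/cvg_ex; eexists; exact: cv.
by apply: nearW => m; exact: H.
Qed.

Lemma D_bound F G : wder F G -> exists2 Z : R, 0 < Z &
  {ae leb, forall t, D t -> `|F t| <= Z}.
Proof.
move=> [mF bG [c H]]; have [B HB] := prim_bounded T bG.
exists (`|c| + `|B| + 1); first by rewrite ltr_wpDl // addr_ge0.
apply: aeS H => t h Dt; rewrite h //; apply: (le_trans (ler_normD _ _)).
apply: ler_wpDr => //; rewrite lerD2l; apply: le_trans (ler_norm _).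
exact: HB (Dsub Dt).
Qed.

(** A lower bound on F makes the equation of 1 / F linear with bounded
    coefficients; uniqueness for that equation is [gronwall0]. *)
Lemma wder_inv F G G' (h : R) : 0 < h -> wder F G ->
  {ae leb, forall t, D t -> h <= F t} -> bmf G' ->
  measurable_fun D (fun t => (F t)^-1) ->
  {ae leb, forall t, D t -> G' t = - G t * (F t)^-1 ^+ 2} ->
  wder (fun t => (F t)^-1) G'.
Proof.
move=> h0 [mF bG [c H]] hF bG' mV HG'; split=> //.
pose P t := c + prim G t.
have cP : continuous P by exact: cprim_continuous.
have hP : forall t, D t -> h <= P t.
  apply: (@ae_continuous_le (fun _ => h) P) => //; first by move=> t; exact: cvg_cst.
  by apply: aeS (aeI hF H) => t [h1 h2] Dt; rewrite /P -h2 // h1.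
have D0 : D 0 by rewrite /= in_itv /= lexx T0.
have P0 : P 0 = c by rewrite /P /prim set_itv1 Rintegral_set1 addr0.
have c0 : 0 < c by rewrite -P0; exact: lt_le_trans (hP 0 D0).
(* y is the candidate for 1 / P; Gronwall applied to y P - 1 shows that it is the reciprocal *)
pose y t := c^-1 + prim G' t.
have cy : continuous y by exact: cprim_continuous.
pose z t := y t * P t - 1.
have cz : continuous z.
  by move=> t; apply: cvgB; [apply: cvgM; [exact: cy|exact: cP]|exact: cvg_cst].
have [B1 HB1] := prim_bounded T bG; have [B2 HB2] := prim_bounded T bG'.
have [B HB] : exists B, forall t, `|G t| <= B by case: bG.
(* truncating P at h makes the quotient measurable and bounded on the whole line *)
pose Pi t := (Num.max (P t) h)^-1.
have Pi0 t : 0 <= Pi t by rewrite invr_ge0 le_max (ltW h0) orbT.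
have Pih t : Pi t <= h^-1 by rewrite lef_pV2 ?posrE ?lt_max ?h0 ?orbT // le_max lexx orbT.
have PiE t : D t -> Pi t = (P t)^-1 by move=> Dt; rewrite /Pi max_l ?hP.
have mPi : measurable_fun [set: R] Pi.
  apply: continuous_measurable_fun => t; apply: cvgV.
    by rewrite gt_eqF // lt_max h0 orbT.
  by apply: continuous_max; [exact: cP|exact: cvg_cst].
have B0 : 0 <= B by exact: le_trans (normr_ge0 _) (HB 0).
have zE t : D t -> z t = \int[leb]_(tau in `[0, t]) (G tau * Pi tau * z tau).
  move=> Dt; rewrite /z /y /P mulrC cprim_mul // divff ?gt_eqF // addrC addKr.
  have p1 := prim_measurable bG; have p2 := prim_measurable bG'.
  case: (bG) => m1 _; case: (bG') => m2 _.
  have mPc : measurable_fun [set: R] (fun t => c + prim G t) by exact: measurable_funD.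
  have mYc : measurable_fun [set: R] y by exact: measurable_funD.
  apply: ae_eq_RI; first exact: measurable_itv.
  - by apply: measurable_funTS; apply: measurable_funD; apply: measurable_funM.
  - apply: measurable_funTS; apply: measurable_funM; first exact: measurable_funM.
    by apply: measurable_funB => //; exact: measurable_funM.
  - apply: aeS (aeI H HG') => s [e1 e2] /(subD Dt) Ds.
    have Pn : P s != 0 by rewrite gt_eqF // (lt_le_trans h0) // hP.
    by rewrite e2 // e1 // -/(P s) -/(y s) PiE //; field.
have z0 : forall t, D t -> z t = 0.
  have L0 : 0 < B / h + 1 by rewrite ltr_wpDl // divr_ge0 // ltW.
  have Z0 : 0 < (`|c^-1| + `|B2|) * (`|c| + `|B1|) + 1.
    by apply: ltr_wpDl => //; apply: mulr_ge0; exact: addr_ge0.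
  apply: (@gronwall0 z _ _ L0 cz Z0).
  - move=> t Dt; rewrite /z; apply: (le_trans (ler_normB _ _)); rewrite normr1 lerD2r normrM.
    apply: ler_pM => //; apply: (le_trans (ler_normD _ _)); rewrite lerD2l; apply: le_trans (ler_norm _).
      exact: HB2 (Dsub Dt).
    exact: HB1 (Dsub Dt).
  - move=> t Dt; rewrite zE //.
    have cnz : continuous (fun tau => `|z tau|) by move=> x; apply: cvg_norm; exact: cz.
    have iz := continuous_itg 0 t cnz.
    rewrite -(RIZl _ (measurable_itv _) iz).
    have mI : measurable `[0, t]%classic by exact: measurable_itv.
    apply: (RI_norm_leM mI _ (itgZl _ mI iz)).
    - apply: measurable_funTS; apply: measurable_funM; last exact: continuous_measurable_fun.
      by apply: measurable_funM => //; case: bG.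
    - move=> x _; rewrite !normrM; apply: ler_wpM2r => //; apply: ler_wpDr => //.
      by apply: ler_pM => //; rewrite ger0_norm.
exists c^-1; apply: aeS H => t e1 Dt; rewrite e1 // -/(P t) -/(y t).
have Pn : P t != 0 by rewrite gt_eqF // (lt_le_trans h0) // hP.
have := z0 t Dt; rewrite /z => /eqP; rewrite subr_eq0 => /eqP e.
by apply: (mulIf Pn); rewrite e mulVf.
Qed.

(** Dominated convergence for the primitives; the constants converge as well,
    because the identity holds for all n at some common time. *)
Lemma wder_lim (f_ g_ : nat -> R -> R) F G (B : R) :
  (forall n, wder (f_ n) (g_ n)) -> (forall n t, `|g_ n t| <= B) ->
  measurable_fun D F -> bmf G ->
  (forall t, D t -> f_ n t @[n --> \oo] --> F t) ->
  {ae leb, forall t, D t -> g_ n t @[n --> \oo] --> G t} -> wder F G.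
Proof.
move=> Hw gB mF bG fF gG; split=> //.
have /choice[c Hc] : forall n, exists c : R, {ae leb, forall t, D t -> f_ n t = c + prim (g_ n) t}.
  by move=> n; case: (Hw n).
have {}Hc := ae_forall Hc.
have mg n : measurable_fun [set: R] (g_ n) by case: (Hw n) => _ [].
have cvp t : D t -> prim (g_ n) t @[n --> \oo] --> prim G t.
  move=> Dt; have mI : measurable `[0, t]%classic by exact: measurable_itv.
  have i0 := bmf_itg 0 t bG.
  have i_ n := bmf_itg 0 t (conj (mg n) (ex_intro _ B (gB n)) : bmf (g_ n)).
  apply: fine_cvg; rewrite fineK; last exact: integrable_fin_num i0.
  have [] // := @dominated_convergence _ _ R leb `[0, t]%classic mI
    (fun n x => (g_ n x)%:E) (fun x => (G x)%:E) (fun _ => B%:E).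
  - by move=> n; case/integrableP : (i_ n).
  - by case/integrableP : i0.
  - by apply: aeS gG => s h /(subD Dt)/h cv; apply: cvg_EFin; [exact: nearW|exact: cv].
  - exact: (itg_cst 0 t B).
  - by apply: aeW => s n _; rewrite lee_fin.
have [t1 [Dt1 Ht1]] : exists t, D t /\ forall n, f_ n t = c n + prim (g_ n) t.
  by have [t [h1 h2]] := ae_ex Hc; exists t; split=> // n; apply: h2.
exists (F t1 - prim G t1); apply: aeS Hc => t Ht Dt.
have cvc : c n @[n --> \oo] --> F t1 - prim G t1.
  rewrite (_ : c = (fun n => f_ n t1 - prim (g_ n) t1)).
    by apply: cvgB; [exact: fF|exact: cvp].
  by apply/funext => n; rewrite Ht1 addrK.
have cv2 : f_ n t @[n --> \oo] --> F t1 - prim G t1 + prim G t.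
  under eq_fun do rewrite (Ht _ Dt).
  by apply: cvgD => //; exact: cvp.
by rewrite -(cvg_lim _ (fF t Dt)) // (cvg_lim _ cv2).
Qed.

(** The primitive of K is constant on ]0, T[ and its derivative is almost everywhere
    K, by Lebesgue's differentiation theorem. *)
Lemma zero_intervals K : itg D K ->
  (forall a b, 0 < a -> a < b -> b < T -> \int[leb]_(t in `]a, b[) K t = 0) ->
  {ae leb, forall t, D t -> K t = 0}.
Proof.
move=> iK HK.
have iK' : itg setT (K \_ D).
  have := (@integrable_mkcond _ _ R leb _ (EFin \o K) mD).1 iK.
  by rewrite (_ : _ \_ _ = EFin \o (K \_ D)) //; apply/funext => x; rewrite /patch /=; case: ifP.
have iKy y : leb.-integrable `]-oo, y] (EFin \o (K \_ D)).
  by apply: (itgS measurableT _ _ iK') => //; exact: measurable_itv.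
have lK : locally_integrable [set: R] (K \_ D) by exact: integrable_locally_restrict mD iK.
have Hd := FTC1Ny iKy lK.
have H0 : {ae leb, forall t, t != 0 :> R}.
  exists [set 0]; split; [exact: measurable_set1|exact: lebesgue_measure_set1|].
  by move=> t /=; move=> /negP; rewrite negbK => /eqP.
apply: aeS (aeI Hd H0) => t [h1 h2] Dt.
have /andP[t0 tT] : 0 < t < T.
  by move: Dt; rewrite /= in_itv /= => /andP[t0 ->]; rewrite andbT lt_neqAle eq_sym h2.
move: h1 => [_].
have -> : (K \_ D) t = K t by rewrite /patch mem_set.
move=> <-; rewrite derive1E; set F := (fun x : R => _).
rewrite (@near_eq_derive _ _ _ F (fun _ => F t) t 1) //; first exact: derive_cst.
have : \forall x \near t, (t / 2 < x) && (x < T).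
  near=> x; apply/andP; split; near: x; [apply: lt_nbhsr|apply: lt_nbhsl] => //.
  by rewrite ltr_pdivrMr // ltr_pMr // ltr1n.
have E x : t / 2 < x -> x < T -> F x = F (t / 2).
  move=> tx xT; rewrite /F; apply/eqP; rewrite -subr_eq0; apply/eqP.
  rewrite (@Rintegral_itvB _ (K \_ D) -oo%O (BRight x) (t / 2)) ?bnd_simp //; last exact: ltW.
  have a0 : 0 < t / 2 by rewrite divr_gt0.
  rewrite -[RHS](HK _ _ a0 tx xT) -Rintegral_itv_bndo_bndc; last first.
    by apply: (itgS measurableT _ _ iK') => //; exact: measurable_itv.
  apply: eq_RI => y; rewrite /= in_itv /= => /andP[y1 y2]; rewrite /patch mem_set //=.
  by rewrite in_itv /= (ltW (lt_trans a0 y1)) (lt_trans y2 xT).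
apply: filterS => x /andP[x1 x2]; rewrite (E x) // (E t) //.
by rewrite ltr_pdivrMr // ltr_pMr // ltr1n.
Unshelve. all: by end_near.
Qed.

(** The bumps tend to the indicator of an interval. *)
Lemma test_zero K : itg D K ->
  (forall a b n, 0 < a -> a < b -> b < T -> \int[leb]_(t in D) (K t * bump a b n t) = 0) ->
  {ae leb, forall t, D t -> K t = 0}.
Proof.
move=> iK HK; apply: zero_intervals => // a b a0 ab bT.
have mK : measurable_fun D K by case/integrableP: iK => /measurable_EFinP.
have mb n : measurable_fun [set: R] (bump a b n).
  by apply: continuous_measurable_fun; case: (smooth_bump a b n 1) => + _ => d x; apply: differentiable_continuous; apply/derivable1_diffP.
pose J t : R := K t * (if t \in `]a, b[ then 1 else 0).
have mJ : measurable_fun D J.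
  apply: measurable_funM => //; apply: measurable_funTS.
  rewrite (_ : (fun x => _) = \1_`]a, b[); first exact: measurable_indic.
  by apply/funext => x; rewrite indicE mem_setE; case: ifP.
have bnd n x : `|K x * bump a b n x| <= `|K x|.
  by rewrite normrM [X in _ * X]ger0_norm ?bump_ge0 // ler_piMr // bump_le1.
have iJ : itg D J.
  apply: (itg_dom mD mJ iK) => x Dx.
  by rewrite /J normrM; case: ifP; rewrite ?normr1 ?mulr1 ?normr0 ?mulr0.
have i_ n : itg D (fun t => K t * bump a b n t).
  apply: (itg_dom mD _ iK) => [|x Dx]; last exact: bnd.
  by apply: measurable_funM => //; exact: measurable_funTS.
have cv : \int[leb]_(t in D) (K t * bump a b n t) @[n --> \oo] --> \int[leb]_(t in D) J t.
  apply: fine_cvg; rewrite fineK; last exact: integrable_fin_num iJ.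
  have [] // := @dominated_convergence _ _ R leb D mD
    (fun n x => (K x * bump a b n x)%:E) (fun x => (J x)%:E) (fun x => `|K x|%:E).
  - by move=> n; case/integrableP : (i_ n).
  - by case/integrableP : iJ.
  - apply: aeW => x _; apply: cvg_EFin; first exact: nearW.
    by apply: cvgM; [exact: cvg_cst|exact: bump_cvg].
  - exact: (@integrable_norm _ _ R leb D _ iK).
  - by apply: aeW => x n _; rewrite lee_fin.
have J0 : \int[leb]_(t in D) J t = 0.
  rewrite -(cvg_lim _ cv) // (_ : (fun n => _) = (fun=> 0)); first exact: lim_cst.
  by apply/funext => n; exact: HK.
rewrite -[RHS]J0 [RHS]Rintegral_mkcond [LHS]Rintegral_mkcond; apply: eq_RI => x _.
rewrite /patch /J !mem_setE; case: ifPn => [xab|xab]; last by case: ifP; rewrite ?mulr0.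
rewrite ifT ?mulr1 //; move: xab; rewrite !in_itv /= => /andP[x1 x2].
by rewrite (ltW (lt_trans a0 x1)) (lt_trans x2 bT).
Qed.

End WeakTime.

Section WeakTime2.
Variables (R : realType) (T : R).
Hypothesis T0 : 0 < T.
Local Notation leb := (@lebesgue_measure R).
Local Notation D := [set` `[(0:R), T[].
Implicit Types (F G : R -> R) (a b c t : R) (P Q : R -> Prop).

Let mDT : measurable D := mD T.

Lemma RI_zero (E : set R) (f : R -> R) : (forall x, E x -> f x = 0) ->
  \int[leb]_(x in E) f x = 0.
Proof. by move=> H; rewrite /Rintegral integral0_eq // => x Ex; rewrite H. Qed.

Lemma bmf_restrict (f : R -> R) : continuous f -> bmf (fun t => if t \in `[0, T] then f t else 0).
Proof.
move=> cf; split.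
  rewrite (_ : (fun t => _) = (fun t => \1_`[0, T] t * f t)).
    apply: measurable_funM; last exact: continuous_measurable_fun.
    by apply: measurable_indic; exact: measurable_itv.
  by apply/funext => x; rewrite indicE mem_setE; case: ifP; rewrite ?mul1r ?mul0r.
have [B [_ HB]] : bounded_set (f @` `[0, T]).
  apply: compact_bounded; apply: continuous_compact; last exact: segment_compact.
  by apply: continuous_subspaceT.
exists (`|B| + 1) => t; case: ifP => [tT|_]; last by rewrite normr0 addr_ge0.
by apply: (HB (`|B| + 1)); [rewrite ltr_pwDr // ler_norm|exists t].
Qed.

Lemma test_prim (phi : R -> R) : test_function T phi -> exists psi, [/\ bmf psi,
  bmf (fun t => if t \in `[0, T] then phi t else 0),
  forall t, D t -> psi t = derive1 phi t, forall t, `[0, T]%classic t -> phi t = 0 + prim psi t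
  & phi T = 0].
Proof.
move=> [sm [a [b [a0 bT H]]]].
have [d1 n1] := ndP (test_smooth sm 1).
have c1 : continuous phi by exact: der_continuous d1.
have c2 : continuous (derive1 phi).
  have [_ n2] := ndP (test_smooth sm 2); have [d4 _] := ndP n2; exact: der_continuous d4.
exists (fun t => if t \in `[0, T] then derive1 phi t else 0); split.
- exact: bmf_restrict.
- exact: bmf_restrict.
- by move=> t /Dsub /= ->.
- move=> t /=; rewrite in_itv /= => /andP[t0 tT]; rewrite add0r /prim.
  rewrite (eq_RI (g := derive1 phi)); last first.
    by move=> x /=; rewrite !in_itv /= => /andP[-> xt]; rewrite (le_trans xt tT).
  by rewrite (RI_der d1 c2 t0) (H 0) ?subr0 // in_itv /= leNgt a0.
- by rewrite H // in_itv /= negb_and -!ltNge bT orbT.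
Qed.

Lemma D_itv (f : R -> R) : itg D f -> \int[leb]_(t in D) f t = \int[leb]_(t in `[0, T]) f t.
Proof. by move=> h; rewrite Rintegral_itv_bndo_bndc. Qed.

(** A test function is the primitive of its derivative, so that this is the product
    rule for primitives between the ends of the interval. *)
Lemma wder_weak F G phi : wder T F G -> test_function T phi ->
  \int[leb]_(t in D) (F t * derive1 phi t) = - \int[leb]_(t in D) (G t * phi t).
Proof.
move=> [mF bG [c HF]] tp; have [psi [bp bq e1 e2 e3]] := test_prim tp.
have mp := prim_measurable bG; have mq := prim_measurable bp.
have [mG _] := bG; have [mpsi _] := bp.
have iGp : itg `[0, T] (fun t => G t * prim psi t) by exact: itg_mul_prim.
have iPp : itg `[0, T] (fun t => (c + prim G t) * psi t).
  rewrite (_ : (fun t => _) = (fun t => c * psi t + prim G t * psi t)); last by apply/funext => t; ring.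
  by apply: itgD; [exact: measurable_itv|apply: itgZl (bmf_itg _ _ bp)|apply: itg_prim_mul] => //; exact: measurable_itv.
have iD f : itg `[0, T] f -> itg D f by apply: itgS (@Dsub _ T) => //; exact: measurable_itv.
have E1 : \int[leb]_(t in D) (F t * derive1 phi t) = \int[leb]_(t in `[0, T]) ((c + prim G t) * psi t).
  rewrite -D_itv; last exact: iD.
  transitivity (\int[leb]_(t in D) (F t * psi t)); first by apply: eq_RI => t Dt; rewrite e1.
  apply: ae_eq_RI => //.
  - by apply: measurable_funM => //; exact: measurable_funTS.
  - by apply: measurable_funTS; apply: measurable_funM => //; apply: measurable_funD.
  - by apply: aeS HF => t h Dt; rewrite h.
have E2 : \int[leb]_(t in D) (G t * phi t) = \int[leb]_(t in `[0, T]) (G t * prim psi t).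
  rewrite -D_itv; last exact: iD.
  by apply: eq_RI => t /Dsub Dt; rewrite e2 // add0r.
have TT : `[0, T]%classic T by rewrite /= in_itv /= lexx ltW.
have := cprim_mul c 0 T bG bp.
rewrite -(e2 T TT) e3 !mulr0 add0r.
rewrite (eq_RI (g := fun t => G t * prim psi t + (c + prim G t) * psi t)); last by move=> t _; rewrite add0r.
rewrite RID //.
by rewrite E1 E2 => h; apply/eqP; rewrite -subr_eq0 opprK addrC -h.
Qed.

Lemma prim_der psi (m : R) : continuous psi -> 0 < m -> (forall t, t < m -> psi t = 0) ->
  der (prim psi) psi.
Proof.
move=> cp m0 Hm t; case: (ltP t m) => tm; last first.
  have t0 : 0 < t by exact: lt_le_trans tm.
  have lt1 : t < t + 1 by rewrite ltrDl.
  have [d e] := continuous_FTC1_closed lt1 (continuous_itg 0 (t + 1) cp) t0 (cp t).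
  by apply: DeriveDef; [exact: d|rewrite -derive1E -[RHS]e].
have z x : x < m -> prim psi x = 0.
  move=> xm; by apply: RI_zero => y /=; rewrite in_itv /= => /andP[_ yx]; rewrite Hm // (le_lt_trans yx).
rewrite (Hm t tm).
have nz : \forall x \near t, (fun _ : R => 0 : R) x = prim psi x.
  by near=> x; rewrite z //; near: x; exact: lt_nbhsl.
apply: (@near_eq_is_derive _ _ _ (fun _ => 0)) => //.
Unshelve. all: by end_near.
Qed.

(** Let V be F minus the primitive of G.  It is orthogonal to the derivatives of test
    functions, hence to the combinations of two bumps which have zero integral, and
    so it is almost everywhere a constant. *)
Lemma dubois_reymond F G : bmf F -> bmf G ->
  (forall phi, test_function T phi ->
    \int[leb]_(t in D) (F t * derive1 phi t) = - \int[leb]_(t in D) (G t * phi t)) ->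
  wder T F G.
Proof.
move=> bF bG H; have [mF _] := bF; split=> //; first exact: measurable_funTS.
have wG : wder T (prim G) G.
  split=> //; first by apply: measurable_funTS; exact: prim_measurable.
  by exists 0; apply: aeW => t _; rewrite add0r.
pose W t := F t + -1 * prim G t.
have bP : bmf (fun t => if t \in `[0, T] then prim G t else 0).
  by apply: bmf_restrict; exact: prim_continuous.
pose V t := F t + -1 * (if t \in `[0, T] then prim G t else 0).
have bV : bmf V by apply: bmf_add => //; apply: bmf_mul => //; exact: bmf_cst.
have iD f : bmf f -> itg D f by apply: (bmfT_itg mDT (@Dsub _ T)).
have V0 phi : test_function T phi -> \int[leb]_(t in D) (V t * derive1 phi t) = 0.
  move=> tp; have [psi [bp bq e1 e2 e3]] := test_prim tp.
  have := wder_weak wG tp; have := H phi tp => <-.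
  rewrite (eq_RI (g := fun t => (if t \in `[0, T] then prim G t else 0) * psi t)); last first.
    by move=> t Dt; rewrite (e1 _ Dt) ifT //; exact: (Dsub Dt).
  rewrite [RHS](eq_RI (g := fun t => F t * psi t)); last by move=> t Dt; rewrite e1.
  rewrite [in X in _ -> X](eq_RI (g := fun t => F t * psi t + -1 * ((if t \in `[0, T] then prim G t else 0) * psi t))); last first.
    by move=> t Dt; rewrite -e1 // /V; ring.
  have i1 : itg D (fun t => F t * psi t) by apply: iD; exact: bmf_mul.
  have i2 : itg D (fun t => (if t \in `[0, T] then prim G t else 0) * psi t) by apply: iD; exact: bmf_mul.
  by rewrite RID // ?RIZl // => [->|]; [ring|exact: itgZl].
have bb a b n : bmf (bump a b n).
  split; last by exists 1 => t; rewrite ger0_norm ?bump_ge0 ?bump_le1.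
  by apply: continuous_measurable_fun; have [d _] := ndP (smooth_bump a b n 1); exact: der_continuous d.
have [a0 [b0 [n0 [a00 ab0 b0T I0]]]] : exists a b n, [/\ 0 < a, a < b, b < T &
    \int[leb]_(t in D) (1 * bump a b n t) != 0].
  apply: contrapT => hN.
  have [] // := @ae_ex _ T T0 (fun t => D t -> 1 = 0 :> R).
    apply: (test_zero (K := fun _ => 1)); first by apply: iD; exact: bmf_cst.
    move=> a b n a0 ab bT; apply/eqP; rewrite -[_ == _]negbK; apply/negP => h.
    by apply: hN; exists a, b, n.
  by move=> t [Dt] /(_ Dt)/eqP; rewrite oner_eq0.
have I0' : \int[leb]_(t in D) (bump a0 b0 n0 t) != 0.
  by move: I0; rewrite (eq_RI (g := bump a0 b0 n0)) // => t _; rewrite mul1r.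
(* c is the value that V has to take, computed on one fixed bump of nonzero integral *)
pose c := \int[leb]_(t in D) (V t * bump a0 b0 n0 t) / \int[leb]_(t in D) (bump a0 b0 n0 t).
suff : {ae leb, forall t, D t -> V t + - c = 0}.
  move=> h; exists c; apply: aeS h => t h Dt; have := h Dt.
  by rewrite /V ifT; [lra|exact: (Dsub Dt)].
apply: test_zero; first by apply: iD; apply: bmf_add => //; exact: bmf_cst.
move=> a b n aa ab bT.
pose k := \int[leb]_(t in D) (bump a b n t) / \int[leb]_(t in D) (bump a0 b0 n0 t).
(* k makes the integral of psi vanish, so that its primitive is again a test function *)
pose psi t := bump a b n t + (- k) * bump a0 b0 n0 t.
have bpsi : bmf psi by apply: bmf_add => //; apply: bmf_mul => //; exact: bmf_cst.
have sp : smooth psi by move=> j; apply: nd_add; [exact: smooth_bump|apply: nd_scale; exact: smooth_bump].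
have cp : continuous psi by have [d _] := ndP (sp 1%N); exact: der_continuous d.
have m0 : 0 < Num.min a a0 by rewrite lt_min aa.
have zl t : t < Num.min a a0 -> psi t = 0.
  rewrite lt_min => /andP[h1 h2]; rewrite /psi !bump_out ?mulr0 ?addr0 // in_itv /= negb_and -!leNgt ?(ltW h1) ?(ltW h2) //.
have zr t : Num.max b b0 < t -> psi t = 0.
  rewrite gt_max => /andP[h1 h2]; rewrite /psi !bump_out ?mulr0 ?addr0 // in_itv /= negb_and -!leNgt ?(ltW h1) ?(ltW h2) orbT //.
have dp := prim_der cp m0 zl.
have ip : \int[leb]_(t in D) psi t = 0.
  rewrite /psi RID //; [|by apply: iD|by apply: itgZl => //; exact: iD].
  by rewrite RIZl //; [rewrite /k mulNr divfK // subrr|exact: iD].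
have maxT : Num.max b b0 < T by rewrite gt_max bT.
have max0 : 0 <= Num.max b b0 by rewrite le_max (ltW (lt_trans aa ab)).
have pz t : Num.max b b0 <= t -> prim psi t = 0.
  move=> bt.
  have tail u v : Num.max b b0 <= u -> \int[leb]_(tau in `]u, v]) psi tau = 0.
    move=> bu; apply: RI_zero => y /=; rewrite in_itv /= => /andP[yu _].
    by rewrite zr // (le_lt_trans bu).
  have pT : prim psi T = 0 by rewrite /prim -D_itv ?ip //; exact: iD.
  have pm : prim psi (Num.max b b0) = 0.
    by move: pT; rewrite (prim_split bpsi max0 (ltW maxT)) tail // addr0.
  by rewrite (prim_split bpsi max0 bt) tail // addr0.
have tp : test_function T (prim psi).
  split.
    by apply: smooth_test => -[//|j]; apply: ndS dp (sp j).
  exists (Num.min a a0), (Num.max b b0); split=> // t.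
  rewrite in_itv /= negb_and -!ltNge => /orP[h|h]; last by rewrite pz // ltW.
  by apply: RI_zero => y /=; rewrite in_itv /= => /andP[_ yx]; rewrite zl // (le_lt_trans yx).
have iVb a' b' n' : itg D (fun t => V t * bump a' b' n' t) by apply: iD; exact: bmf_mul.
have := V0 _ tp; rewrite (derE dp).
rewrite (eq_RI (g := fun t => V t * bump a b n t + (- k) * (V t * bump a0 b0 n0 t))); last first.
  by move=> t _; rewrite /psi; ring.
rewrite RID //; last by apply: itgZl.
rewrite RIZl // => e.
rewrite (eq_RI (g := fun t => V t * bump a b n t + (- c) * bump a b n t)); last first.
  by move=> t _; ring.
rewrite RID //; last by apply: itgZl => //; exact: iD.
rewrite RIZl //; last exact: iD.
rewrite -[RHS]e /c /k; move: I0'.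
move: (\int[leb]_(t in D) bump a0 b0 n0 t) (\int[leb]_(t in D) bump a b n t) => u v.
move: (\int[leb]_(t in D) (V t * bump a0 b0 n0 t)) => w u0.
by congr (_ + _); rewrite !mulNr mulrAC [in RHS]mulrAC [w * v]mulrC.
Qed.

Lemma wder_of_is_dt (f g : R -> R -> R) F G x : is_dt T f g -> bmf F -> bmf G ->
  {ae leb, forall t, D t -> F t = f t x} -> {ae leb, forall t, D t -> G t = g t x} ->
  wder T F G.
Proof.
move=> [_ jf jg H] bF bG Ff Gg; apply: dubois_reymond => // phi tp.
have [psi [bp bq e1 e2 e3]] := test_prim tp.
have [mF _] := bF; have [mG _] := bG; have [mp _] := bp; have [mq _] := bq.
have mf : measurable_fun D (f ^~ x) by case/integrableP : (jf x) => /measurable_EFinP.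
have mg : measurable_fun D (g ^~ x) by case/integrableP : (jg x) => /measurable_EFinP.
have /(_ x phi tp) := H.
rewrite [X in X = _ -> _](eq_RI (g := fun t => f t x * psi t)); last by move=> t Dt; rewrite e1.
rewrite [X in _ = - X -> _](eq_RI (g := fun t => g t x * (if t \in `[0, T] then phi t else 0))); last first.
  by move=> t Dt; rewrite ifT //; exact: (Dsub Dt).
rewrite [X in _ -> X = _](eq_RI (g := fun t => F t * psi t)); last by move=> t Dt; rewrite e1.
rewrite [X in _ -> _ = - X](eq_RI (g := fun t => G t * (if t \in `[0, T] then phi t else 0))); last first.
  by move=> t Dt; rewrite ifT //; exact: (Dsub Dt).
have m1 := measurable_funTS (D := D) mp; have m2 := measurable_funTS (D := D) mq.
rewrite (@ae_eq_RI _ D (fun t => F t * psi t) (fun t => f t x * psi t)) //; first last.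
- by apply: aeS Ff => t h Dt; rewrite h.
- exact: measurable_funM.
- by apply: measurable_funM => //; exact: measurable_funTS.
move=> ->; congr (- _); apply: ae_eq_RI => //.
- exact: measurable_funM.
- by apply: measurable_funM => //; exact: measurable_funTS.
- by apply: aeS Gg => t h Dt; rewrite h.
Qed.

Lemma is_dt_of_wder (f g : R -> R -> R) : (forall x, wder T (f ^~ x) (g ^~ x)) ->
  ae_time T (fun t => continuous (g t)) -> is_dt T f g.
Proof.
move=> H cg; split=> //.
- move=> x; have [mF bG [c HF]] := H x; have [B HB] := prim_bounded T bG.
  have [Z Z0 HZ] := D_bound (H x).
  have : itg D (fun _ => Z) by apply: (bmfT_itg mDT (@Dsub _ T)); exact: bmf_cst.
  move=> /integrableP[_ iZ]; apply/integrableP; split; first exact/measurable_EFinP.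
  apply: le_lt_trans iZ; apply: ae_ge0_le_integral => //.
  - by apply: measurableT_comp => //; exact/measurable_EFinP.
  - by apply: aeS HZ => t h Dt; rewrite /= lee_fin (le_trans (h Dt)) // ler_norm.
- by move=> x; have [_ bG _] := H x; apply: (bmfT_itg mDT (@Dsub _ T)).
- by move=> x phi tp; apply: wder_weak (H x) tp.
Qed.

(** For each rational x the two derivatives agree at almost every time; almost
    every time serves for all rational x, and continuity in x does the rest. *)
Lemma is_dt_unique (f g1 g2 : R -> R -> R) : is_dt T f g1 -> is_dt T f g2 ->
  ae_time T (fun t => forall x, g1 t x = g2 t x).
Proof.
move=> [c1 _ j1 H1] [c2 _ j2 H2].
have tb a b n : 0 < a -> a < b -> b < T -> test_function T (bump a b n).
  move=> a0 ab bT; split; first by apply: smooth_test; exact: smooth_bump.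
  exists a, b; split=> // t h; apply: bump_out; apply: contra h.
  by rewrite !in_itv /= => /andP[/ltW -> /ltW ->].
have E x : {ae leb, forall t, D t -> g1 t x - g2 t x = 0}.
  have i1 := j1 x; have i2 := j2 x.
  have i12 : itg D (fun t => g1 t x + -1 * g2 t x) by apply: itgD => //; exact: itgZl.
  suff : {ae leb, forall t, D t -> g1 t x + -1 * g2 t x = 0}.
    by apply: aeS => t h /h; lra.
  apply: test_zero => // a b n a0 ab bT.
  have bb : bmf (bump a b n).
    split; last by exists 1 => t; rewrite ger0_norm ?bump_ge0 ?bump_le1.
    by apply: continuous_measurable_fun; have [d _] := ndP (smooth_bump a b n 1); exact: der_continuous d.
  have [mb _] := bb.
  have k1 (g : R -> R) : itg D g -> itg D (fun t => g t * bump a b n t).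
    move=> ig; apply: (itg_dom mDT _ ig) => [|t _].
      by apply: measurable_funM; [case/integrableP : ig => /measurable_EFinP|exact: measurable_funTS].
    by rewrite normrM ler_piMr // ger0_norm ?bump_ge0 // bump_le1.
  have t1 := tb a b n a0 ab bT.
  have := H1 x _ t1; rewrite H2 // => /oppr_inj e.
  rewrite (eq_RI (g := fun t => g1 t x * bump a b n t + -1 * (g2 t x * bump a b n t))); last first.
    by move=> t _; ring.
  rewrite RID //; [|exact: k1|by apply: itgZl => //; exact: k1].
  by rewrite RIZl //; [rewrite e; ring|exact: k1].
have : {ae leb, forall t, forall n : nat, D t -> forall q : rat, pickle q = n -> g1 t (ratr q) = g2 t (ratr q)}.
  apply: ae_forall => n; case e : (@unpickle rat n) => [q|]; last first.
    by apply: aeW => t _ q qn; move: e; rewrite -qn pickleK.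
  apply: aeS (E (ratr q)) => t h Dt q' qn; move: e; rewrite -qn pickleK => -[->].
  by apply/eqP; rewrite -subr_eq0; apply/eqP; exact: h.
move=> H; apply: aeS (aeI H (aeI c1 c2)) => t [h [d1 d2]] Dt x.
have {}h q : g1 t (ratr q) = g2 t (ratr q) by exact: (h _ Dt).
have cx := d1 Dt; have cy := d2 Dt.
apply: contrapT => /eqP ne.
have : \forall y \near x, g1 t y - g2 t y != 0.
  have cv : (g1 t y - g2 t y) @[y --> x] --> g1 t x - g2 t x by apply: cvgB; [exact: cx|exact: cy].
  by apply: (cvgr_neq0 _ cv); rewrite subr_eq0.
move=> /nbhs_ballP[e /= e0 He].
have xe : x < x + e by rewrite ltrDl.
have [q] := rat_in_itvoo xe; rewrite in_itv /= => /andP[q1 q2].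
have := He (ratr q); rewrite h subrr eqxx => /(_ _)/negP/(_ isT); apply.
by rewrite /ball /= distrC ger0_norm ?subr_ge0 ?(ltW q1) // ltrBlDl.
Qed.

End WeakTime2.

(** * Functions of time and space: classes and expansions *)

Section DiffQuotient.
Variable R : realType.
Implicit Types f : R -> R.

Definition dquot f x (n : nat) : R := n.+1%:R * (f (x + n.+1%:R^-1) - f x).

Lemma dquot_cvg f f' x : der f f' -> dquot f x n @[n --> \oo] --> f' x.
Proof.
move=> F; have [dF <-] := F x.
have cv : (n.+1%:R^-1 : R) @[n --> \oo] --> (0 : R)^'.
  move=> A /= [e /= e0 He].
  have hc := @cvg_harmonic R.
  have : \forall n \near \oo, ball (0 : R) e (n.+1%:R^-1 : R) by apply: hc; exact: nbhsx_ballx.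
  by apply: filterS => n h; apply: He => //; rewrite invr_eq0 pnatr_eq0.
have h := cvg_comp _ _ cv dF.
rewrite (_ : dquot f x = ((fun h : R => h^-1 *: ((f \o shift x) (h *: 1) - f x)) \o (fun n : nat => (n.+1%:R^-1 : R)))).
  exact: h.
by apply/funext => n; rewrite /dquot /= invrK; congr (_ * (f _ - _)); rewrite addrC /GRing.scale /= mulr1.
Qed.

(** The mean value theorem gives a bound which does not depend on the step. *)
Lemma dquot_le f f' (Z x : R) n : der f f' -> (forall y, `|f' y| <= Z) -> `|dquot f x n| <= Z.
Proof.
move=> F HZ; have n0 : (0 : R) < n.+1%:R^-1 by rewrite invr_gt0 ltr0n.
have ab : x < x + n.+1%:R^-1 by rewrite ltrDl.
have [|y _ e] := @MVT R f f' x (x + n.+1%:R^-1) ab (fun y _ => F y).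
  by apply: continuous_subspaceT; exact: der_continuous F.
rewrite /dquot e addrC addKr mulrC -mulrA mulVf ?mulr1 //.
Qed.
End DiffQuotient.

Lemma Hs_ball0 (R : realType) (sg N : R) : 2^-1 < sg -> 0 < N -> Hs_ball sg N (fun _ => 0).
Proof.
move=> s2 N0; exists (fun _ => 0).
  split=> //.
  rewrite integral0_eq ?lee_fin ?sqr_ge0 // => x _.
  by rewrite expr0n mulr0.
move=> x; rewrite /hart /Rintegral integral0_eq // => y _.
by rewrite mul0r.
Qed.

Section Classes.
Variables (R : realType) (s B T : R) (E : set R).
Local Notation leb := (@lebesgue_measure R).
Local Notation D := [set` `[(0:R), T[].
Hypotheses (s2 : 2^-1 < s) (B16 : 16 <= B) (T0 : 0 < T).
Hypothesis HK : forall k, (k <= 3)%N -> 16 * Kconv (s + k%:R) <= B /\ Kneu (s + k%:R) <= B.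
Hypotheses (mE : measurable E) (ED : E `<=` D) (Eae : {ae leb, forall t, D t -> E t}).

Let mDT : measurable D := mD T.
Lemma B1 : 1 <= B. Proof. by apply: le_trans B16; rewrite ler1n. Qed.
Lemma B0 : 0 < B. Proof. exact: lt_le_trans B1. Qed.
Lemma Bn0 n : 0 < B ^+ n. Proof. exact: exprn_gt0 B0. Qed.
Lemma Bn_le m n : (m <= n)%N -> B ^+ m <= B ^+ n.
Proof. by move=> mn; apply: ler_weXn2l => //; exact: B1. Qed.
Lemma BM m n : B ^+ m * B ^+ n = B ^+ (m + n). Proof. by rewrite exprD. Qed.
Lemma sk2 k : 2^-1 < s + k%:R. Proof. by apply: lt_le_trans s2 _; rewrite lerDl. Qed.

(** All the bounds are measured in powers of the single number B, which exceeds the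
    constants of the Sobolev estimates: each operation adds a small integer to
    the exponent. *)
Definition HsB (k n : nat) (f : R -> R) : Prop := Hs_ball (s + k%:R) (B ^+ n) f.

Lemma HsB_ext k n f g : (forall x, f x = g x) -> HsB k n f -> HsB k n g.
Proof. exact: Hs_ball_ext. Qed.

Lemma HsB_le k k' n n' f : (k' <= k)%N -> (n <= n')%N -> HsB k n f -> HsB k' n' f.
Proof. by move=> kk nn; apply: Hs_ball_mono; [rewrite lerD2l ler_nat|exact: Bn_le]. Qed.

Lemma HsB0 k n : HsB k n (fun _ => 0).
Proof. by apply: Hs_ball0; [exact: sk2|exact: Bn0]. Qed.

Lemma HsB_add k n m f g : HsB k n f -> HsB k m g -> HsB k (maxn n m).+1 (fun x => f x + g x).
Proof.
move=> F G; apply: Hs_ball_mono (Hs_ball_add (sk2 k) F G) => //.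
apply: (@le_trans _ _ (2 * (B ^+ (maxn n m) + B ^+ (maxn n m)))).
  by rewrite ler_pM2l // lerD // Bn_le // ?leq_maxl ?leq_maxr.
by have := Bn0 (maxn n m); rewrite [leRHS]exprS; move: (B ^+ (maxn n m)) => b b0; have := B16; nra.
Qed.

Lemma HsB_scale k n m (a : R) f : `|a| <= B ^+ m -> HsB k n f -> HsB k (m + n) (fun x => a * f x).
Proof. by move=> aB F; rewrite /HsB -BM; apply: Hs_ball_scale => //; [exact: sk2|exact: Bn0]. Qed.

Lemma HsB_mul k n m f g : (k <= 3)%N -> HsB k n f -> HsB k m g ->
  HsB k (n + m).+1 (fun x => f x * g x).
Proof.
move=> k3 F G; apply: Hs_ball_mono (Hs_ball_mul (sk2 k) F G) => //.
by rewrite BM exprS ler_wpM2r ?(ltW (Bn0 _)) //; case: (HK k3).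
Qed.

Lemma HsB_bound k n f x : (k <= 3)%N -> HsB k n f -> `|f x| <= B ^+ n.+1.
Proof.
move=> k3 F; apply: (le_trans (Hs_ball_bound x (sk2 k) F)).
rewrite exprS ler_wpM2r ?(ltW (Bn0 _)) //; apply: le_trans (HK k3).2.
have K1 := Kwt_ge1 (s + k%:R); have K2 := Kconv_ge1 (s + k%:R).
rewrite /Kneu; apply: ler_wpDl; first by rewrite mulr_ge0 // (le_trans ler01).
by rewrite ler_wpM2r ?ler_nat // (le_trans ler01).
Qed.

Lemma HsB_deriv k n f : HsB k.+1 n f -> der f (derive1 f) /\ HsB k n (derive1 f).
Proof.
rewrite /HsB -natr1 addrA => F; have [d h] := Hs_ball_deriv (sk2 k) F.
by split=> //; exact: derivable_der.
Qed.

(** The bound of f is B^(- n) with n at least 3, small enough for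
    [Hs_ball_inv1B]. *)
Lemma HsB_inv k n f : (k <= 3)%N -> HsB k 0 (fun x => B ^+ n * f x) -> (3 <= n)%N ->
  HsB k 0 (fun x => (1 - f x)^-1 - 1).
Proof.
move=> k3 F n3.
have {}F : Hs_ball (s + k%:R) (B ^- 3) f.
  have := Hs_ball_scale (k := B ^- n) (L := B ^- n) (sk2 k) _ _ F.
  rewrite expr0 mulr1 invr_gt0 Bn0 ger0_norm ?invr_ge0 ?(ltW (Bn0 _)) // => /(_ isT (lexx _)).
  move=> h; apply: Hs_ball_mono (Hs_ball_ext _ h) => //.
    by rewrite lef_pV2 ?posrE ?Bn0 // Bn_le.
  by move=> x; rewrite mulKf // gt_eqF // Bn0.
have Bi : B ^- 3 <= B^-1 * 16^-1.
  rewrite -invfM lef_pV2 ?posrE ?Bn0 ?mulr_gt0 ?B0 //.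
  by rewrite exprS ler_pM2l ?B0 // expr2 (le_trans B16) // ler_peMl ?B1 ?(ltW B0).
have Bi1 : B^-1 <= 1 by rewrite invf_le1 ?B0 ?B1.
have h : Kneu (s + k%:R) * B ^- 3 <= 4^-1.
  have [_ hk] := HK k3.
  apply: (@le_trans _ _ (B * (B^-1 * 16^-1))).
    apply: ler_pM => //; last by rewrite invr_ge0 ltW // Bn0.
    rewrite /Kneu addr_ge0 // mulr_ge0 //.
      by rewrite (le_trans ler01) // Kconv_ge1.
    by rewrite (le_trans ler01) // Kwt_ge1.
  rewrite mulrA divff ?gt_eqF ?B0 // mul1r lef_pV2 ?posrE // ler_nat //.
apply: Hs_ball_mono (Hs_ball_inv1B (sk2 k) F h) => //.
rewrite expr0; apply: (@le_trans _ _ (2 * (1 * 16^-1))).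
  by rewrite ler_pM2l // (le_trans Bi) // ler_wpM2r // invr_ge0.
by rewrite mul1r ler_pdivrMr // mul1r ler_nat.
Qed.

Lemma E_bmf (G : R -> R) Z : measurable_fun D G -> (forall t, E t -> `|G t| <= Z) ->
  (forall t, ~ E t -> G t = 0) -> bmf G.
Proof.
move=> mG GZ G0; split.
  rewrite (_ : G = G \_ D); first exact/(measurable_restrictT _ mDT).
  apply/funext => t; rewrite /patch; case: ifPn => // h; rewrite G0 // => /ED Dt.
  by move: h; rewrite mem_set.
exists `|Z| => t; have [Et|nE] := pselect (E t); last by rewrite G0 // normr0.
by apply: (le_trans (GZ t Et)); rewrite ler_norm.
Qed.

(** E is the set of the times with uniform bounds.  At the other times f is only
    known to be differentiable in space, and its time derivative g is set to 0.
    The constant c is subtracted because functions such as 1 - e zeta do not decay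
    at infinity. *)
Definition W1B (k n : nat) (c : R) (f g : R -> R -> R) : Prop :=
  [/\ (k <= 2)%N /\ `|c| <= B ^+ n,
      forall x, measurable_fun D (f ^~ x),
      forall t, D t -> nd k.+1 (f t)
    & forall t, E t -> HsB k.+1 n (fun x => f t x - c)] /\
  [/\ forall x, wder T (f ^~ x) (g ^~ x),
      forall t, E t -> HsB k n (g t)
    & forall t x, ~ E t -> g t x = 0].

Lemma W1B_cst k n c : (k <= 2)%N -> `|c| <= B ^+ n -> W1B k n c (fun _ _ => c) (fun _ _ => 0).
Proof.
move=> k2 cB; split; split=> //.
- by move=> t _; exact: nd_cst.
- by move=> t _; apply: HsB_ext (HsB0 _ _) => x; rewrite subrr.
- by move=> x; exact: wder_cst.
- by move=> t _; exact: HsB0.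
Qed.

Lemma W1B_eqD k n c f f' g : (forall t x, D t -> f t x = f' t x) -> W1B k n c f g -> W1B k n c f' g.
Proof.
move=> ff [[[k2 cB] m d h] [w hg g0]].
have mf' x : measurable_fun D (f' ^~ x).
  by apply: eq_measurable_fun (m x) => t; rewrite inE => Dt; rewrite ff.
split; split=> //.
- by move=> t Dt; apply: nd_ext (d t Dt) => x; rewrite ff.
- by move=> t Et; apply: HsB_ext (h t Et) => x; rewrite ff //; exact: ED.
- move=> x; have [mF bG _] := w x; apply: wder_congr (w x) (mf' x) bG _ _.
    by apply: aeW => t Dt; rewrite ff.
  by apply: aeW => t Dt.
Qed.

Lemma W1B_le k k' n n' c f g : (k' <= k)%N -> (n <= n')%N -> W1B k n c f g -> W1B k' n' c f g.
Proof.
move=> kk nn [[[k2 cB] m d h] [w hg g0]]; split; split=> //.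
- by split; [exact: leq_trans k2|apply: le_trans cB (Bn_le nn)].
- by move=> t Dt; apply: nd_le (d t Dt).
- by move=> t Et; apply: HsB_le (h t Et).
- by move=> t Et; apply: HsB_le (hg t Et).
Qed.

Lemma BnD_le n m : B ^+ n + B ^+ m <= B ^+ (maxn n m).+1.
Proof.
apply: (@le_trans _ _ (B ^+ (maxn n m) + B ^+ (maxn n m))).
  by rewrite lerD // Bn_le // ?leq_maxl ?leq_maxr.
rewrite exprS -mulr2n -mulr_natl ler_wpM2r ?(ltW (Bn0 _)) //.
by apply: le_trans B16; rewrite ler_nat.
Qed.

Lemma W1B_add k n m c d f f' g g' : W1B k n c f g -> W1B k m d f' g' ->
  W1B k (maxn n m).+1 (c + d) (fun t x => f t x + f' t x) (fun t x => g t x + g' t x).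
Proof.
move=> [[[k2 cB] mf df h] [w hg g0]] [[[_ cB'] mf' df' h'] [w' hg' g0']]; split; split=> //.
- split=> //; apply: (le_trans (ler_normD _ _)); apply: le_trans (BnD_le _ _); exact: lerD.
- by move=> x; exact: measurable_funD.
- by move=> t Dt; apply: nd_add; auto.
- by move=> t Et; apply: HsB_ext (HsB_add (h t Et) (h' t Et)) => x; ring.
- by move=> x; exact: wder_add.
- by move=> t Et; exact: HsB_add (hg t Et) (hg' t Et).
- by move=> t x nE; rewrite g0 // g0' // addr0.
Qed.

Lemma W1B_scale k n m a c f g : `|a| <= B ^+ m -> W1B k n c f g ->
  W1B k (m + n) (a * c) (fun t x => a * f t x) (fun t x => a * g t x).
Proof.
move=> aB [[[k2 cB] mf df h] [w hg g0]]; split; split=> //.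
- by split=> //; rewrite normrM -BM; apply: ler_pM.
- by move=> x; exact: measurable_funM.
- by move=> t Dt; apply: nd_scale; auto.
- by move=> t Et; apply: HsB_ext (HsB_scale aB (h t Et)) => x; ring.
- by move=> x; exact: wder_scale.
- by move=> t Et; exact: HsB_scale (hg t Et).
- by move=> t x nE; rewrite g0 // mulr0.
Qed.

Lemma W1B_bound k n c f g t x : W1B k n c f g -> E t -> `|f t x| <= B ^+ n.+2.
Proof.
move=> [[[k2 cB] mf df h] _] Et; rewrite -(subrK c (f t x)).
apply: (le_trans (ler_normD _ _)).
apply: (@le_trans _ _ (B ^+ n.+1 + B ^+ n.+1)).
  by apply: lerD; [apply: HsB_bound (h t Et)|apply: (le_trans cB); exact: Bn_le].
by have := Bn0 n.+1; rewrite [leRHS]exprS; move: (B ^+ n.+1) => b b0; have := B16; nra.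
Qed.

Lemma W1B_dt_bound k n c f g t x : W1B k n c f g -> E t -> `|g t x| <= B ^+ n.+1.
Proof.
move=> [[[k2 cB] mf df h] [w hg g0]] Et; apply: HsB_bound (hg t Et).
exact: leq_trans k2 _.
Qed.

(** The constants c and d account for the terms of the product which do not have two
    factors in the algebra. *)
Lemma W1B_mul k n m c d f f' g g' : W1B k n c f g -> W1B k m d f' g' ->
  W1B k (n + m + 3) (c * d) (fun t x => f t x * f' t x)
    (fun t x => g t x * f' t x + f t x * g' t x).
Proof.
move=> Xf Xf'; move: (Xf) (Xf') => [[[k2 cB] mf df h] [w hg g0]] [[[_ cB'] mf' df' h'] [w' hg' g0']].
have k3 : (k.+1 <= 3)%N by [].
have prod j (u v : R -> R) (a b : nat) (e : R) : (j <= 3)%N -> HsB j a u -> HsB j b (fun x => v x - e) -> `|e| <= B ^+ b ->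
    HsB j (a + b + 2) (fun x => u x * v x).
  move=> j3 hu hv eB; have h1 := HsB_mul j3 hu hv; have h2 := HsB_scale eB hu.
  apply: HsB_le (HsB_ext _ (HsB_add h1 h2)) => //; last by move=> x; ring.
  by lia.
split; split=> //.
- by split=> //; rewrite normrM; apply: (le_trans (ler_pM _ _ cB cB')) => //; rewrite BM Bn_le //; lia.
- by move=> x; exact: measurable_funM.
- by move=> t Dt; apply: nd_mul; auto.
- move=> t Et; have h1 := prod _ _ _ _ _ _ k3 (h t Et) (h' t Et) cB'.
  have h2 := HsB_scale cB (h' t Et).
  by apply: HsB_le (HsB_ext _ (HsB_add h1 h2)) => //; [lia|move=> x; ring].
- move=> x; apply: (wder_mul (w x) (w' x)); last by apply: aeW.
  have [_ [mg _] _] := w x; have [_ [mg' _] _] := w' x.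
  apply: (E_bmf (Z := B ^+ n.+1 * B ^+ m.+2 + B ^+ n.+2 * B ^+ m.+1)).
  + by apply: measurable_funD; apply: measurable_funM => //; exact: measurable_funTS.
  + move=> t Et; apply: (le_trans (ler_normD _ _)); rewrite !normrM; apply: lerD; apply: ler_pM => //.
    * exact: W1B_dt_bound Xf Et.
    * exact: W1B_bound Xf' Et.
    * exact: W1B_bound Xf Et.
    * exact: W1B_dt_bound Xf' Et.
  + by move=> t nE; rewrite g0 // g0' // mul0r mulr0 addr0.
- move=> t Et; have k3' : (k <= 3)%N by exact: leq_trans k2 _.
  have h1 := prod _ _ _ _ _ _ k3' (hg t Et) (HsB_le (leqnSn k) (leqnn _) (h' t Et)) cB'.
  have h2 := prod _ _ _ _ _ _ k3' (hg' t Et) (HsB_le (leqnSn k) (leqnn _) (h t Et)) cB.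
  by apply: HsB_le (HsB_ext _ (HsB_add h1 h2)) => //; [lia|move=> x; ring].
- by move=> t x nE; rewrite g0 // g0' // mulr0 mul0r addr0.
Qed.

(** Derivatives in time and space commute because the difference quotients of f in
    space have weak derivatives which are bounded uniformly in the step. *)
Lemma W1B_dx k n c f g : W1B k.+1 n c f g -> W1B k n 0 (dx f) (dx g).
Proof.
move=> Xf; move: (Xf) => [[[k2 cB] mf df h] [w hg g0]].
have derf t : D t -> der (f t) (dx f t) by move=> Dt; have [] := ndP (df t Dt).
have derg t : E t -> der (g t) (dx g t) /\ HsB k n (dx g t) by move=> Et; exact: HsB_deriv (hg t Et).
have gE t : ~ E t -> g t = (fun _ => 0) by move=> nE; apply/funext => x; exact: g0.
have dg0 t x : ~ E t -> dx g t x = 0.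
  by move=> nE; rewrite /dx gE // (derE (der_cst 0)).
have derg' t : der (g t) (dx g t).
  have [/derg[]//|nE] := pselect (E t).
  apply: der_ext (der_cst 0) => x; first by rewrite g0.
  by rewrite dg0.
have wq x N : wder T (fun t => dquot (f t) x N) (fun t => dquot (g t) x N).
  apply: wder_scale; have h1 := wder_add (w (x + N.+1%:R^-1)) (wder_scale (-1) (w x)).
  have := h1; rewrite (_ : (fun t => _ + -1 * f t x) = (fun t => f t (x + N.+1%:R^-1) - f t x)); last first.
    by apply/funext => t; rewrite mulN1r.
  rewrite (_ : (fun t => _ + -1 * g t x) = (fun t => g t (x + N.+1%:R^-1) - g t x)) //.
  by apply/funext => t; rewrite mulN1r.
have bq t x N : `|dquot (g t) x N| <= B ^+ n.+1.
  have [Et|nE] := pselect (E t).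
    have [d1 d2] := derg t Et; apply: (dquot_le _ _ d1) => y; apply: HsB_bound d2.
    exact: leq_trans (leqW k2).
  by rewrite /dquot gE // subr0 mulr0 normr0 ltW // Bn0.
have mdx x : measurable_fun D (dx f ^~ x).
  apply: (measurable_fun_cvg (h := fun N t => dquot (f t) x N)) => [N|t Dt]; first by case: (wq x N).
  exact: dquot_cvg (derf t Dt).
split; split=> //.
- by split; [exact: ltnW|rewrite normr0 ltW // Bn0].
- by move=> t Dt; have [] := ndP (df t Dt).
- move=> t Et; have [d1 d2] := HsB_deriv (h t Et).
  apply: HsB_ext d2 => x; rewrite subr0 (_ : dx f t = derive1 (fun x => f t x - c)) //.
  apply/esym/derE; apply: der_ext (der_add (derf t (ED Et)) (der_cst (- c))) => // y.
  by rewrite addr0.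
- move=> x; apply: (wder_lim T0 (wq x) (fun N t => bq t x N) (mdx x)).
  + split; last first.
      exists (B ^+ n.+1) => t; have [Et|nE] := pselect (E t).
        by apply: (HsB_bound _ _ (derg t Et).2); exact: leq_trans (leqW k2).
      by rewrite dg0 // normr0 ltW // Bn0.
    apply: (measurable_fun_cvg (h := fun N t => dquot (g t) x N)) => [N|t _].
      by case: (wq x N) => _ [].
    exact: dquot_cvg (derg' t).
  + by move=> t Dt; exact: dquot_cvg (derf t Dt).
  + by apply: aeW => t Dt; exact: dquot_cvg (derg' t).
- by move=> t Et; case: (derg t Et).
Qed.

(** [Hs_ball_inv1B] gives the size of the reciprocal at the times of E.  The lower
    bound h makes it differentiable in space at all times and measurable in time. *)
Lemma W1B_inv n m (h : R) (y : R -> R -> R) g : W1B 2 n 0 y g -> 0 < h ->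
  (forall t x, D t -> h <= 1 - y t x) -> (3 <= m)%N ->
  (forall t, E t -> HsB 3 0 (fun x => B ^+ m * y t x)) ->
  W1B 2 (n + 6) 1 (fun t x => (1 - y t x)^-1) (fun t x => g t x * (1 - y t x)^-1 ^+ 2).
Proof.
move=> Xy h0 hy m3 hE; move: (Xy) => [[_ my dy hy3] [w hg g0]].
have hi t : E t -> HsB 3 0 (fun x => (1 - y t x)^-1 - 1) by move=> Et; exact: HsB_inv (hE t Et) m3.
have mi x : measurable_fun D (fun t => (1 - y t x)^-1).
  have mm : measurable_fun [set: R] (fun z : R => (Num.max z h)^-1).
    apply: continuous_measurable_fun => z; apply: cvgV.
      by rewrite gt_eqF // lt_max h0 orbT.
    by apply: continuous_max; [exact: cvg_id|exact: cvg_cst].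
  have m1 : measurable_fun D (fun t => 1 - y t x) by exact: measurable_funB.
  apply: eq_measurable_fun (measurableT_comp mm m1) => t; rewrite inE => Dt /=.
  by rewrite max_l // hy.
have n0 t x : D t -> 1 - y t x != 0 by move=> Dt; rewrite gt_eqF // (lt_le_trans h0) // hy.
have bi t x : E t -> `|(1 - y t x)^-1| <= B ^+ 2.
  move=> Et; rewrite -[(_)^-1](subrK 1); apply: (le_trans (ler_normD _ _)).
  rewrite normr1; have := HsB_bound x (leqnn 3) (hi t Et).
  by rewrite expr1 expr2; have := B16; nra.
split; split.
- by split; [|rewrite normr1 exprn_ege1 // B1].
- exact: mi.
- move=> t Dt; apply: nd_inv; first by move=> x; exact: n0 Dt.
  apply: nd_add; first exact: nd_cst.
  by apply: nd_ext (nd_scale (-1) (dy t Dt)) => x; rewrite mulN1r.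
- by move=> t Et; apply: (HsB_le (leqnn 3) (leq0n _) (hi t Et)).
- move=> x; have [_ [mg _] _] := w x.
  apply: (@wder_inv _ _ T0 (fun t => 1 - y t x) (fun t => - g t x) _ h h0) => //.
  + have := wder_add (wder_cst T 1) (wder_scale (-1) (w x)).
    rewrite (_ : (fun t => 1 + -1 * y t x) = (fun t => 1 - y t x)); last by apply/funext => t; rewrite mulN1r.
    rewrite (_ : (fun t => 0 + -1 * g t x) = (fun t => - g t x)) //.
    by apply/funext => t; rewrite add0r mulN1r.
  + by apply: aeW => t Dt; exact: hy.
  + apply: (E_bmf (Z := B ^+ n.+1 * B ^+ 2 ^+ 2)).
    * by apply: measurable_funM; [exact: measurable_funTS|exact: measurable_funX].
    * move=> t Et; rewrite normrM normrX; apply: ler_pM => //; first exact: W1B_dt_bound Xy Et.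
      by rewrite ler_pXn2r ?nnegrE ?(ltW (Bn0 _)) //; exact: bi.
    * by move=> t nE; rewrite g0 // mul0r.
  + by apply: aeW => t Dt; rewrite opprK.
- move=> t Et; have hi2 := HsB_le (leqnSn 2) (leqnn 0) (hi t Et).
  have st u a : HsB 2 a u -> HsB 2 (a + 2) (fun x => u x * (1 - y t x)^-1).
    move=> hu; have k3 : (2 <= 3)%N by [].
    have h1 := HsB_add (HsB_mul k3 hu hi2) hu.
    by apply: HsB_le (HsB_ext _ h1) => //; [lia|move=> x; ring].
  apply: HsB_le (HsB_ext _ (st _ _ (st _ _ (hg t Et)))) => //; first by lia.
  by move=> x; rewrite expr2 mulrA.
- by move=> t x nE; rewrite g0 // mul0r.
Qed.

(** Where only the size matters, the limit at infinity and the time derivative are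
    left implicit. *)
Definition inW1B k n f : Prop := exists c g, W1B k n c f g.

Lemma inW1B_eqD k n f f' : (forall t x, D t -> f t x = f' t x) -> inW1B k n f -> inW1B k n f'.
Proof. by move=> ff [c [g h]]; exists c, g; exact: W1B_eqD ff h. Qed.

Lemma inW1B_le k k' n n' f : (k' <= k)%N -> (n <= n')%N -> inW1B k n f -> inW1B k' n' f.
Proof. by move=> kk nn [c [g h]]; exists c, g; exact: W1B_le kk nn h. Qed.

Lemma inW1B_cst k n c : (k <= 2)%N -> `|c| <= B ^+ n -> inW1B k n (fun _ _ => c).
Proof. by move=> k2 cB; exists c, (fun _ _ => 0); exact: W1B_cst. Qed.

Lemma inW1B_add k n m f f' : inW1B k n f -> inW1B k m f' -> inW1B k (maxn n m).+1 (fun t x => f t x + f' t x).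
Proof. by move=> [c [g h]] [c' [g' h']]; exists (c + c'), (fun t x => g t x + g' t x); exact: W1B_add. Qed.

Lemma inW1B_scale k n m a f : `|a| <= B ^+ m -> inW1B k n f -> inW1B k (m + n) (fun t x => a * f t x).
Proof. by move=> aB [c [g h]]; exists (a * c), (fun t x => a * g t x); exact: W1B_scale. Qed.

Lemma inW1B_mul k n m f f' : inW1B k n f -> inW1B k m f' -> inW1B k (n + m + 3) (fun t x => f t x * f' t x).
Proof. by move=> [c [g h]] [c' [g' h']]; do 2!eexists; exact: W1B_mul h h'. Qed.

Lemma inW1B_dx k n f : inW1B k.+1 n f -> inW1B k n (dx f).
Proof. by move=> [c [g h]]; do 2!eexists; exact: W1B_dx h. Qed.

Lemma inW1B_nd k n f t : inW1B k n f -> D t -> nd k.+1 (f t).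
Proof. by move=> [c [g [[_ _ h _] _]]]; exact: h. Qed.

Lemma inW1B_der k n f t : inW1B k n f -> D t -> der (f t) (dx f t).
Proof. by move=> h Dt; have [] := ndP (inW1B_nd h Dt). Qed.

Variable e : R.
Hypothesis eB : `|e| <= B.

Lemma e1B : `|e| <= B ^+ 1. Proof. by rewrite expr1. Qed.
Lemma e2B : `|e ^+ 2| <= B ^+ 2.
Proof. by rewrite normrX ler_pXn2r ?nnegrE ?(ltW B0). Qed.

(** First-order expansions in e whose second-order remainder is in the same class
    as the coefficients, uniformly in e. *)
Definition jet k n (f f0 f1 : R -> R -> R) : Prop :=
  [/\ inW1B k n f0, inW1B k n f1 & exists2 f2, inW1B k n f2 &
    forall t x, D t -> f t x = f0 t x + e * f1 t x + e ^+ 2 * f2 t x].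

Lemma jet_eqD k n f f' f0 f0' f1 f1' : (forall t x, D t -> f t x = f' t x) ->
  (forall t x, D t -> f0 t x = f0' t x) -> (forall t x, D t -> f1 t x = f1' t x) ->
  jet k n f f0 f1 -> jet k n f' f0' f1'.
Proof.
move=> ff ff0 ff1 [h0 h1 [f2 h2 E2]]; split; [exact: inW1B_eqD h0|exact: inW1B_eqD h1|].
by exists f2 => // t x Dt; rewrite -ff // -ff0 // -ff1 // E2.
Qed.

Lemma jet_le k k' n n' f f0 f1 : (k' <= k)%N -> (n <= n')%N -> jet k n f f0 f1 -> jet k' n' f f0 f1.
Proof.
move=> kk nn [h0 h1 [f2 h2 E2]]; split; [exact: inW1B_le h0|exact: inW1B_le h1|].
by exists f2 => //; exact: inW1B_le h2.
Qed.

Lemma jet_cst k n f : inW1B k n f -> jet k n f f (fun _ _ => 0).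
Proof.
move=> h; have [c [g [[[k2 _] _ _ _] _]]] := h.
have z : inW1B k n (fun _ _ => 0) by apply: inW1B_cst => //; rewrite normr0 ltW // Bn0.
by split=> //; exists (fun _ _ => 0) => // t x _; ring.
Qed.

Lemma jet_add k n m f f0 f1 f' f0' f1' : jet k n f f0 f1 -> jet k m f' f0' f1' ->
  jet k (maxn n m).+1 (fun t x => f t x + f' t x) (fun t x => f0 t x + f0' t x)
    (fun t x => f1 t x + f1' t x).
Proof.
move=> [h0 h1 [f2 h2 E2]] [h0' h1' [f2' h2' E2']].
split; [exact: inW1B_add|exact: inW1B_add|].
by exists (fun t x => f2 t x + f2' t x); [exact: inW1B_add|move=> t x Dt; rewrite E2 // E2' //; ring].
Qed.

Lemma jet_scale k n m a f f0 f1 : `|a| <= B ^+ m -> jet k n f f0 f1 ->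
  jet k (m + n) (fun t x => a * f t x) (fun t x => a * f0 t x) (fun t x => a * f1 t x).
Proof.
move=> aB [h0 h1 [f2 h2 E2]]; split; [exact: inW1B_scale|exact: inW1B_scale|].
by exists (fun t x => a * f2 t x); [exact: inW1B_scale|move=> t x Dt; rewrite E2 //; ring].
Qed.

Lemma jet_mul k n m f f0 f1 f' f0' f1' : jet k n f f0 f1 -> jet k m f' f0' f1' ->
  jet k (n + m + 8) (fun t x => f t x * f' t x) (fun t x => f0 t x * f0' t x)
    (fun t x => f0 t x * f1' t x + f1 t x * f0' t x).
Proof.
move=> [h0 h1 [f2 h2 E2]] [h0' h1' [f2' h2' E2']].
have M u v : inW1B k n u -> inW1B k m v -> inW1B k (n + m + 3) (fun t x => u t x * v t x) by exact: inW1B_mul.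
have A j u v : inW1B k j u -> inW1B k j v -> inW1B k j.+1 (fun t x => u t x + v t x).
  by move=> hu hv; have := inW1B_add hu hv; rewrite maxnn.
split.
- by apply: inW1B_le (M _ _ h0 h0') => //; lia.
- by apply: inW1B_le (A _ _ _ (M _ _ h0 h1') (M _ _ h1 h0')) => //; lia.
exists (fun t x => f0 t x * f2' t x + f1 t x * f1' t x + f2 t x * f0' t x
  + (e * (f1 t x * f2' t x + f2 t x * f1' t x) + e ^+ 2 * (f2 t x * f2' t x))); last first.
  by move=> t x Dt; rewrite E2 // E2' //; ring.
have a1 := inW1B_le (leqnn k) (leqnSn _) (A _ _ _ (M _ _ h0 h2') (M _ _ h1 h1')).
have a2 := A _ _ _ a1 (inW1B_le (leqnn k) (leqnSn _) (inW1B_le (leqnn k) (leqnSn _) (M _ _ h2 h0'))).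
have a3 := inW1B_scale e1B (A _ _ _ (M _ _ h1 h2') (M _ _ h2 h1')).
have a4 := inW1B_scale e2B (M _ _ h2 h2').
have le1 : ((n + m + 3).+3 <= n + m + 6)%N by lia.
have le3 : (1 + (n + m + 3).+1 <= n + m + 6)%N by lia.
have le4 : (2 + (n + m + 3) <= n + m + 6)%N by lia.
have a34 := A _ _ _ (inW1B_le (leqnn k) le3 a3) (inW1B_le (leqnn k) le4 a4).
apply: inW1B_le (A _ _ _ (inW1B_le (leqnn k) (leqW le1) a2) a34) => //; first by lia.
Qed.

Lemma jet_dx k n f f0 f1 : jet k.+1 n f f0 f1 -> jet k n (dx f) (dx f0) (dx f1).
Proof.
move=> [h0 h1 [f2 h2 E2]]; split; [exact: inW1B_dx|exact: inW1B_dx|].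
exists (dx f2); first exact: inW1B_dx.
move=> t x Dt; rewrite {1}/dx (_ : f t = fun x => f0 t x + e * f1 t x + e ^+ 2 * f2 t x).
  by rewrite (derE (der_add (der_add (inW1B_der h0 Dt) (der_scale e (inW1B_der h1 Dt))) (der_scale _ (inW1B_der h2 Dt)))).
by apply/funext => y; exact: E2.
Qed.

Lemma der_to f f' g' : der f f' -> (forall x : R, f' x = g' x) -> der f g'.
Proof. by move=> hf /funext <-. Qed.

Lemma der_sq (f f' : R -> R) : der f f' -> der (fun x => f x ^+ 2) (fun x => 2 * f x * f' x).
Proof. by move=> d; apply: der_ext (der_mul d d) => x; ring. Qed.

(** Differentiates a polynomial expression in functions whose derivatives are given
    in the context. *)
Ltac derive_tac := first
  [ match goal with |- der (fun _ => ?k) _ => exact (der_cst k) end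
  | lazymatch goal with
    | |- der (fun x => GRing.add (@?f x) (@?g x)) _ => eapply (@der_add _ f g); [derive_tac|derive_tac]
    | |- der (fun x => GRing.opp (@?f x)) _ => eapply (@der_opp _ f); derive_tac
    | |- der (fun x => GRing.mul (@?f x) (@?g x)) _ => eapply (@der_mul _ f g); [derive_tac|derive_tac]
    | |- der (fun x => GRing.exp (@?f x) _) _ => eapply (@der_sq f); derive_tac
    | |- der (fun x => ?f x) _ => match goal with Hd : der f _ |- _ => exact Hd end
    end ].

Lemma jet_opp k n f f0 f1 : jet k n f f0 f1 ->
  jet k n.+1 (fun t x => - f t x) (fun t x => - f0 t x) (fun t x => - f1 t x).
Proof.
move=> h; have h1 : `|-1 : R| <= B ^+ 1 by rewrite normrN normr1 expr1 B1.
by apply: jet_eqD (jet_scale h1 h) => t x _; rewrite mulN1r.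
Qed.

Lemma dxE (f : R -> R -> R) f' t x : der (f t) f' -> dx f t x = f' x.
Proof. by rewrite /dx => /derE ->. Qed.

(** * Expansion of the Green-Naghdi operators *)

Variables (p : param R) (ul ur gl gr : R -> R -> R) (h : R).
Local Notation mu := (mu_of p).
Local Notation delta := (delta_of p).
Local Notation gamma := (gamma_of p).
Local Notation tau := (gamma + delta).
Local Notation a := (delta * (1 - gamma) / tau).
Local Notation z := (fun t x => ul t x + ur t x).
Local Notation W := (fun t x => ul t x - ur t x).
Local Notation v := (fun t x => tau * (ul t x - ur t x)).
Local Notation H1 := (h1 p z).
Local Notation H2 := (h2 p z).
Hypotheses (ee : eps_of p = e) (e0 : 0 <= e) (eS : e * B ^+ 10 <= 1).
Hypotheses (d0 : 0 < delta) (dB : delta <= B) (diB : delta^-1 <= B).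
Hypotheses (g0 : 0 <= gamma) (g1 : gamma < 1).
Hypotheses (Xl : W1B 2 1 0 ul gl) (Xr : W1B 2 1 0 ur gr).
Hypotheses (h0 : 0 < h) (hH1 : forall t x, D t -> h <= H1 t x) (hH2 : forall t x, D t -> h <= H2 t x).

Lemma tau0 : 0 < tau. Proof. exact: ltr_wpDl d0. Qed.
Lemma tauB : `|tau| <= B ^+ 2.
Proof. by rewrite ger0_norm ?(ltW tau0) // expr2; have := B16; have := dB; have := g1; nra. Qed.
Lemma tauiB : `|tau^-1| <= B ^+ 1.
Proof.
rewrite expr1 ger0_norm ?invr_ge0 ?(ltW tau0) //; apply: le_trans diB.
by rewrite lef_pV2 ?posrE ?tau0 // lerDr.
Qed.
Lemma a_ge0 : 0 <= a.
Proof. by rewrite divr_ge0 ?(ltW tau0) // mulr_ge0 ?(ltW d0) // subr_ge0 ltW. Qed.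
Lemma a_le1 : a <= 1.
Proof. by rewrite ler_pdivrMr ?tau0 // mul1r; have := d0; have := g0; nra. Qed.
Lemma aB : `|a| <= B ^+ 0.
Proof. by rewrite expr0 ger0_norm ?a_ge0 ?a_le1. Qed.
Lemma dltB : `|delta| <= B ^+ 1.
Proof. by rewrite expr1 ger0_norm ?(ltW d0). Qed.
Lemma dltiB : `|delta^-1| <= B ^+ 1.
Proof. by rewrite expr1 ger0_norm ?invr_ge0 ?(ltW d0). Qed.
Lemma gB : `|gamma| <= B ^+ 0.
Proof. by rewrite expr0 ger0_norm ?(ltW g1). Qed.

Lemma inW1B_ul : inW1B 2 1 ul. Proof. by exists 0, gl. Qed.
Lemma inW1B_ur : inW1B 2 1 ur. Proof. by exists 0, gr. Qed.
Lemma N1B : `|-1 : R| <= B ^+ 0. Proof. by rewrite normrN normr1. Qed.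
Lemma W1B_zeta : W1B 2 2 0 z (fun t x => gl t x + gr t x).
Proof. by have := W1B_add Xl Xr; rewrite addr0. Qed.
Lemma W1B_W : W1B 2 2 0 W (fun t x => gl t x - gr t x).
Proof.
have := W1B_add Xl (W1B_scale N1B Xr); rewrite mulr0 addr0.
rewrite (_ : (fun t x => gl t x + -1 * gr t x) = (fun t x => gl t x - gr t x)).
  by apply: W1B_eqD => t x _; rewrite mulN1r.
by apply/funext => t; apply/funext => x; rewrite mulN1r.
Qed.
Lemma inW1B_zeta : inW1B 2 2 z. Proof. by do 2!eexists; exact: W1B_zeta. Qed.
Lemma inW1B_W : inW1B 2 2 W. Proof. by do 2!eexists; exact: W1B_W. Qed.
Lemma inW1B_v : inW1B 2 4 v. Proof. exact: inW1B_scale tauB inW1B_W. Qed.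

(** e z is small in H^(s+3) because e B^10 is at most 1. *)
Lemma inW1B_inv (b k : R) : `|b| <= B -> 0 < k -> (forall t x, D t -> k <= 1 - e * b * z t x) ->
  inW1B 2 10 (fun t x => (1 - e * b * z t x)^-1).
Proof.
move=> bB k0 Hk.
have ebB : `|e * b| <= B ^+ 2.
  by rewrite normrM expr2; apply: ler_pM.
have hy := W1B_scale ebB W1B_zeta; rewrite mulr0 in hy.
have hE t : E t -> HsB 3 0 (fun x => B ^+ 3 * (e * b * z t x)).
  move=> Et; have [[_ _ _ /(_ t Et) hz] _] := W1B_zeta.
  have c : `|B ^+ 3 * (e * b)| <= B ^- 2.
    rewrite (normrM (B ^+ 3)) (normrM e) (ger0_norm e0) (ger0_norm (ltW (Bn0 3))).
    rewrite -[leRHS]mul1r ler_pdivlMr ?Bn0 //; apply: le_trans eS.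
    apply: (@le_trans _ _ (B ^+ 3 * (e * B) * B ^+ 2)).
      by rewrite ler_pM2r ?Bn0 // ler_pM2l ?Bn0 // ler_wpM2l.
    rewrite (_ : _ * _ = e * B ^+ 6); last by rewrite -[in RHS](BM 3 3) -(BM 1 2) expr1; ring.
    by rewrite ler_wpM2l // Bn_le.
  have Bi0 : 0 < B ^- 2 by rewrite invr_gt0 Bn0.
  have := Hs_ball_scale (sk2 3) Bi0 c hz.
  rewrite mulVf ?gt_eqF ?Bn0 // => hh.
  by rewrite /HsB expr0; apply: Hs_ball_ext hh => x; rewrite subr0; ring.
by do 2!eexists; exact: (W1B_inv hy k0 Hk (leqnn 3) hE).
Qed.

(** 1 / (1 - y) = 1 + y + y^2 / (1 - y). *)
Lemma jet_inv (b k : R) : `|b| <= B -> 0 < k -> (forall t x, D t -> k <= 1 - e * b * z t x) ->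
  jet 2 24 (fun t x => (1 - e * b * z t x)^-1) (fun _ _ => 1) (fun t x => b * z t x).
Proof.
move=> bB k0 Hk; have hi := inW1B_inv bB k0 Hk.
have bB1 : `|b| <= B ^+ 1 by rewrite expr1.
have hbz := inW1B_scale bB1 inW1B_zeta.
split.
- by apply: inW1B_cst => //; rewrite normr1 exprn_ege1 // B1.
- exact: inW1B_le hbz.
exists (fun t x => (b * z t x) * (b * z t x) * (1 - e * b * z t x)^-1).
  by apply: inW1B_le (inW1B_mul (inW1B_mul hbz hbz) hi).
move=> t x Dt; have n0 : 1 - e * b * z t x != 0 by rewrite gt_eqF // (lt_le_trans k0) // Hk.
by move: (z t x) n0 => y n0; field.
Qed.

Lemma jet_H1 : jet 2 4 H1 (fun _ _ => 1) (fun t x => - z t x).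
Proof.
have k1 : inW1B 2 4 (fun _ _ : R => 1 : R) by apply: inW1B_cst => //; rewrite normr1 exprn_ege1 // B1.
have k2 : inW1B 2 4 (fun t x => -1 * z t x) by apply: inW1B_le (inW1B_scale N1B inW1B_zeta).
split=> //; first by apply: inW1B_eqD k2 => t x _; rewrite mulN1r.
exists (fun _ _ => 0); first by apply: inW1B_cst => //; rewrite normr0 ltW // Bn0.
by move=> t x _; rewrite /h1 ee; ring.
Qed.

Lemma jet_H2 : jet 2 4 H2 (fun _ _ => delta^-1) z.
Proof.
have k1 : inW1B 2 4 (fun _ _ : R => delta^-1 : R) by apply: inW1B_cst => //; apply: le_trans dltiB (Bn_le _).
split=> //; first exact: inW1B_le inW1B_zeta.
exists (fun _ _ => 0); first by apply: inW1B_cst => //; rewrite normr0 ltW // Bn0.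
by move=> t x _; rewrite /h2 ee; ring.
Qed.

(** h1 + gamma h2 = (tau / delta) (1 - a e z), with a = delta (1 - gamma) / tau. *)
Lemma jet_denV : jet 2 26 (fun t x => (H1 t x + gamma * H2 t x)^-1)
  (fun _ _ => delta / tau) (fun t x => delta / tau * (a * z t x)).
Proof.
have tn : tau != 0 by rewrite gt_eqF // tau0.
have dn : delta != 0 by rewrite gt_eqF.
have aB' : `|a| <= B by apply: le_trans aB _; rewrite expr0 B1.
have fE t x : H1 t x + gamma * H2 t x = tau / delta * (1 - e * a * z t x).
  by rewrite /h1 /h2 ee; field; rewrite tn.
have k0 : 0 < h / (tau / delta) by rewrite !divr_gt0 // tau0.
have Hk t x : D t -> h / (tau / delta) <= 1 - e * a * z t x.
  move=> Dt; rewrite ler_pdivrMr ?divr_gt0 ?tau0 // mulrC -fE.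
  apply: ler_wpDr (hH1 x Dt); rewrite mulr_ge0 // (le_trans (ltW h0)) //; exact: hH2.
have cB : `|delta / tau| <= B ^+ 2 by rewrite normrM expr2; apply: ler_pM => //; [have := dltB|have := tauiB]; rewrite expr1.
apply: jet_eqD (jet_scale cB (jet_inv aB' k0 Hk)) => t x _ //.
  by rewrite fE invfM invf_div.
by rewrite mulr1.
Qed.

Lemma jet_H1V : jet 2 26 (fun t x => (H1 t x)^-1) (fun _ _ => 1) z.
Proof.
have B1' : `|1 : R| <= B by rewrite normr1 B1.
have Hk t x : D t -> h <= 1 - e * 1 * z t x by move=> Dt; have := hH1 x Dt; rewrite /h1 ee mulr1.
apply: jet_eqD (jet_le (leqnn _) _ (jet_inv B1' h0 Hk)) => // t x _; first by rewrite /h1 ee mulr1.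
by rewrite mul1r.
Qed.

Lemma jet_H2V : jet 2 26 (fun t x => (H2 t x)^-1) (fun _ _ => delta) (fun t x => - delta ^+ 2 * z t x).
Proof.
have dn : delta != 0 by rewrite gt_eqF.
have bB : `|- delta| <= B by rewrite normrN; have := dltB; rewrite expr1.
have fE t x : H2 t x = delta^-1 * (1 - e * (- delta) * z t x).
  by rewrite /h2 ee; field.
have k0 : 0 < h * delta by rewrite mulr_gt0.
have Hk t x : D t -> h * delta <= 1 - e * (- delta) * z t x.
  move=> Dt; have := hH2 x Dt; rewrite fE mulrC => hh.
  by rewrite -ler_pdivlMr // mulrC.
apply: jet_eqD (jet_le (leqnn _) _ (jet_scale dltB (jet_inv bB k0 Hk))) => // t x _.
- by rewrite fE invfM invrK.
- by rewrite mulr1.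
- by ring.
Qed.

Lemma jet_v : jet 2 4 v v (fun _ _ => 0). Proof. exact: jet_cst inW1B_v. Qed.

Lemma jet_exp3 k n f f0 f1 : jet k n f f0 f1 ->
  jet k (n + (n + n + 8) + 8) (fun t x => f t x ^+ 3) (fun t x => f0 t x ^+ 3)
   (fun t x => 3 * f0 t x ^+ 2 * f1 t x).
Proof. by move=> hj; apply: jet_eqD (jet_mul hj (jet_mul hj hj)) => t x _; ring. Qed.

Lemma jet_exp2 k n f f0 f1 : jet k n f f0 f1 ->
  jet k (n + n + 8) (fun t x => f t x ^+ 2) (fun t x => f0 t x ^+ 2)
   (fun t x => 2 * f0 t x * f1 t x).
Proof. by move=> hj; apply: jet_eqD (jet_mul hj hj) => t x _; ring. Qed.

(** [Af] and [Bf] are the mean velocities of the two layers, up to sign, whose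
    derivatives enter the two dispersive operators. *)
Definition Af := fun t x => H1 t x * v t x / (H1 t x + gamma * H2 t x).
Definition Bf := fun t x => H2 t x * v t x / (H1 t x + gamma * H2 t x).

Lemma jet_Af : jet 2 60 Af (fun t x => delta * W t x) (fun t x => delta * (a - 1) * (z t x * W t x)).
Proof.
have tn : tau != 0 by rewrite gt_eqF // tau0.
apply: jet_le (jet_eqD _ _ _ (jet_mul (jet_mul jet_H1 jet_v) jet_denV)) => // t x _; by field.
Qed.

Lemma jet_Bf : jet 2 60 Bf W (fun t x => (a + delta) * (z t x * W t x)).
Proof.
have tn : tau != 0 by rewrite gt_eqF // tau0.
have dn : delta != 0 by rewrite gt_eqF.
apply: jet_le (jet_eqD _ _ _ (jet_mul (jet_mul jet_H2 jet_v) jet_denV)) => // t x _; field; by rewrite ?tn ?dn.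
Qed.

Lemma Wder t : D t -> [/\ der (ul t) (dx ul t), der (dx ul t) (dx (dx ul) t),
  der (ur t) (dx ur t) & der (dx ur t) (dx (dx ur) t)].
Proof.
move=> Dt; split.
- exact: inW1B_der inW1B_ul Dt.
- exact: inW1B_der (inW1B_dx inW1B_ul) Dt.
- exact: inW1B_der inW1B_ur Dt.
- exact: inW1B_der (inW1B_dx inW1B_ur) Dt.
Qed.

Definition Wx := fun t x => dx ul t x - dx ur t x.
Definition Wxx := fun t x => dx (dx ul) t x - dx (dx ur) t x.
Definition zx := fun t x => dx ul t x + dx ur t x.
Definition zxx := fun t x => dx (dx ul) t x + dx (dx ur) t x.

Ltac der_start Dt :=
  let d1 := fresh in let d2 := fresh in let d3 := fresh in let d4 := fresh in
  have [d1 d2 d3 d4] := Wder Dt.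

(** Algebraic identities are proved on variables: comparing the derivatives of u_l
    and u_r with each other by conversion would be very costly. *)
Ltac gen_atoms t x :=
  generalize (dx (dx ul) t x), (dx (dx ur) t x), (dx ul t x), (dx ur t x), (ul t x), (ur t x);
  intros.

Ltac rewrite_atom d := match type of d with ?u = _ => revert d; generalize u; intros ? -> end.

Lemma jet_dxE k n f f0 f1 f0' f1' : jet k.+1 n f f0 f1 ->
  (forall t, D t -> der (f0 t) (f0' t)) -> (forall t, D t -> der (f1 t) (f1' t)) ->
  jet k n (dx f) f0' f1'.
Proof.
move=> hj d0' d1'; apply: jet_eqD (jet_dx hj) => // t x Dt; [exact: dxE (d0' t Dt)|exact: dxE (d1' t Dt)].
Qed.

Lemma jet_dx_Af : jet 1 60 (dx Af) (fun t x => delta * Wx t x)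
  (fun t x => delta * (a - 1) * (zx t x * W t x + z t x * Wx t x)).
Proof.
apply: jet_dxE jet_Af _ _ => t Dt; der_start Dt.
  by eapply der_to; [cbv beta delta [Wx zx]; derive_tac|move=> x; rewrite /Wx; gen_atoms t x; ring].
by eapply der_to; [cbv beta delta [Wx zx]; derive_tac|move=> x; rewrite /Wx /zx; gen_atoms t x; ring].
Qed.

Lemma jet_dx_Bf : jet 1 60 (dx Bf) Wx (fun t x => (a + delta) * (zx t x * W t x + z t x * Wx t x)).
Proof.
apply: jet_dxE jet_Bf _ _ => t Dt; der_start Dt.
  by eapply der_to; [cbv beta delta [Wx zx]; derive_tac|move=> x; rewrite /Wx; gen_atoms t x; ring].
by eapply der_to; [cbv beta delta [Wx zx]; derive_tac|move=> x; rewrite /Wx /zx; gen_atoms t x; ring].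
Qed.

(** The second-order expressions shared by the two dispersive operators. *)
Definition PA := dx (fun t x => H2 t x ^+ 3 * dx Af t x).
Definition PB := dx (fun t x => H1 t x ^+ 3 * dx Bf t x).
Definition S2 := fun t x => zxx t x * W t x + 2 * zx t x * Wx t x + z t x * Wxx t x.

Lemma jet_PA : jet 0 96 PA (fun t x => delta^-1 ^+ 2 * Wxx t x)
  (fun t x => delta^-1 ^+ 2 * (a - 1) * S2 t x + 3 * delta^-1 * (zx t x * Wx t x + z t x * Wxx t x)).
Proof.
have dn : delta != 0 by rewrite gt_eqF.
have tn : tau != 0 by rewrite gt_eqF // tau0.
have hj := jet_le (leqnn _) (_ : (_ <= 96)%N) (jet_mul (jet_le (leqnSn 1) (leqnn _) (jet_exp3 jet_H2)) jet_dx_Af).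
apply: jet_dxE (hj isT) _ _ => t Dt; der_start Dt.
  by eapply der_to; [cbv beta delta [Wx zx]; derive_tac|move=> x; rewrite /Wx /Wxx; gen_atoms t x; field].
by eapply der_to; [cbv beta delta [Wx zx]; derive_tac|move=> x; rewrite /S2 /Wx /Wxx /zx /zxx; gen_atoms t x; field; rewrite ?tn ?dn].
Qed.

Lemma jet_PB : jet 0 96 PB Wxx
  (fun t x => (a + delta) * S2 t x - 3 * (zx t x * Wx t x + z t x * Wxx t x)).
Proof.
have dn : delta != 0 by rewrite gt_eqF.
have hj := jet_le (leqnn _) (_ : (_ <= 96)%N) (jet_mul (jet_le (leqnSn 1) (leqnn _) (jet_exp3 jet_H1)) jet_dx_Bf).
apply: jet_dxE (hj isT) _ _ => t Dt; der_start Dt.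
  by eapply der_to; [cbv beta delta [Wx zx]; derive_tac|move=> x; rewrite /Wx /Wxx; gen_atoms t x; ring].
by eapply der_to; [cbv beta delta [Wx zx]; derive_tac|move=> x; rewrite /S2 /Wx /Wxx /zx /zxx; gen_atoms t x; ring].
Qed.

(** The quantity under the time derivative in the equation of u_l; the one in the
    equation of u_r is its opposite. *)
Definition kappa_term := fun t x =>
    kappa1 p * (ul t x * dx (dx ul) t x - ur t x * dx (dx ur) t x)
    + kappa2 p * (ur t x * dx (dx ul) t x - ul t x * dx (dx ur) t x)
    + (kappa1 p + kappa2 p / 2) * (dx ul t x ^+ 2 - dx ur t x ^+ 2).

Lemma Hn0 t x : D t -> H1 t x != 0 /\ H2 t x != 0.
Proof. by move=> Dt; split; rewrite gt_eqF // (lt_le_trans h0) //; [exact: hH1|exact: hH2]. Qed.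

(** The definitions of nu, kappa_1 and kappa_2 amount to this expansion. *)
Lemma jet_GN_Q : jet 0 400 (GN_Q p H1 H2 v) (fun t x => - 2 * tau * nu p * Wxx t x)
  (fun t x => - 2 * tau * kappa_term t x).
Proof.
have tn : tau != 0 by rewrite gt_eqF // tau0.
have tn' : delta + gamma != 0 by rewrite addrC.
have dn : delta != 0 by rewrite gt_eqF.
have c3 : `|- 1 / 3 : R| <= B ^+ 0.
  by rewrite mulN1r normrN ger0_norm ?invr_ge0 // invf_le1 // ler1n.
have l0 n f f0 f1 : jet 2 n f f0 f1 -> jet 0 n f f0 f1 by exact: jet_le.
have jp := jet_scale c3 (jet_mul (l0 _ _ _ _ jet_H1V) (l0 _ _ _ _ jet_H2V)).
have js := jet_add (jet_mul (l0 _ _ _ _ jet_H1) jet_PA) (jet_mul (jet_scale gB (l0 _ _ _ _ jet_H2)) jet_PB).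
apply: jet_le (jet_eqD _ _ _ (jet_mul jp js)) => // t x Dt.
- have [n1 n2] := Hn0 x Dt.
  rewrite (_ : GN_Q p H1 H2 v t x = - 1 / (3 * H1 t x * H2 t x) * (H1 t x * PA t x + gamma * H2 t x * PB t x)); last by reflexivity.
  by move: (H1 t x) (H2 t x) (PA t x) (PB t x) n1 n2 => y1 y2 u1 u2 n1 n2; field; rewrite n1 n2.
- by rewrite /nu /Wxx; gen_atoms t x; field; rewrite ?tn ?tn' ?dn.
- rewrite /kappa_term /kappa1 /kappa2 /S2 /Wx /Wxx /zx /zxx.
  gen_atoms t x.
  by field; rewrite ?tn ?tn' ?dn.
Qed.

(** The definition of kappa_3 amounts to this leading term. *)
Lemma jet_GN_R : exists r1, jet 0 500 (GN_R p H1 H2 v) (fun t x => - 2 * tau * kappa3 p *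
  (1 / 3 * (ul t x - ur t x) * Wxx t x + 1 / 2 * Wx t x ^+ 2)) r1.
Proof.
have tn : tau != 0 by rewrite gt_eqF // tau0.
have dn : delta != 0 by rewrite gt_eqF.
have c3 : `|1 / 3 : R| <= B ^+ 0.
  by rewrite mul1r ger0_norm ?invr_ge0 // invf_le1 // ler1n.
have c2 : `|1 / 2 : R| <= B ^+ 0.
  by rewrite mul1r ger0_norm ?invr_ge0 // invf_le1 // ler1n.
have l0 n f f0 f1 : jet 2 n f f0 f1 -> jet 0 n f f0 f1 by exact: jet_le.
have l1 n f f0 f1 : jet 1 n f f0 f1 -> jet 0 n f f0 f1 by exact: jet_le.
have j1 := jet_exp2 (jet_mul (l0 _ _ _ _ jet_H2) (l1 _ _ _ _ jet_dx_Af)).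
have j2 := jet_opp (jet_scale gB (jet_exp2 (jet_mul (l0 _ _ _ _ jet_H1) (l1 _ _ _ _ jet_dx_Bf)))).
have j3 := jet_scale c2 (jet_add j1 j2).
have j4 := jet_scale c3 (jet_mul (l0 _ _ _ _ jet_v) (l0 _ _ _ _ jet_denV)).
have j5 := jet_mul (jet_mul (l0 _ _ _ _ jet_H1) (l0 _ _ _ _ jet_H2V)) jet_PA.
have j6 := jet_opp (jet_mul (jet_scale gB (jet_mul (l0 _ _ _ _ jet_H2) (l0 _ _ _ _ jet_H1V))) jet_PB).
have j7 := jet_add j3 (jet_mul j4 (jet_add j5 j6)).
eexists; apply: jet_le (jet_eqD _ _ _ j7) => // t x Dt.
rewrite /kappa3 /Wx /Wxx; gen_atoms t x; field; by rewrite ?tn ?dn.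
Qed.

Lemma inW1B_opp k n f : inW1B k n f -> inW1B k (0 + n) (fun t x => - f t x).
Proof. by move=> hf; apply: inW1B_eqD (inW1B_scale N1B hf) => t x _; rewrite mulN1r. Qed.

Lemma inW1B_e : inW1B 2 1 (fun _ _ => e). Proof. by apply: inW1B_cst => //; exact: e1B. Qed.
Lemma inW1B_delta : inW1B 2 1 (fun _ _ => delta). Proof. by apply: inW1B_cst => //; exact: dltB. Qed.
Lemma inW1B_gamma : inW1B 2 0 (fun _ _ => gamma). Proof. by apply: inW1B_cst => //; exact: gB. Qed.
Lemma inW1B_a : inW1B 2 0 (fun _ _ => a). Proof. by apply: inW1B_cst => //; exact: aB. Qed.
Lemma inW1B_nat (j : nat) : (j <= 16)%N -> inW1B 2 1 (fun _ _ => j%:R).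
Proof.
by move=> j16; apply: inW1B_cst => //; rewrite expr1 normr_nat (le_trans _ B16) // ler_nat.
Qed.

Definition i3 := fun t x => (1 - e * a * z t x)^-1.

Lemma i3P t x : D t -> i3 t x * (1 - e * a * z t x) = 1 /\ (H1 t x + gamma * H2 t x)^-1 = delta / tau * i3 t x.
Proof.
move=> Dt.
have tn : tau != 0 by rewrite gt_eqF // tau0.
have dn : delta != 0 by rewrite gt_eqF.
have fE : H1 t x + gamma * H2 t x = tau / delta * (1 - e * a * z t x).
  by rewrite /h1 /h2 ee; field; rewrite ?tn ?dn.
have pos : 0 < H1 t x + gamma * H2 t x.
  apply: ltr_wpDr; last by rewrite (lt_le_trans h0) // hH1.
  by rewrite mulr_ge0 // (le_trans (ltW h0)) //; exact: hH2.
have n0 : 1 - e * a * z t x != 0.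
  by apply/eqP => h00; move: pos; rewrite fE h00 mulr0 ltxx.
by split; [rewrite /i3 mulVf|rewrite fE invfM invf_div].
Qed.

Lemma inW1B_i3 : inW1B 2 10 i3.
Proof.
have aB' : `|a| <= B by apply: le_trans aB _; rewrite expr0 B1.
have tn : tau != 0 by rewrite gt_eqF // tau0.
have dn : delta != 0 by rewrite gt_eqF.
have fE t x : H1 t x + gamma * H2 t x = tau / delta * (1 - e * a * z t x).
  by rewrite /h1 /h2 ee; field; rewrite ?tn ?dn.
have k0 : 0 < h / (tau / delta) by rewrite !divr_gt0 // tau0.
apply: (inW1B_inv aB' k0) => t x Dt.
rewrite ler_pdivrMr ?divr_gt0 ?tau0 // mulrC -fE.
by apply: ler_wpDr (hH1 x Dt); rewrite mulr_ge0 // (le_trans (ltW h0)) //; exact: hH2.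
Qed.

(** With y = a e z, replace 1 / (1 - y) by 1 + y + y^2 + y^3 + y^4 / (1 - y) in the
    first flux: F4 is what is left beyond the power e^3. *)
Definition F4 := fun t x => z t x * z t x * (z t x * z t x) * W t x *
  ((delta - 1) * (a * a * a) - delta * (a * a) - e * (delta * (a * a * a)) * z t x
   + i3 t x * (a * a * (a * a) * (1 + (delta - 1) * e * z t x - delta * (e * e) * (z t x * z t x)))).

Definition n0 := delta * delta - gamma.
Definition n1 := - (2 * delta * (delta + gamma)).
Definition n2 := delta * delta * (1 - gamma).

(** With y = a e z, replace 1 / (1 - y)^2 by
    1 + 2 y + 3 y^2 + y^3 (4 - 3 y) / (1 - y)^2 in the second flux multiplied by
    e / 2; n0, n1 and n2 are the coefficients of its numerator. *)
Definition G4 := fun t x => W t x * W t x * (z t x * z t x * z t x) *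
  (3 * (a * a) * n1 + 2 * a * n2 + 3 * (a * a) * n2 * e * z t x
   + a * a * a * (4 - 3 * a * e * z t x) * (i3 t x * i3 t x) *
     (n0 + n1 * e * z t x + n2 * (e * e) * (z t x * z t x))).

Ltac inW1B_tac := lazymatch goal with
  | |- inW1B _ _ (fun t x => GRing.add (@?f t x) (@?g t x)) => eapply (@inW1B_add _ _ _ f g); [inW1B_tac|inW1B_tac]
  | |- inW1B _ _ (fun t x => GRing.opp (@?f t x)) => eapply (@inW1B_opp _ _ f); inW1B_tac
  | |- inW1B _ _ (fun _ _ => a) => exact inW1B_a
  | |- inW1B _ _ (fun t x => GRing.mul (@?f t x) (@?g t x)) => eapply (@inW1B_mul _ _ _ f g); [inW1B_tac|inW1B_tac]
  | |- inW1B _ _ (fun _ _ => e) => exact inW1B_e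
  | |- inW1B _ _ (fun _ _ => delta) => exact inW1B_delta
  | |- inW1B _ _ (fun _ _ => gamma) => exact inW1B_gamma
  | |- inW1B _ _ (fun t x => i3 t x) => exact inW1B_i3
  | |- inW1B _ _ (fun t x => ul t x) => exact inW1B_ul
  | |- inW1B _ _ (fun t x => ur t x) => exact inW1B_ur
  | |- inW1B _ _ (fun _ _ => 1) => exact: (@inW1B_nat 1 isT)
  | |- inW1B _ _ (fun _ _ => 2) => exact: (@inW1B_nat 2 isT)
  | |- inW1B _ _ (fun _ _ => 3) => exact: (@inW1B_nat 3 isT)
  | |- inW1B _ _ (fun _ _ => 4) => exact: (@inW1B_nat 4 isT)
  end.

Lemma inW1B_F4 : inW1B 2 500 F4.
Proof.
by eapply inW1B_le; [exact (leqnn 2)| |cbv beta delta [F4]; inW1B_tac].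
Qed.

Lemma inW1B_G4 : inW1B 2 500 G4.
Proof.
by eapply inW1B_le; [exact (leqnn 2)| |cbv beta delta [G4 n0 n1 n2]; inW1B_tac].
Qed.

(** The expansion of the first flux defines alpha_1, alpha_2 and alpha_3. *)
Lemma flux1E t x : D t -> H1 t x * H2 t x / (H1 t x + gamma * H2 t x) * v t x =
  W t x + (e * (2 * alpha1 p / 3) * (z t x * W t x) + e ^+ 2 * (alpha2 p / 3) * (z t x * z t x * W t x)
   + e ^+ 3 * (alpha3 p / 5) * (z t x * z t x * z t x * W t x)) + e ^+ 4 * F4 t x.
Proof.
move=> Dt; have [iP ->] := i3P x Dt.
have tn : tau != 0 by rewrite gt_eqF // tau0.
have dn : delta != 0 by rewrite gt_eqF.
rewrite /F4 /h1 /h2 ee; move: (i3 t x) iP => i iP.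
move: (ul t x) (ur t x) iP => l r iP.
pose P := 1 + e * (2 * alpha1 p / 3) * (l + r) + e ^+ 2 * (alpha2 p / 3) * ((l + r) ^+ 2)
   + e ^+ 3 * (alpha3 p / 5) * (l + r) ^+ 3 + e ^+ 4 * (l + r) ^+ 4 *
   ((delta - 1) * (a * a * a) - delta * (a * a) - e * (delta * (a * a * a)) * (l + r)).
apply/eqP; rewrite -subr_eq0; apply/eqP.
transitivity ((i * (1 - e * a * (l + r)) - 1) * (P * (l - r))); last by rewrite iP subrr mul0r.
rewrite /P /alpha1 /alpha2 /alpha3; field; by rewrite ?tn ?dn.
Qed.

(** The second flux has the same three coefficients, up to numerical factors: this is
    why the two equations can be decoupled at this order. *)
Lemma flux2E t x : D t ->
  e / 2 * ((H1 t x ^+ 2 - gamma * H2 t x ^+ 2) / (H1 t x + gamma * H2 t x) ^+ 2 * `|v t x| ^+ 2) =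
  tau * (e * (alpha1 p / 3) * (W t x * W t x) + e ^+ 2 * (alpha2 p / 3) * (z t x * W t x * W t x)
   + e ^+ 3 * (3 * alpha3 p / 10) * (z t x * z t x * W t x * W t x)) + e ^+ 4 * (1 / 2 * G4 t x).
Proof.
move=> Dt; have [iP e3] := i3P x Dt.
have tn : tau != 0 by rewrite gt_eqF // tau0.
have dn : delta != 0 by rewrite gt_eqF.
rewrite -normrX ger0_norm ?sqr_ge0 // -exprVn e3.
rewrite /G4 /n0 /n1 /n2 /h1 /h2 ee; move: (i3 t x) iP => i iP.
move: (ul t x) (ur t x) iP => l r iP.
pose Y := e * a * (l + r).
pose N := (delta * delta - gamma) - 2 * delta * (delta + gamma) * (e * (l + r)) + delta * delta * (1 - gamma) * (e * (l + r)) ^+ 2.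
apply/eqP; rewrite -subr_eq0; apply/eqP.
transitivity (((i * (1 - e * a * (l + r))) ^+ 2 - 1) * (e / 2 * (l - r) ^+ 2 * (N * (1 + 2 * Y + 3 * Y ^+ 2)))); last by rewrite iP expr1n subrr mul0r.
rewrite /Y /N /alpha1 /alpha2 /alpha3; field; by rewrite ?tn ?dn.
Qed.

Lemma W1B_is_dt k n c f g : W1B k n c f g -> is_dt T f g.
Proof.
move=> [_ [w hg _]]; apply: is_dt_of_wder => //.
by apply: aeS Eae => t Et Dt; exact: Hs_ball_continuous (sk2 k) (hg t (Et Dt)).
Qed.

Lemma W1B_dt k n c f g : W1B k n c f g -> {ae leb, forall t, D t -> forall x, dt T f t x = g t x}.
Proof.
move=> Xf; have i1 := W1B_is_dt Xf; have i2 : is_dt T f (dt T f); last first.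
  exact: (is_dt_unique i2 i1).
by apply: (@xgetPex _ (fun _ _ => 0) [set g0 | is_dt T f g0]); exists g.
Qed.

(** For c = 0 nothing is known of f; this is used for the flux multiplied by e / 2. *)
Lemma dx_scale (c x : R) (f f' : R -> R) : der (fun x => c * f x) f' -> c * derive1 f x = f' x.
Proof.
move=> d; have [c0|cn] := eqVneq c 0.
  rewrite c0 mul0r -(derE d) c0 (_ : (fun x => 0 * f x) = (fun=> 0)); last by apply/funext => y; rewrite mul0r.
  by rewrite (derE (der_cst 0)).
have d' : der f (fun x => c^-1 * f' x) by apply: der_ext (der_scale c^-1 d) => // y; rewrite mulKf.
by rewrite (derE d') mulVKf.
Qed.

Lemma dxxE (f g f' f'' g' g'' : R -> R) x : [/\ der f f', der f' f'', der g g' & der g' g''] ->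
  derive1 (derive1 (fun x => f x - g x)) x = f'' x - g'' x.
Proof.
move=> [d1 d2 d3 d4].
by rewrite (derE (der_add d1 (der_opp d3))) (derE (der_add d2 (der_opp d4))).
Qed.

Lemma W1B_v : W1B 2 4 0 v (fun t x => tau * (gl t x - gr t x)).
Proof. by have := W1B_scale tauB W1B_W; rewrite mulr0. Qed.

(** R is multiplied by mu e in the system, so that its expansion stops one order
    before that of Q. *)
Lemma W1B_GN_w : `|mu| <= B -> exists gE gQ Q2 R1, [/\
  exists n c, W1B 0 n c kappa_term gE,
  exists c, W1B 0 400 c Q2 gQ,
  inW1B 0 600 R1,
  exists n c, W1B 0 n c (fun t x => v t x + mu * GN_Q p H1 H2 v t x)
    (fun t x => tau * (gl t x - gr t x) + mu * (- 2 * tau * nu p * dx (dx (fun t x => gl t x - gr t x)) t x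
       + e * (- 2 * tau * gE t x) + e ^+ 2 * gQ t x))
  & forall t x, D t -> GN_R p H1 H2 v t x = - 2 * tau * kappa3 p *
  (1 / 3 * (ul t x - ur t x) * Wxx t x + 1 / 2 * Wx t x ^+ 2) + e * R1 t x].
Proof.
move=> muB.
have tn : tau != 0 by rewrite gt_eqF // tau0.
have [r1 [hR0 hR1 [R2 hR2 RE]]] := jet_GN_R.
have [hQ0 [c1 [g1' hQ1]] [Q2 [c2 [gQ hQ2]] QE]] := jet_GN_Q.
have tB : `|(- 2 * tau)^-1| <= B ^+ 1.
  rewrite invfM normrM -[leRHS]mul1r; apply: ler_pM; rewrite ?tauiB //.
  by rewrite normfV normrN ger0_norm // invf_le1 // ler1n.
have XE : exists n c gE, W1B 0 n c kappa_term gE.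
  exists (1 + 400)%N, ((- 2 * tau)^-1 * c1), (fun t x => (- 2 * tau)^-1 * g1' t x).
  by apply: W1B_eqD (W1B_scale tB hQ1) => t x _; rewrite mulKf // mulf_neq0 // oppr_eq0.
have [nE [cE [gE hE]]] := XE.
exists gE, gQ, Q2, (fun t x => r1 t x + e * R2 t x).
have sB j : exists m, `|j : R| <= B ^+ m.
  exists (Num.bound j); apply: (@le_trans _ _ (Num.bound j)%:R); first by rewrite ltW // unstable.ltr_norm_bound.
  elim: (Num.bound j) => [|m IH]; first by rewrite expr0.
  rewrite -natr1 exprS; have b1 : 1 <= B ^+ m by rewrite exprn_ege1 // B1.
  by move: (B ^+ m) b1 IH => b b1 IH; have := B16; nra.
split.
- by exists nE, cE.
- by exists c2.
- by apply: inW1B_le (inW1B_add hR1 (inW1B_scale e1B (hR2))).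
- have [m1 b1] := sB (- 2 * tau * nu p).
  have [m2 b2] := sB (- 2 * tau).
  have muB1 : `|mu| <= B ^+ 1 by rewrite expr1.
  have x0 := W1B_scale b1 (W1B_dx (W1B_dx W1B_W)).
  have x1 := W1B_scale e1B (W1B_scale b2 hE).
  have x2 := W1B_scale e2B hQ2.
  have xs := W1B_add (W1B_le (leq0n 2) (leqnn _) W1B_v) (W1B_scale muB1 (W1B_add (W1B_add x0 x1) x2)).
  do 2!eexists; apply: W1B_eqD xs => t x Dt; congr (_ + mu * _).
  rewrite QE //; congr (_ * _ + _ + _); rewrite /Wxx.
  exact: dxxE (Wder Dt).
- by move=> t x Dt; rewrite RE //; ring.
Qed.

Hypotheses (Gl : forall t x, E t -> dt T ul t x = gl t x) (Gr : forall t x, E t -> dt T ur t x = gr t x).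

Lemma gder t : E t -> [/\ der (gl t) (dx gl t), der (dx gl t) (dx (dx gl) t),
  der (gr t) (dx gr t) & der (dx gr t) (dx (dx gr) t)].
Proof.
move=> Et; have [_ [_ hl _]] := Xl; have [_ [_ hr _]] := Xr.
have [a1 b1] := HsB_deriv (hl t Et); have [a2 _] := HsB_deriv b1.
have [a3 b3] := HsB_deriv (hr t Et); have [a4 _] := HsB_deriv b3.
split; [exact: a1|exact: a2|exact: a3|exact: a4].
Qed.

Lemma dx_size k n f : inW1B k n f -> (forall x, measurable_fun D (dx f ^~ x)) /\
  (forall t, E t -> HsB k n (dx f t)).
Proof.
move=> Xf; have [c [g [[_ mf _ hf] _]]] := Xf; split=> [x|t Et].
  apply: (measurable_fun_cvg (h := fun N t => dquot (f t) x N)) => [N|t Dt].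
    by apply: measurable_funM => //; exact: measurable_funB.
  exact: dquot_cvg (inW1B_der Xf Dt).
have [d1 d2] := HsB_deriv (hf t Et).
rewrite (_ : dx f t = derive1 (fun x => f t x - c)) //.
by apply/esym/derE; apply: der_ext (der_add (inW1B_der Xf (ED Et)) (der_cst (- c))) => // y; rewrite addr0.
Qed.

Lemma derE_at (f f' : R -> R) x y : der f f' -> f' x = y -> derive1 f x = y.
Proof. by move=> /derE -> . Qed.

Lemma dxF (f : R -> R -> R) t x : dx f t x = derive1 (f t) x. Proof. by []. Qed.

Lemma dxxB (f g : R -> R -> R) u f2 g2 t x : u t = (fun x => f t x - g t x) ->
  [/\ der (f t) (dx f t), der (dx f t) f2, der (g t) (dx g t) & der (dx g t) g2] ->
  dx (dx u) t x = f2 x - g2 x.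
Proof. by move=> ut hd; rewrite /dx ut; exact: dxxE hd. Qed.

Lemma kappa_termE t x : kappa_term t x = kappa1 p * (ul t x * dx (dx ul) t x - ur t x * dx (dx ur) t x)
    + kappa2 p * (ur t x * dx (dx ul) t x - ul t x * dx (dx ur) t x)
    + (kappa1 p + kappa2 p / 2) * (dx ul t x ^+ 2 - dx ur t x ^+ 2).
Proof. by []. Qed.

Opaque dx alpha1 alpha2 alpha3 kappa1 kappa2 kappa3 nu F4 G4 kappa_term.

Ltac eval_dx := match goal with
  | |- context [@dx _ (fun t x => GRing.add (@?F t x) (@?G t x)) ?t0 ?x0] =>
     let d := fresh in eassert (d : dx (fun t x => F t x + G t x) t0 x0 = _) by (eapply dxE; cbv beta; derive_tac);
     cbv beta in d; rewrite_atom d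
  | |- context [@dx _ (fun t x => GRing.mul (@?F t x) (@?G t x)) ?t0 ?x0] =>
     let d := fresh in eassert (d : dx (fun t x => F t x * G t x) t0 x0 = _) by (eapply dxE; cbv beta; derive_tac);
     cbv beta in d; rewrite_atom d
  end.

Lemma dx_flux1 t x : D t -> dx (fun t x => H1 t x * H2 t x / (H1 t x + gamma * H2 t x) * v t x) t x =
  Wx t x + (e * (2 * alpha1 p / 3) * (zx t x * W t x + z t x * Wx t x)
   + e ^+ 2 * (alpha2 p / 3) * (2 * zx t x * z t x * W t x + z t x * z t x * Wx t x)
   + e ^+ 3 * (alpha3 p / 5) * (3 * zx t x * z t x * z t x * W t x + z t x * z t x * z t x * Wx t x))
   + e ^+ 4 * dx F4 t x.
Proof.
move=> Dt; have [d1 _ d3 _] := Wder Dt; have dF := inW1B_der inW1B_F4 Dt.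
rewrite dxF (_ : (fun x => _) = (fun x =>
    W t x + (e * (2 * alpha1 p / 3) * (z t x * W t x) + e ^+ 2 * (alpha2 p / 3) * (z t x * z t x * W t x)
   + e ^+ 3 * (alpha3 p / 5) * (z t x * z t x * z t x * W t x)) + e ^+ 4 * F4 t x)); last first.
  by apply/funext => y; exact: flux1E.
move: (alpha1 p) (alpha2 p) (alpha3 p) => a1 a2 a3.
eapply derE_at.
  derive_tac.
rewrite /Wx /zx.
  generalize (dx F4 t x); gen_atoms t x; ring.
Qed.

Lemma dx_flux2 t x : D t ->
  e / 2 * dx (fun t x => (H1 t x ^+ 2 - gamma * H2 t x ^+ 2) / (H1 t x + gamma * H2 t x) ^+ 2 * `|v t x| ^+ 2) t x =
  tau * (e * (alpha1 p / 3) * (2 * W t x * Wx t x)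
   + e ^+ 2 * (alpha2 p / 3) * (zx t x * W t x * W t x + 2 * z t x * W t x * Wx t x)
   + e ^+ 3 * (3 * alpha3 p / 10) * (2 * zx t x * z t x * W t x * W t x + 2 * z t x * z t x * W t x * Wx t x))
   + e ^+ 4 * (1 / 2 * dx G4 t x).
Proof.
move=> Dt; have [d1 _ d3 _] := Wder Dt; have dG := inW1B_der inW1B_G4 Dt.
have d : der (fun x => e / 2 * ((H1 t x ^+ 2 - gamma * H2 t x ^+ 2) / (H1 t x + gamma * H2 t x) ^+ 2 * `|v t x| ^+ 2))
  (fun x => tau * (e * (alpha1 p / 3) * (2 * W t x * Wx t x)
   + e ^+ 2 * (alpha2 p / 3) * (zx t x * W t x * W t x + 2 * z t x * W t x * Wx t x)
   + e ^+ 3 * (3 * alpha3 p / 10) * (2 * zx t x * z t x * W t x * W t x + 2 * z t x * z t x * W t x * Wx t x))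
   + e ^+ 4 * (1 / 2 * dx G4 t x)); last by rewrite dxF; exact: dx_scale d.
rewrite (_ : (fun x => e / 2 * _) = (fun x => tau * (e * (alpha1 p / 3) * (W t x * W t x) + e ^+ 2 * (alpha2 p / 3) * (z t x * W t x * W t x)
   + e ^+ 3 * (3 * alpha3 p / 10) * (z t x * z t x * W t x * W t x)) + e ^+ 4 * (1 / 2 * G4 t x))); last first.
  by apply/funext => y; exact: flux2E.
move: (alpha1 p) (alpha2 p) (alpha3 p) => a1 a2 a3.
eapply der_to; first by derive_tac.
move=> y; rewrite /Wx /zx; generalize (dx G4 t y); gen_atoms t y; ring.
Qed.

Lemma dx_GN_R (R1 : R -> R -> R) n : inW1B 0 n R1 ->
  (forall t x, D t -> GN_R p H1 H2 v t x = - 2 * tau * kappa3 p *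
  (1 / 3 * (ul t x - ur t x) * Wxx t x + 1 / 2 * Wx t x ^+ 2) + e * R1 t x) ->
  forall t x, D t -> dx (GN_R p H1 H2 v) t x = - 2 * tau * kappa3 p *
   (1 / 3 * Wx t x * Wxx t x + 1 / 3 * W t x * (dx (dx (dx ul)) t x - dx (dx (dx ur)) t x)
    + Wx t x * Wxx t x) + e * dx R1 t x.
Proof.
move=> hR1 RE t x Dt; have [d1 d2 d3 d4] := Wder Dt.
have d5 : der (dx (dx ul) t) (dx (dx (dx ul)) t) by exact: inW1B_der (inW1B_dx (inW1B_dx inW1B_ul)) Dt.
have d6 : der (dx (dx ur) t) (dx (dx (dx ur)) t) by exact: inW1B_der (inW1B_dx (inW1B_dx inW1B_ur)) Dt.
have dR1 : der (R1 t) (dx R1 t) by exact: inW1B_der hR1 Dt.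
rewrite dxF (_ : GN_R p H1 H2 v t = (fun x => - 2 * tau * kappa3 p *
  (1 / 3 * (ul t x - ur t x) * (dx (dx ul) t x - dx (dx ur) t x) + 1 / 2 * (dx ul t x - dx ur t x) ^+ 2) + e * R1 t x)); last first.
  by apply/funext => y; rewrite RE.
move: (kappa3 p) => k3.
eapply derE_at.
  derive_tac.
cbv beta; rewrite /Wx /Wxx.
generalize (dx R1 t x), (dx (dx (dx ul)) t x), (dx (dx (dx ur)) t x); gen_atoms t x.
by field.
Qed.

Lemma lin_comb (u u' c c' k l : R) : u = 0 -> u' = 0 -> c - c' = k * u + l * u' -> c = c'.
Proof. by move=> -> -> /eqP; rewrite !mulr0 addr0 subr_eq0 => /eqP. Qed.

(** The sum of the equations of u_l and u_r, and tau times their difference. *)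
Lemma GN_remainder : `|mu| <= B -> strong_solution p T ul ur ->
  exists A1 A2 A3 : R -> R -> R, [/\
   [/\ forall x, measurable_fun D (A1 ^~ x), forall x, measurable_fun D (A2 ^~ x)
     & forall x, measurable_fun D (A3 ^~ x)],
   forall t, E t -> [/\ HsB 0 600 (A1 t), HsB 0 600 (A2 t) & HsB 0 602 (A3 t)]
   & GN_with_rhs p T z v (fun t x => e ^+ 4 * A1 t x)
       (fun t x => e ^+ 4 * A2 t x + mu * e ^+ 2 * A3 t x)].
Proof.
move=> muB sol.
have [gE [gQ [Q2 [R1 [[nE [cE hE]] [cQ hQ2] hR1 [nw [cw hw]] RE]]]]] := W1B_GN_w muB.
have XF := inW1B_dx (inW1B_le (leqnSn 1) (leqnn _) inW1B_F4); have XG := inW1B_dx (inW1B_le (leqnSn 1) (leqnn _) inW1B_G4).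
have XR := hR1.
exists (dx F4), (fun t x => 1 / 2 * dx G4 t x), (fun t x => gQ t x - dx R1 t x).
split.
- split=> x.
  + exact: (dx_size inW1B_F4).1.
  + by apply: measurable_funM => //; exact: (dx_size inW1B_G4).1.
  + apply: measurable_funB; last exact: (dx_size hR1).1.
    by have [_ [wq _ _]] := hQ2; have [_ [mq _] _] := wq x; exact: measurable_funTS.
- move=> t Et; split.
  + by apply: HsB_le ((dx_size inW1B_F4).2 t Et).
  + have c2 : `|1 / 2 : R| <= B ^+ 0 by rewrite mul1r ger0_norm ?invr_ge0 // invf_le1 // ler1n.
    by apply: HsB_le (HsB_scale c2 ((dx_size inW1B_G4).2 t Et)).
  + have [_ [_ hq _]] := hQ2.
    apply: HsB_le (HsB_ext _ (HsB_add (hq t Et) (HsB_scale N1B ((dx_size hR1).2 t Et)))) => //.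
    by move=> x; rewrite mulN1r.
have hz := W1B_dt W1B_zeta; have hW := W1B_dt W1B_W; have hwd := W1B_dt hw.
have hWm : {ae leb, forall t, D t -> forall x, dt T (fun t x => ur t x - ul t x) t x = gr t x - gl t x}.
  have := W1B_dt (W1B_scale N1B W1B_W).
  rewrite (_ : (fun t x => -1 * (ul t x - ur t x)) = (fun t x => ur t x - ul t x)).
    by apply: aeS => t ht Dt x; rewrite ht //; ring.
  by apply/funext => t; apply/funext => x; ring.
have hEd : {ae leb, forall t, D t -> forall x, dt T (fun t x =>
    kappa1 p * (ul t x * dx (dx ul) t x - ur t x * dx (dx ur) t x)
    + kappa2 p * (ur t x * dx (dx ul) t x - ul t x * dx (dx ur) t x)
    + (kappa1 p + kappa2 p / 2) * (dx ul t x ^+ 2 - dx ur t x ^+ 2)) t x = gE t x}.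
  exact: (W1B_dt hE).
have hEm : {ae leb, forall t, D t -> forall x, dt T (fun t x =>
    kappa1 p * (ur t x * dx (dx ur) t x - ul t x * dx (dx ul) t x)
    + kappa2 p * (ul t x * dx (dx ur) t x - ur t x * dx (dx ul) t x)
    + (kappa1 p + kappa2 p / 2) * (dx ur t x ^+ 2 - dx ul t x ^+ 2)) t x = - gE t x}.
  have := W1B_dt (W1B_scale N1B hE).
  rewrite (_ : (fun t x => -1 * kappa_term t x) = (fun t x =>
    kappa1 p * (ur t x * dx (dx ur) t x - ul t x * dx (dx ul) t x)
    + kappa2 p * (ul t x * dx (dx ur) t x - ur t x * dx (dx ul) t x)
    + (kappa1 p + kappa2 p / 2) * (dx ur t x ^+ 2 - dx ul t x ^+ 2))).
    by apply: aeS => t ht Dt x; rewrite ht // mulN1r.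
  by apply/funext => t; apply/funext => x; rewrite kappa_termE; gen_atoms t x; ring.
split.
- by exists (fun t x => gl t x + gr t x); exact: W1B_is_dt W1B_zeta.
- by eexists; exact: W1B_is_dt hw.
apply: aeS (aeI (aeI (aeI hz hW) (aeI hEd hwd)) (aeI (aeI hWm hEm) (aeI Eae sol))).
move=> t [[[z1 W1] [E1 w1]] [[Wm1 Em1] [Et sol1]]] Dt x.
have {}z1 := z1 Dt; have {}W1 := W1 Dt; have {}E1 := E1 Dt; have {}w1 := w1 Dt.
have {}Wm1 := Wm1 Dt; have {}Em1 := Em1 Dt; have {}Et := Et Dt.
have [sl sr] := sol1 Dt x.
have [d1 d2 d3 d4] := Wder Dt; have [q1 q2 q3 q4] := gder Et.
have d5 : der (dx (dx ul) t) (dx (dx (dx ul)) t) by exact: inW1B_der (inW1B_dx (inW1B_dx inW1B_ul)) Dt.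
have d6 : der (dx (dx ur) t) (dx (dx (dx ur)) t) by exact: inW1B_der (inW1B_dx (inW1B_dx inW1B_ur)) Dt.
have dF : der (F4 t) (dx F4 t) by exact: inW1B_der inW1B_F4 Dt.
have dG : der (G4 t) (dx G4 t) by exact: inW1B_der inW1B_G4 Dt.
have dR1 : der (R1 t) (dx R1 t) by exact: inW1B_der hR1 Dt.
have W1' : dt T (fun t x => ul t x - ur t x) t = (fun x => gl t x - gr t x) by apply/funext.
have Wm1' : dt T (fun t x => ur t x - ul t x) t = (fun x => gr t x - gl t x) by apply/funext.
have dW : dx (dx (dt T (fun t x => ul t x - ur t x))) t x = dx (dx gl) t x - dx (dx gr) t x.
  exact: dxxB W1' _.
have dWm : dx (dx (dt T (fun t x => ur t x - ul t x))) t x = dx (dx gr) t x - dx (dx gl) t x.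
  exact: dxxB Wm1' (And4 q3 q4 q1 q2).
have v1 := dx_flux1 x Dt.
have v2 := dx_flux2 x Dt.
have v3 := dx_GN_R hR1 RE x Dt.
have {}E1 := E1 x; have {}Em1 := Em1 x; have Gl' := Gl x Et; have Gr' := Gr x Et.
move: sl sr; unfold f_l, f_r.
rewrite_atom dW. rewrite_atom dWm. rewrite_atom E1. rewrite_atom Em1. rewrite_atom Gl'. rewrite_atom Gr'.
rewrite ee.
do 9 eval_dx.
cbv beta.
have gg : dx (dx (fun t x => gl t x - gr t x)) t x = dx (dx gl) t x - dx (dx gr) t x.
  have hd := And4 q1 q2 q3 q4.
  exact: dxxB hd.
have zz : dx z t x = zx t x by rewrite dxF; eapply derE_at; [derive_tac|].
have {}z1 := z1 x; have {}w1 := w1 x.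
clear W1' Wm1' hz hW hEd hwd hWm hEm sol1 W1 Wm1.
rewrite_atom z1; rewrite_atom zz; rewrite_atom v1; rewrite_atom v3.
match goal with |- context [dt T ?F t x] => have {}w1 : dt T F t x = _ := w1 end.
match goal with |- context [e / 2 * dx ?F t x] => have {}v2 : e / 2 * dx F t x = _ := v2 end.
rewrite_atom w1; rewrite_atom gg; rewrite_atom v2.
unfold Wx, Wxx, zx.
generalize (dx F4 t x), (dx G4 t x), (dx R1 t x), (gE t x), (gQ t x).
generalize (dx (dx gl) t x), (dx (dx gr) t x), (gl t x), (gr t x).
generalize (dx (dx (dx ul)) t x), (dx (dx (dx ur)) t x), (dx (dx ul) t x), (dx (dx ur) t x), (dx ul t x), (dx ur t x), (ul t x), (ur t x).
generalize (alpha1 p), (alpha2 p), (alpha3 p).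
generalize (kappa3 p), (nu p); intros.
match goal with sr : _ = 0, sl : _ = 0 |- _ => split;
  [apply: (lin_comb (k := 1) (l := 1) sl sr)|apply: (lin_comb (k := tau) (l := - tau) sr sl)] end.
  by generalize tau mu; intros; field.
by generalize tau mu; intros; field.
Qed.

Transparent dx alpha1 alpha2 alpha3 kappa1 kappa2 kappa3 nu F4 G4 kappa_term.
End Classes.

(** * From the norms of the solutions to consistency *)

Section Assembly.
Variable R : realType.
Local Notation leb := (@lebesgue_measure R).
Implicit Types (s T M : R) (u f : R -> R -> R).

Lemma Hs_norm_ge0 s (f : R -> R) : (0 <= Hs_norm s f)%E.
Proof. by apply: le_ereal_inf_tmp => _ [a [b [_ ->]]]; exact: Lnorm_ge0. Qed.

(** The interval of times has positive measure. *)
Lemma LinfH_norm_ge0 T s u : 0 < T -> (0 <= LinfH_norm T s u)%E.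
Proof.
move=> T0; have [t [Dt h]] := ae_ex T0 (ess_sup_ge leb ((fun t => Hs_norm s (u t)) \_ `[0, T[)).
apply: le_trans h; rewrite /patch mem_set //; exact: Hs_norm_ge0.
Qed.

Lemma LinfH_normP T s u (Z : \bar R) : (0 <= Z)%E ->
  (LinfH_norm T s u <= Z)%E <->
  {ae leb, forall t, [set` `[(0:R), T[] t -> (Hs_norm s (u t) <= Z)%E}.
Proof.
move=> Z0; split.
  move=> /ess_supP H; apply: aeS H => t + Dt.
  by rewrite /patch mem_set.
move=> H; apply/ess_supP; apply: aeS H => t h.
by rewrite /patch; case: ifPn => // /set_mem; exact: h.
Qed.

Lemma good_times T s M u : 0 < T -> (W1_norm T s u <= M%:E)%E ->
  {ae leb, forall t, [set` `[(0:R), T[] t ->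
    (Hs_norm s (u t) <= M%:E)%E /\ (Hs_norm (s - 1) (dt T u t) <= M%:E)%E}.
Proof.
move=> T0; have n1 := LinfH_norm_ge0 s u T0; have n2 := LinfH_norm_ge0 (s - 1) (dt T u) T0.
rewrite /W1_norm => WM.
have [M0 h1 h2] : [/\ (0 <= M%:E)%E, (LinfH_norm T s u <= M%:E)%E &
    (LinfH_norm T (s - 1) (dt T u) <= M%:E)%E].
  move: (LinfH_norm T s u) (LinfH_norm T (s - 1) (dt T u)) n1 n2 WM => a b a0 b0 ab; split.
  - by apply: le_trans ab; exact: adde_ge0.
  - by apply: le_trans ab; exact: leeDl.
  - by apply: le_trans ab; exact: leeDr.
move/(LinfH_normP _ _ _ M0) : h1 => h1; move/(LinfH_normP _ _ _ M0) : h2 => h2.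
by apply: aeS (aeI h1 h2) => t [a1 a2] Dt; split; [exact: a1|exact: a2].
Qed.

Lemma is_dt_dt T s u : in_W1 T s u -> is_dt T u (dt T u).
Proof.
by move=> [_ [g ug _]]; apply: (@xgetPex _ (fun _ _ => 0) [set g0 | is_dt T u g0]); exists g.
Qed.

Lemma Hs_ball_nd s n N (f : R -> R) : 2^-1 < s -> Hs_ball (s + n%:R) N f -> nd n f.
Proof.
move=> s2; elim: n f => [//|n IH] f; rewrite -natr1 addrA => h.
have s2n : 2^-1 < s + n%:R by apply: lt_le_trans s2 _; rewrite lerDl.
by have [d h'] := Hs_ball_deriv s2n h; exact: ndS (derivable_der d) (IH _ h').
Qed.

(** The weak derivative is bounded at the times of E, so that [wder_of_is_dt]
    applies; outside of E only the finiteness of the norm is used. *)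
Lemma W1B_of_W1 s B T M (E : set R) u : 2^-1 < s -> 16 <= B -> 0 < T ->
  (forall k, (k <= 3)%N -> 16 * Kconv (s + k%:R) <= B /\ Kneu (s + k%:R) <= B) ->
  measurable E -> E `<=` [set` `[(0:R), T[] -> {ae leb, forall t, [set` `[(0:R), T[] t -> E t} ->
  2 * (M + 1) <= B -> in_W1 T (s + 3) u ->
  (forall t, E t -> (Hs_norm (s + 3) (u t) <= M%:E)%E /\ (Hs_norm (s + 3 - 1) (dt T u t) <= M%:E)%E) ->
  W1B s B T E 2 1 0 u (fun t x => \1_E t * dt T u t x).
Proof.
move=> s2 B16 T0 HK mE ED Eae MB W HE.
have s3 : s + 3 - 1 = s + 2%:R by ring.
have hbE sg (f : R -> R) : (Hs_norm sg f <= M%:E)%E -> Hs_ball sg (B ^+ 1) f.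
  move=> h; have h1 : (Hs_norm sg f < (M + 1)%:E)%E by apply: le_lt_trans h _; rewrite lte_fin ltrDl.
  by apply: Hs_ball_mono (Hs_norm_Hs_ball h1) => //; rewrite expr1.
have ind1 t : E t -> \1_E t = 1 :> R by move=> Et; rewrite indicE mem_set.
have ind0 t : ~ E t -> \1_E t = 0 :> R by move=> Et; rewrite indicE memNset.
have mind : measurable_fun [set: R] (\1_E : R -> R) by exact: measurable_indic.
have mDT := mD T.
have [[mu fu _] [g0 _ _]] := W; have isdt := is_dt_dt W; have [_ _ jg _] := isdt.
have hu t : E t -> HsB s B 3 1 (u t) by move=> Et; exact: hbE (HE t Et).1.
have hg t : E t -> HsB s B 2 1 (dt T u t) by move=> Et; rewrite /HsB -s3; exact: hbE (HE t Et).2.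
have mg x : measurable_fun [set` `[(0:R), T[] (fun t => dt T u t x).
  by case/integrableP : (jg x) => /measurable_EFinP.
have bG x : bmf (fun t => \1_E t * dt T u t x).
  apply: (E_bmf (T := T) ED (Z := B ^+ 2)).
  - by apply: measurable_funM => //; exact: measurable_funTS.
  - by move=> t Et; rewrite ind1 // mul1r; apply: (HsB_bound s2 B16 HK) (hg t Et).
  - by move=> t nE; rewrite ind0 // mul0r.
have bF x : bmf (fun t => \1_E t * u t x).
  apply: (E_bmf (T := T) ED (Z := B ^+ 2)).
  - by apply: measurable_funM => //; exact: measurable_funTS.
  - by move=> t Et; rewrite ind1 // mul1r; apply: (HsB_bound s2 B16 HK) (hu t Et).
  - by move=> t nE; rewrite ind0 // mul0r.
split; split.
- by split=> //; rewrite normr0 expr1 (le_trans _ B16).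
- exact: mu.
- move=> t Dt; have := fu t Dt; case e : (Hs_norm (s + 3) (u t)) => [r| |] // _; last first.
    by have := Hs_norm_ge0 (s + 3) (u t); rewrite e.
  have h1 : (Hs_norm (s + 3) (u t) < (r + 1)%:E)%E by rewrite e lte_fin ltrDl.
  exact: (Hs_ball_nd s2 (Hs_norm_Hs_ball h1)).
- by move=> t Et; apply: Hs_ball_ext (hu t Et) => x; rewrite subr0.
- move=> x.
  have w : wder T (fun t => \1_E t * u t x) (fun t => \1_E t * dt T u t x).
    apply: (wder_of_is_dt (x := x) T0 isdt (bF x) (bG x)).
      by apply: aeS Eae => t h /h Et; rewrite ind1 // mul1r.
    by apply: aeS Eae => t h /h Et; rewrite ind1 // mul1r.
  apply: wder_congr w (mu x) (bG x) _ _; last exact: aeW.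
  by apply: aeS Eae => t h /h Et; rewrite ind1 // mul1r.
- by move=> t Et; apply: Hs_ball_ext (hg t Et) => x; rewrite ind1 // mul1r.
- by move=> t x nE; rewrite ind0 // mul0r.
Qed.

(** A function of [Hs_ball sg N] has norm at most kF N. *)
Definition kF : R := 4 * ((Num.sqrt (2 * pi))^-1)^-1.

Lemma kF_gt0 : 0 < kF.
Proof. by rewrite mulr_gt0 // invrK sqrtr_gt0 mulr_gt0 // pi_gt0. Qed.

Lemma LinfH_of_HsB s B T (E : set R) n f : 2^-1 < s -> 16 <= B ->
  measurable E -> E `<=` [set` `[(0:R), T[] -> {ae leb, forall t, [set` `[(0:R), T[] t -> E t} ->
  (forall x, measurable_fun [set` `[(0:R), T[] (f ^~ x)) ->
  (forall t, E t -> Hs_ball s (B ^+ n) (f t)) ->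
  in_LinfH T s (fun t x => \1_E t * f t x) /\
  (LinfH_norm T s (fun t x => (\1_E t * f t x)%R) <= (kF * B ^+ n)%:E)%E.
Proof.
move=> s2 B16 mE ED Eae mf hf.
have mind : measurable_fun [set: R] (\1_E : R -> R) by exact: measurable_indic.
have B0 : 0 < B by apply: lt_le_trans B16.
have hb1 t : E t -> (Hs_norm s (fun x => (\1_E t * f t x)%R) <= (kF * B ^+ n)%:E)%E.
  move=> Et; apply: Hs_ball_Hs_norm => //; apply: Hs_ball_ext (hf t Et) => x.
  by rewrite indicE mem_set // mul1r.
have y0 : (0 <= (kF * B ^+ n)%:E)%E by rewrite lee_fin mulr_ge0 ?exprn_ge0 ?(ltW kF_gt0) ?(ltW B0).
have le1 : (LinfH_norm T s (fun t x => (\1_E t * f t x)%R) <= (kF * B ^+ n)%:E)%E.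
  by apply/LinfH_normP => //; apply: aeS Eae => t h /h; exact: hb1.
split=> //; split.
- by move=> x; apply: measurable_funM => //; exact: measurable_funTS.
- move=> t _; have [Et|nE] := pselect (E t).
    by apply: le_lt_trans (hb1 t Et) _; rewrite ltry.
  apply: (@le_lt_trans _ _ (kF * 1)%:E); last by rewrite ltry.
  apply: Hs_ball_Hs_norm => //; apply: Hs_ball_ext (Hs_ball0 s2 ltr01) => x.
  by rewrite indicE memNset // mul0r.
- by apply: le_lt_trans le1 _; rewrite ltry.
Qed.

Lemma Hs_norm_fin_ball s (f : R -> R) : (Hs_norm s f < +oo)%E -> exists N, Hs_ball s N f.
Proof.
case e : (Hs_norm s f) => [r| |] // _; last by have := Hs_norm_ge0 s f; rewrite e.
by exists (2 * (r + 1)); apply: Hs_norm_Hs_ball; rewrite e lte_fin ltrDl.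
Qed.

Lemma in_LinfH_add T s u u' (k M : R) : 2^-1 < s -> 0 <= M -> in_LinfH T s u -> in_LinfH T s u' ->
  (LinfH_norm T s u <= M%:E)%E -> (LinfH_norm T s u' <= M%:E)%E ->
  in_LinfH T s (fun t x => u t x + k * u' t x) /\
  (LinfH_norm T s (fun t x => (u t x + k * u' t x)%R) <=
    (kF * (2 * (2 * (M + 1) + (`|k| + 1) * (2 * (M + 1)))))%:E)%E.
Proof.
move=> s2 M0 [mu fu _] [mu' fu' _].
move=> /(LinfH_normP _ _ _ (_ : (0 <= M%:E)%E)) => /(_ M0) h1.
move=> /(LinfH_normP _ _ _ (_ : (0 <= M%:E)%E)) => /(_ M0) h2.
have k1 : 0 < `|k| + 1 by rewrite ltr_wpDl.
have kk : `|k| <= `|k| + 1 by rewrite lerDl.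
have y0 : (0 <= (kF * (2 * (2 * (M + 1) + (`|k| + 1) * (2 * (M + 1)))))%:E)%E.
  rewrite lee_fin mulr_ge0 ?(ltW kF_gt0) // mulr_ge0 // addr_ge0 // ?mulr_ge0 ?addr_ge0 //.
have le1 : (LinfH_norm T s (fun t x => (u t x + k * u' t x)%R) <=
    (kF * (2 * (2 * (M + 1) + (`|k| + 1) * (2 * (M + 1)))))%:E)%E.
  apply/LinfH_normP => //; apply: aeS (aeI h1 h2) => t [a1 a2] Dt.
  have b1 : (Hs_norm s (u t) < (M + 1)%:E)%E by apply: le_lt_trans (a1 Dt) _; rewrite lte_fin ltrDl.
  have b2 : (Hs_norm s (u' t) < (M + 1)%:E)%E by apply: le_lt_trans (a2 Dt) _; rewrite lte_fin ltrDl.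
  exact: Hs_ball_Hs_norm s2 (Hs_ball_add s2 (Hs_norm_Hs_ball b1) (Hs_ball_scale s2 k1 kk (Hs_norm_Hs_ball b2))).
split=> //; split.
- by move=> x; apply: measurable_funD => //; exact: measurable_funM.
- move=> t Dt; have [N hN] := Hs_norm_fin_ball (fu t Dt); have [N' hN'] := Hs_norm_fin_ball (fu' t Dt).
  apply: le_lt_trans (Hs_ball_Hs_norm s2 (Hs_ball_add s2 hN (Hs_ball_scale s2 k1 kk hN'))) _.
  exact: ltry.
- by apply: le_lt_trans le1 _; rewrite ltry.
Qed.

Lemma in_LinfH_scale T s u (k M : R) : 2^-1 < s -> 0 <= M -> in_LinfH T s u ->
  (LinfH_norm T s u <= M%:E)%E ->
  in_LinfH T s (fun t x => k * u t x) /\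
  (LinfH_norm T s (fun t x => (k * u t x)%R) <= (kF * ((`|k| + 1) * (2 * (M + 1))))%:E)%E.
Proof.
move=> s2 M0 [mu fu _].
move=> /(LinfH_normP _ _ _ (_ : (0 <= M%:E)%E)) => /(_ M0) h1.
have k1 : 0 < `|k| + 1 by rewrite ltr_wpDl.
have kk : `|k| <= `|k| + 1 by rewrite lerDl.
have y0 : (0 <= (kF * ((`|k| + 1) * (2 * (M + 1))))%:E)%E.
  by rewrite lee_fin mulr_ge0 ?(ltW kF_gt0) // ?mulr_ge0 ?addr_ge0.
have le1 : (LinfH_norm T s (fun t x => (k * u t x)%R) <= (kF * ((`|k| + 1) * (2 * (M + 1))))%:E)%E.
  apply/LinfH_normP => //; apply: aeS h1 => t a1 Dt.
  have b1 : (Hs_norm s (u t) < (M + 1)%:E)%E by apply: le_lt_trans (a1 Dt) _; rewrite lte_fin ltrDl.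
  exact: Hs_ball_Hs_norm s2 (Hs_ball_scale s2 k1 kk (Hs_norm_Hs_ball b1)).
split=> //; split.
- by move=> x; exact: measurable_funM.
- move=> t Dt; have [N hN] := Hs_norm_fin_ball (fu t Dt).
  apply: le_lt_trans (Hs_ball_Hs_norm s2 (Hs_ball_scale s2 k1 kk hN)) _.
  exact: ltry.
- by apply: le_lt_trans le1 _; rewrite ltry.
Qed.

End Assembly.

Theorem proposition5p2 (R : realType) (s s0 h M : R) :
  2^-1 < s0 -> s0 <= s -> 0 < h ->
  exists (sbar : R) (C : R -> R -> R -> R -> R -> R -> R),
    [/\ 0 <= sbar, positive_nondecreasing6 C
      & forall (mumax epsmax deltamin deltamax T : R)
          (ul ur : param R -> R -> R -> R),
        0 < mumax -> 0 < epsmax -> 0 < deltamin -> 0 < deltamax -> 0 < T ->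
        (forall p, in_params mumax epsmax deltamin deltamax p ->
          [/\ strong_solution p T (ul p) (ur p),
              in_W1 T (s + 3) (ul p) /\ in_W1 T (s + 3) (ur p),
              (W1_norm T (s + 3) (ul p) <= M%:E)%E,
              (W1_norm T (s + 3) (ur p) <= M%:E)%E
            & forall t x, t \in `[0, T[ ->
                h <= h1 p (fun t x => ul p t x + ur p t x) t x /\
                h <= h2 p (fun t x => ul p t x + ur p t x) t x]) ->
        consistent_with_GN mumax epsmax deltamin deltamax sbar C
          (fun p => mu_of p * eps_of p ^+ 2 + eps_of p ^+ 4) s T
          (fun p t x => ul p t x + ur p t x)
          (fun p t x =>
            (gamma_of p + delta_of p) * (ul p t x - ur p t x))].
Proof.
move=> s02 s0s h0; have s2 : 2^-1 < s by exact: lt_le_trans s02 s0s.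
pose K0 : R := \sum_(k < 4) (16 * Kconv (s + k%:R) + Kneu (s + k%:R)).
have Kc k : 0 <= 16 * Kconv (s + k%:R).
  by rewrite mulr_ge0 // (le_trans ler01) // Kconv_ge1.
have Kn k : 0 <= Kneu (s + k%:R).
  by rewrite /Kneu addr_ge0 // mulr_ge0 // (le_trans ler01) // Kwt_ge1.
have K00 : 0 <= K0 by apply: sumr_ge0 => k _; rewrite addr_ge0.
have K0P k : (k <= 3)%N -> 16 * Kconv (s + k%:R) <= K0 /\ Kneu (s + k%:R) <= K0.
  move=> k3; have k4 : (k < 4)%N by [].
  have : 16 * Kconv (s + k%:R) + Kneu (s + k%:R) <= K0.
    rewrite /K0 (bigD1 (Ordinal k4)) //= lerDl; apply: sumr_ge0 => j _.
    by rewrite addr_ge0.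
  by move: (Kc k) (Kn k) => c1 c2 c3; split; apply: le_trans c3; rewrite ?lerDl ?lerDr.
pose A0 : R := 16 + K0 + 2 * (`|M| + 1).
have A00 : 16 <= A0 by rewrite /A0 -addrA lerDl addr_ge0 // mulr_ge0 // addr_ge0.
pose Bf (a1 a2 a3 a4 : R) := A0 + a1 + a2 + a3 + a4.
(* the residues are bounded by B^602; adding two of them costs one more factor B, and the
   factor 2 is for the two equations *)
exists 3, (fun a1 a2 a3 a4 _ _ => 2 * (@kF R * Bf a1 a2 a3 a4 ^+ 603)).
split=> //.
  have A0p : 0 < A0 by apply: lt_le_trans A00.
  split=> [a1 a2 a3 a4 a5 a6 p1 p2 p3 p4 _ _|
    a1 a2 a3 a4 a5 a6 b1 b2 b3 b4 b5 b6 /andP[p1 q1] /andP[p2 q2] /andP[p3 q3] /andP[p4 q4] _ _].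
    by rewrite mulr_gt0 // mulr_gt0 ?kF_gt0 // exprn_gt0 // !ltr_wpDr.
  rewrite ler_pM2l // ler_pM2l ?kF_gt0 //.
  have b0 : 0 <= Bf a1 a2 a3 a4 by rewrite !addr_ge0 // ltW.
  have bb : Bf a1 a2 a3 a4 <= Bf b1 b2 b3 b4 by rewrite /Bf !lerD.
  by rewrite ler_pXn2r // nnegrE // (le_trans b0).
move=> mumax epsmax deltamin deltamax T ul ur mu0 eps0 dmin0 dmax0 T0 H.
pose B := Bf mumax epsmax deltamin^-1 deltamax.
have di0 : 0 < deltamin^-1 by rewrite invr_gt0.
have [AB mB eB dB' diB'] : [/\ A0 <= B, mumax <= B, epsmax <= B, deltamax <= B & deltamin^-1 <= B].
  have A0p : 0 <= A0 by apply: le_trans A00.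
  rewrite /B /Bf; move: mu0 eps0 di0 dmax0; clear -A0p.
  by move: (deltamin^-1) => d' m1 m2 m3 m4; split; lra.
have B16 : 16 <= B by exact: le_trans A00 AB.
have HK k : (k <= 3)%N -> 16 * Kconv (s + k%:R) <= B /\ Kneu (s + k%:R) <= B.
  move=> /K0P[k1 k2]; have KB : K0 <= B.
    by apply: le_trans AB; rewrite /A0 -addrA addrCA lerDl addr_ge0 // mulr_ge0 // addr_ge0.
  by split; [exact: le_trans KB|exact: le_trans KB].
have MB : 2 * (M + 1) <= B.
  apply: le_trans AB; apply: (@le_trans _ _ (2 * (`|M| + 1))); last by rewrite /A0 lerDr addr_ge0.
  by rewrite ler_pM2l // lerD2r ler_norm.
have B0 : 0 < B by apply: lt_le_trans B16.
have s32 : 2^-1 < s + 3 by apply: lt_le_trans s2 _; rewrite lerDl.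
split.
  pose M1 := kF R * (2 * (2 * (`|M| + 1) + (1 + 1) * (2 * (`|M| + 1)))).
  exists (M1 + kF R * ((1 + deltamax + 1) * (2 * (M1 + 1)))) => p pin.
  have [_ [Wl Wr] Ml Mr _] := H p pin; have [_ _ /andP[d1 d2] /andP[g0 g1]] := pin.
  have bnd u : in_W1 T (s + 3) u -> (W1_norm T (s + 3) u <= M%:E)%E ->
      in_LinfH T (s + 3) u /\ (LinfH_norm T (s + 3) u <= `|M|%:E)%E.
    move=> [iu _] WM; split=> //; apply/LinfH_normP; first by rewrite lee_fin.
    apply: aeS (good_times T0 WM) => t ht Dt; have [h1' _] := ht Dt.
    by apply: le_trans h1' _; rewrite lee_fin ler_norm.
  have [il nl] := bnd _ Wl Ml; have [ir nr] := bnd _ Wr Mr.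
  have M00 : 0 <= `|M| by [].
  have [iz nz] := in_LinfH_add 1 s32 M00 il ir nl nr.
  have [iw nw] := in_LinfH_add (-1) s32 M00 il ir nl nr.
  rewrite normr1 in nz; rewrite normrN normr1 in nw.
  have M10 : 0 <= M1.
    by rewrite mulr_ge0 ?(ltW (kF_gt0 R)) // mulr_ge0 // addr_ge0 // ?mulr_ge0 ?addr_ge0.
  have [iv nv] := in_LinfH_scale (gamma_of p + delta_of p) s32 M10 iw nw.
  have ez : (fun t x => ul p t x + 1 * ur p t x) = (fun t x => ul p t x + ur p t x).
    by apply/funext => t; apply/funext => x; rewrite mul1r.
  have ev : (fun t x => (gamma_of p + delta_of p) * (ul p t x + -1 * ur p t x)) =
            (fun t x => (gamma_of p + delta_of p) * (ul p t x - ur p t x)).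
    by apply/funext => t; apply/funext => x; rewrite mulN1r.
  rewrite ez in iz nz; rewrite ev in iv nv.
  have t0 : 0 < gamma_of p + delta_of p by rewrite ltr_wpDl // (lt_trans dmin0).
  have kk : 0 <= kF R by exact: ltW (kF_gt0 R).
  split=> //.
    apply: le_trans nz _; rewrite lee_fin lerDl mulr_ge0 // mulr_ge0 //.
      by rewrite addr_ge0 // addr_ge0 // ltW.
    by rewrite mulr_ge0 // addr_ge0.
  apply: le_trans nv _; rewrite lee_fin (ger0_norm (ltW t0)).
  apply: ler_wpDl => //; rewrite ler_wpM2l // ler_wpM2r ?mulr_ge0 ?addr_ge0 //.
  by rewrite lerD2r lerD // ltW.
(* this makes e B^10 at most 1, more than the Neumann series require *)
exists ((B ^- 10) ^+ 4); first by rewrite exprn_gt0 // invr_gt0 exprn_gt0.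
move=> p pin etap.
have [sol [Wl Wr] Ml Mr hh] := H p pin.
have [/andP[m0 m1] /andP[e0 e1] /andP[d1 d2] /andP[g0 g1]] := pin.
have d0 : 0 < delta_of p by exact: lt_trans d1.
have [N [mN N0 sN]] := aeI (good_times T0 Ml) (good_times T0 Mr).
(* the times at which the four norms are at most M *)
pose E := [set` `[(0:R), T[] `\` N.
have mE : measurable E by apply: measurableD => //; exact: mD.
have ED : E `<=` [set` `[(0:R), T[] by move=> t [].
have Eae : {ae @lebesgue_measure R, forall t, [set` `[(0:R), T[] t -> E t}.
  by exists N; split=> // t /= nt; apply: contrapT => Nt; apply: nt => Dt; split.
have EP t : E t -> ((Hs_norm (s + 3) (ul p t) <= M%:E)%E /\ (Hs_norm (s + 3 - 1) (dt T (ul p) t) <= M%:E)%E) /\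
    ((Hs_norm (s + 3) (ur p t) <= M%:E)%E /\ (Hs_norm (s + 3 - 1) (dt T (ur p) t) <= M%:E)%E).
  move=> [Dt Nt]; apply: contrapT => hN; apply: Nt; apply: sN => /= -[l1 l2].
  by apply: hN; split; [exact: l1|exact: l2].
have Xl := W1B_of_W1 s2 B16 T0 HK mE ED Eae MB Wl (fun t Et => (EP t Et).1).
have Xr := W1B_of_W1 s2 B16 T0 HK mE ED Eae MB Wr (fun t Et => (EP t Et).2).
have Gl u t x : E t -> dt T u t x = \1_E t * dt T u t x.
  by move=> Et; rewrite indicE mem_set // mul1r.
have eB' : `|eps_of p| <= B by rewrite ger0_norm // (le_trans e1).
have muB : `|mu_of p| <= B by rewrite ger0_norm // (le_trans m1).
have dB : delta_of p <= B by rewrite (le_trans (ltW d2)).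
have diB : (delta_of p)^-1 <= B by apply: le_trans diB'; rewrite lef_pV2 ?posrE // ltW.
set eta := mu_of p * eps_of p ^+ 2 + eps_of p ^+ 4 in etap *.
have q1 : 0 <= mu_of p * eps_of p ^+ 2 by rewrite mulr_ge0 // exprn_ge0.
have q2 : 0 <= eps_of p ^+ 4 by rewrite exprn_ge0.
have eta0 : 0 <= eta by rewrite addr_ge0.
have eS : eps_of p * B ^+ 10 <= 1.
  have : eps_of p ^+ 4 <= (B ^- 10) ^+ 4 by apply: le_trans etap; rewrite /eta lerDr.
  rewrite ler_pXn2r ?nnegrE // ?invr_ge0 ?exprn_ge0 ?(ltW B0) // => h1'.
  by rewrite -ler_pdivlMr ?exprn_gt0 // mul1r.
have hH1 t x : [set` `[(0:R), T[] t -> h <= h1 p (fun t x => ul p t x + ur p t x) t x by move=> Dt; have [] := hh t x Dt.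
have hH2 t x : [set` `[(0:R), T[] t -> h <= h2 p (fun t x => ul p t x + ur p t x) t x by move=> Dt; have [] := hh t x Dt.
have [A1 [A2 [A3 [[mA1 mA2 mA3] hA GN]]]] :=
  GN_remainder s2 B16 T0 HK ED Eae eB' erefl e0 eS d0 dB diB g0 g1 Xl Xr h0 hH1 hH2
   (Gl _) (Gl _) muB sol.
(* for eta = 0 the quotients below are 0, and so are both numerators *)
pose k1 := eps_of p ^+ 4 / eta; pose k2 := mu_of p * eps_of p ^+ 2 / eta.
have k1E : eta * k1 = eps_of p ^+ 4.
  rewrite /k1 mulrC; have [z|nz] := eqVneq eta 0; last by rewrite divfK.
  rewrite z mulr0; apply/le_anti; rewrite q2 /=; move: z; rewrite /eta => z.
  by move: q1 q2 z; move: (mu_of p * _) (eps_of p ^+ 4) => a b; lra.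
have k2E : eta * k2 = mu_of p * eps_of p ^+ 2.
  rewrite /k2 mulrC; have [z|nz] := eqVneq eta 0; last by rewrite divfK.
  rewrite z mulr0; apply/le_anti; rewrite q1 /=; move: z; rewrite /eta => z.
  by move: q1 q2 z; move: (mu_of p * _) (eps_of p ^+ 4) => a b; lra.
have kle (q : R) : 0 <= q -> q <= eta -> `|q / eta| <= B ^+ 0.
  move=> q0 qe; rewrite expr0 ger0_norm ?divr_ge0 //.
  have [z|nz] := eqVneq eta 0; first by rewrite z invr0 mulr0.
  by rewrite ler_pdivrMr ?mul1r // lt_neqAle eq_sym nz.
have k1B : `|k1| <= B ^+ 0 by apply: kle => //; rewrite /eta lerDr.
have k2B : `|k2| <= B ^+ 0 by apply: kle => //; rewrite /eta lerDl.
have h1A t : E t -> Hs_ball s (B ^+ 603) (fun x => k1 * A1 t x).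
  move=> Et; have [a1 _ _] := hA t Et.
  by have := HsB_le B16 (leqnn 0) (_ : (0 + 600 <= 603)%N) (HsB_scale s2 B16 k1B a1); rewrite /HsB addr0; apply.
have h2A t : E t -> Hs_ball s (B ^+ 603) (fun x => k1 * A2 t x + k2 * A3 t x).
  move=> Et; have [_ a2 a3] := hA t Et.
  have := HsB_le B16 (leqnn 0) (_ : ((maxn (0 + 600) (0 + 602)).+1 <= 603)%N)
    (HsB_add s2 B16 (HsB_scale s2 B16 k1B a2) (HsB_scale s2 B16 k2B a3)).
  by rewrite /HsB addr0; apply.
have [i1 n1] := LinfH_of_HsB s2 B16 mE ED Eae (fun x => measurable_funM (@measurable_cst _ _ _ _ _ k1) (mA1 x)) h1A.
have [i2 n2] := LinfH_of_HsB s2 B16 mE ED Eae (fun x => measurable_funD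
  (measurable_funM (@measurable_cst _ _ _ _ _ k1) (mA2 x)) (measurable_funM (@measurable_cst _ _ _ _ _ k2) (mA3 x))) h2A.
exists (fun t x => \1_E t * (k1 * A1 t x)), (fun t x => \1_E t * (k1 * A2 t x + k2 * A3 t x)).
split=> //; last first.
  apply: le_trans (leeD n1 n2) _.
  by rewrite -EFinD lee_fin -/B [leRHS]mulr_natl mulr2n.
have [dz dw GN'] := GN; split=> //.
apply: aeS (aeI Eae GN') => t [h1' h2'] Dt x; have Et := h1' Dt; have [g1' g2'] := h2' Dt x.
have I1 : \1_E t = 1 :> R by rewrite indicE mem_set.
split; [apply: (eq_trans g1')|apply: (eq_trans g2')]; rewrite I1 mul1r -k1E.
  by rewrite mulrA.
by rewrite -k2E mulrDr !mulrA.
Qed.
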